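(* There exist $\delta_0>0$ and a function $E:(0,\infty)\to(0,\infty)$ growing slower than any polynomial such that, with $\beta=1/6$ and $\epsilon(\delta)=E(1/\delta)\,\delta^{\beta}$, the following holds. For every $\delta\in(0,\delta_0)$, every $n\ge 1$ and all self-adjoint contractions $A,B\in M_n(\mathbb{C})$ with $\|[A,B]\|\le\delta$, there exist self-adjoint $A',B'\in M_n(\mathbb{C})$ such that $[A',B']=0$ and $$\|A-A'\|\le\epsilon(\delta),\qquad \|B-B'\|\le \epsilon(\delta).$$
   Context: $\|\cdot\|$ is the operator norm on $M_n(\mathbb{C})$, and $[A,B]=AB-BA$. A contraction is a matrix of operator norm at most $1$. ''Growing slower than any polynomial'' means $\lim_{t\to\infty}E(t)/t^{a}=0$ for every $a>0$. The number $\delta_0$ and the function $E$ do not depend on $n$, $A$, $B$. *)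

(* Defs.v *)
From HB Require Import structures.
From mathcomp Require Import all_boot all_order all_algebra.
From mathcomp Require Import complex.
From mathcomp Require Import all_classical all_reals all_analysis.

Set Implicit Arguments.
Unset Strict Implicit.
Unset Printing Implicit Defensive.
Import Order.TTheory GRing.Theory Num.Theory.
Import numFieldNormedType.Exports.
Local Open Scope classical_set_scope.
Local Open Scope ring_scope.

Definition l2norm (R : realType) (n : nat) (v : 'cV[R[i]]_n) : R :=
  Num.sqrt (\sum_(i < n) ComplexField.Normc.normc (v i 0) ^+ 2).

(* The library's own norm on matrices is the entrywise maximum, which is not
   the norm wanted here. The set below is nonempty and bounded (opnorm_has_sup),
   so that this supremum is not a default value. *)
Definition opnorm (R : realType) (n : nat) (A : 'M[R[i]]_n) : R :=
  sup [set l2norm (A *m v) | v in [set v : 'cV[R[i]]_n | l2norm v <= 1]].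

Definition commutator (R : realType) (n : nat) (A B : 'M[R[i]]_n) : 'M[R[i]]_n :=
  A *m B - B *m A.

Definition subpolynomial (R : realType) (E : R -> R) : Prop :=
  forall a : R, 0 < a -> E t / t `^ a @[t --> +oo] --> 0.

Lemma opnorm_has_sup (R : realType) (n : nat) (A : 'M[R[i]]_n) :
  has_sup [set l2norm (A *m v) | v in [set v : 'cV[R[i]]_n | l2norm v <= 1]].
Proof.
split.
  exists (l2norm (A *m 0)), 0 => //=; rewrite /l2norm big1 ?sqrtr0 // => i _.
  by rewrite mxE ComplexField.Normc.normc0 expr0n.
have n_ge0 (z : R[i]) : 0 <= ComplexField.Normc.normc z.
  by case: z => a b; exact: sqrtr_ge0.
exists (Num.sqrt (\sum_(i < n)
  (\sum_(j < n) ComplexField.Normc.normc (A i j)) ^+ 2)) => _ [v /= v1 <-].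
have vj j : ComplexField.Normc.normc (v j 0) <= 1.
  apply: le_trans v1; rewrite -[leLHS]ger0_norm // -sqrtr_sqr ler_wsqrtr //.
  by rewrite (bigD1 j) //= lerDl sumr_ge0 // => k _; exact: sqr_ge0.
rewrite ler_wsqrtr //; apply: ler_sum => i _.
rewrite ler_sqr ?nnegrE ?sumr_ge0 // mxE.
elim/big_ind2: _ => [|x1 x2 y1 y2 h1 h2|j _].
- by rewrite ComplexField.Normc.normc0.
- by apply: le_trans (le_normcD _ _) _; exact: lerD.
- by rewrite ComplexField.Normc.normcM ler_piMr.
Qed.

(* Main.v *)
Require Import Defs.
From HB Require Import structures.
From mathcomp Require Import all_boot all_order all_algebra.
From mathcomp Require Import complex.
From mathcomp Require Import all_classical all_reals all_analysis.
From mathcomp Require Import ring lra.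

Set Implicit Arguments.
Unset Strict Implicit.
Unset Printing Implicit Defensive.
Import Order.TTheory GRing.Theory Num.Theory.
Import numFieldNormedType.Exports.
Local Open Scope classical_set_scope.
Local Open Scope ring_scope.

(** Rescale [A] and [B] by [N = delta^(-1/6)], which is at least [1]. They then
have norm at most [N], their commutator is tiny compared with [N^-2], and it
suffices to find commuting Hermitian matrices within a constant of them,
uniformly in [N] and in the dimension. So [epsilon(delta) = 17 delta^(1/6)]
will do, and [E] can be constant.

Strips. Cut the spectrum of [B] into intervals of length 2 and replace [A] by
its block diagonal part [Ac] for the corresponding spectral projections. The
blocks lost may be large, because nothing separates the spectra of adjacent
strips. Suppose, however, that each strip carries a projection [P] which contains
the lower end of the strip, avoids the upper end, and for which the block
[(1 - P) Ac P] is bounded ([exact_cut]). Glue the upper part [1 - P] of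
each strip to the lower part [P] of the next one. On two different glued blocks
the values of [B], apart from the two halves of one strip, are separated by
[1/20], so [A] almost vanishes between them; between the two halves of one
strip, [A] is bounded by the property of [P]. Hence the part [A'] of [A] inside
the glued blocks is at bounded distance from [A], and it commutes with the
matrix [B'] that takes a constant value on each glued block
([commuting_at_unit_scale]).

Cuts. It remains to cut one strip, that is to treat the case where [B] is a
contraction while [A] has norm up to [N]. The projection [p] is the spectral
projection on the nonpositive axis of some [phi] which is close enough to [B] to
have the right sign where [B] is close to [1] or to [-1], and which commutes
exactly with some [K] at bounded distance from [A]; then [p A - A p] equals the
commutator of [p] with [A - K], and it is bounded ([approx_cut]). One would like
[K] to be the integer part of [A], and [phi] to be the block diagonal part of
[B] for the spectral projections of [K]. This is fine away from the integers
([pinch_cells_near]) but not near them, where the integer part jumps.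
The projection [p] is right at the two ends of the strip up to a small error;
correcting it there smoothly and rounding the result gives [P] ([exact_ends]).

Jumps. Near an integer let [D] be the distance of [A] to this integer, with its
sign. Then [D + iB] is almost normal. Shift it slightly to make it invertible,
which is possible in finite dimension, and let [U] be the unitary factor of its
polar decomposition. The real part [X] and the imaginary part [Y] of [U] commute
exactly, and they have approximately the signs of [D] and [B], as far as [D] and
[B] stay away from [0] ([polar_parts], [compression_gap]). So the spectral
projection of [X] on the positive axis is a jump that commutes exactly with [Y],
and [Y] is an admissible value of [phi] near the jump ([local_model]). All
integers are treated at once, with [D] the signed distance of [A] to the nearest
integer, and [glued_cut] combines the two descriptions of [phi] by means of two
cutoffs in [D] whose squares add up to at least [1].

Two tools are used throughout. If the spectra of two Hermitian matrices are
separated by a gap, a matrix [Y] between the corresponding spectral subspaces is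
bounded by its commutator divided by the gap ([sylvester], [gap_le]). As a
consequence, approximate commutation passes to continuous functions of a
Hermitian matrix, with bounds that do not depend on the dimension
([fc_intertwine_approx]). *)

(** * Adjoints and the real inner product *)

HB.lock Definition adj (R : realType) m n (A : 'M[R[i]]_(m, n)) : 'M[R[i]]_(n, m) :=
  map_mx Num.conj A^T.

(** The real part of the Hermitian inner product, which suffices for norms and for
the quadratic forms of Hermitian matrices. *)
HB.lock Definition rip (R : realType) n (u v : 'cV[R[i]]_n) : R :=
  complex.Re ((adj u *m v) 0 0).

Section InnerProduct.
Context {R : realType}.
Local Notation C := R[i].

Lemma adjE m n (A : 'M[C]_(m, n)) i j : adj A i j = Num.conj (A j i).
Proof. by rewrite adj.unlock !mxE. Qed.

Lemma adjK m n (A : 'M[C]_(m, n)) : adj (adj A) = A.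
Proof. by apply/matrixP=> i j; rewrite !adjE conjCK. Qed.

Lemma adjD m n (A B : 'M[C]_(m, n)) : adj (A + B) = adj A + adj B.
Proof. by apply/matrixP=> i j; rewrite !(mxE, adjE) rmorphD. Qed.

Lemma adjN m n (A : 'M[C]_(m, n)) : adj (- A) = - adj A.
Proof. by apply/matrixP=> i j; rewrite !(mxE, adjE) rmorphN. Qed.

Lemma adjB m n (A B : 'M[C]_(m, n)) : adj (A - B) = adj A - adj B.
Proof. by rewrite adjD adjN. Qed.

Lemma adjZ m n (c : C) (A : 'M[C]_(m, n)) : adj (c *: A) = (Num.conj c) *: adj A.
Proof. by apply/matrixP=> i j; rewrite !(mxE, adjE) rmorphM. Qed.

Lemma adj0 m n : adj (0 : 'M[C]_(m, n)) = 0.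
Proof. by apply/matrixP=> i j; rewrite !(mxE, adjE) rmorph0. Qed.

Lemma adj_mulmx m n p (A : 'M[C]_(m, n)) (B : 'M[C]_(n, p)) :
  adj (A *m B) = adj B *m adj A.
Proof.
by apply/matrixP=> i j; rewrite !(mxE, adjE) rmorph_sum; apply: eq_bigr => k _;
   rewrite rmorphM mulrC !adjE.
Qed.

Lemma adjM n (A B : 'M[C]_n) : adj (A * B) = adj B * adj A.
Proof. exact: adj_mulmx. Qed.

Lemma scalemulAl n (c : C) (A B : 'M[C]_n) : c *: A * B = c *: (A * B).
Proof. exact: esym (scalemxAl _ _ _). Qed.

Lemma scalemulAr n (c : C) (A B : 'M[C]_n) : A * (c *: B) = c *: (A * B).
Proof. exact: esym (scalemxAr _ _ _). Qed.

Lemma comm_scale n (c : C) (A B : 'M[C]_n) : GRing.comm A B -> GRing.comm A (c *: B).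
Proof. by move=> AB; rewrite /GRing.comm scalemulAr scalemulAl AB. Qed.

Lemma entryD m n (A B : 'M[C]_(m, n)) k l : (A + B) k l = A k l + B k l.
Proof. by rewrite mxE. Qed.

Lemma entryN m n (A : 'M[C]_(m, n)) k l : (- A) k l = - A k l.
Proof. by rewrite mxE. Qed.

Lemma entryZ m n (c : C) (A : 'M[C]_(m, n)) k l : (c *: A) k l = c * A k l.
Proof. by rewrite mxE. Qed.

Lemma mulmx_app n (A B : 'M[C]_n) (v : 'cV[C]_n) : (A * B) *m v = A *m (B *m v).
Proof. by rewrite mulmxA. Qed.

Lemma adj1 n : adj (1 : 'M[C]_n) = 1.
Proof.
by apply/matrixP=> i j; rewrite !(mxE, adjE) eq_sym; case: eqP; rewrite ?rmorph1 ?rmorph0.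
Qed.

Lemma adj_sum m n I (r : seq I) (P : pred I) (F : I -> 'M[C]_(m, n)) :
  adj (\sum_(i <- r | P i) F i) = \sum_(i <- r | P i) adj (F i).
Proof. by elim/big_rec2: _ => [|i x y _ <-]; rewrite ?adj0 ?adjD. Qed.

Lemma ReD (x y : C) : complex.Re (x + y) = complex.Re x + complex.Re y.
Proof. by case: x; case: y. Qed.

Lemma Re_sum I (r : seq I) (P : pred I) (F : I -> C) :
  complex.Re (\sum_(i <- r | P i) F i) = \sum_(i <- r | P i) complex.Re (F i).
Proof. by elim/big_rec2: _ => [|i x y _ <-]; rewrite ?ReD. Qed.

Lemma Re_conjM (x y : C) :
  complex.Re (Num.conj x * y) = complex.Re x * complex.Re y + complex.Im x * complex.Im y.
Proof. by case: x => a b; case: y => c d /=; rewrite mulNr opprK. Qed.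

Lemma ripE n (u v : 'cV[C]_n) :
  rip u v = \sum_i (complex.Re (u i 0) * complex.Re (v i 0) +
                    complex.Im (u i 0) * complex.Im (v i 0)).
Proof.
by rewrite rip.unlock mxE Re_sum; apply: eq_bigr => i _; rewrite adjE Re_conjM.
Qed.

Lemma ripC n (u v : 'cV[C]_n) : rip u v = rip v u.
Proof. by rewrite !ripE; apply: eq_bigr => i _; ring. Qed.

Lemma ripDr n (u v w : 'cV[C]_n) : rip u (v + w) = rip u v + rip u w.
Proof. by rewrite rip.unlock mulmxDr mxE ReD. Qed.

Lemma ripDl n (u v w : 'cV[C]_n) : rip (u + v) w = rip u w + rip v w.
Proof. by rewrite !(ripC _ w) ripDr. Qed.

Lemma rip0r n (u : 'cV[C]_n) : rip u 0 = 0.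
Proof. by rewrite rip.unlock mulmx0 mxE. Qed.

Lemma ripNr n (u v : 'cV[C]_n) : rip u (- v) = - rip u v.
Proof. by apply/eqP; rewrite -addr_eq0 -ripDr addNr rip0r. Qed.

Lemma ripNl n (u v : 'cV[C]_n) : rip (- u) v = - rip u v.
Proof. by rewrite ripC ripNr ripC. Qed.

Lemma ripZr n (x : R) (u v : 'cV[C]_n) : rip u (x%:C%C *: v) = x * rip u v.
Proof. by rewrite rip.unlock -scalemxAr mxE; case: (_ 0 0) => a b /=; rewrite mul0r subr0. Qed.

Lemma ripZl n (x : R) (u v : 'cV[C]_n) : rip (x%:C%C *: u) v = x * rip u v.
Proof. by rewrite ripC ripZr ripC. Qed.

Lemma rip_suml n I (r : seq I) (P : pred I) (F : I -> 'cV[C]_n) v :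
  rip (\sum_(i <- r | P i) F i) v = \sum_(i <- r | P i) rip (F i) v.
Proof.
elim/big_rec2: _ => [|i x y _ <-]; last by rewrite ripDl.
by rewrite ripC rip0r.
Qed.

Lemma rip_sumr n I (r : seq I) (P : pred I) (F : I -> 'cV[C]_n) v :
  rip v (\sum_(i <- r | P i) F i) = \sum_(i <- r | P i) rip v (F i).
Proof. by rewrite ripC rip_suml; apply: eq_bigr => i _; rewrite ripC. Qed.

Lemma rip_adj m n (A : 'M[C]_(m, n)) u v : rip u (A *m v) = rip (adj A *m u) v.
Proof. by rewrite rip.unlock adj_mulmx adjK mulmxA. Qed.

Lemma rip_ge0 n (v : 'cV[C]_n) : 0 <= rip v v.
Proof. by rewrite ripE sumr_ge0 // => i _; rewrite addr_ge0 // -expr2 sqr_ge0. Qed.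

Lemma l2norm_ge0 n (v : 'cV[C]_n) : 0 <= l2norm v.
Proof. exact: sqrtr_ge0. Qed.

Lemma l2norm_sqr n (v : 'cV[C]_n) : l2norm v ^+ 2 = rip v v.
Proof.
have normc_sqr (z : C) : ComplexField.Normc.normc z ^+ 2 =
    complex.Re z * complex.Re z + complex.Im z * complex.Im z.
  by case: z => a b /=; rewrite sqr_sqrtr ?addr_ge0 ?sqr_ge0 // !expr2.
rewrite sqr_sqrtr; last by apply: sumr_ge0 => i _; exact: sqr_ge0.
by rewrite ripE; apply: eq_bigr => i _; rewrite normc_sqr.
Qed.

Lemma l2norm_eq n (u v : 'cV[C]_n) : rip u u = rip v v -> l2norm u = l2norm v.
Proof.
by move=> e; apply/eqP; rewrite -(eqrXn2 (n := 2)) ?l2norm_ge0 ?l2norm_sqr ?e.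
Qed.

Lemma l2normN n (v : 'cV[C]_n) : l2norm (- v) = l2norm v.
Proof. by apply: l2norm_eq; rewrite ripNl ripNr opprK. Qed.

Lemma l2norm0 n : l2norm (0 : 'cV[C]_n) = 0.
Proof. by apply/eqP; rewrite -sqrf_eq0 l2norm_sqr rip0r. Qed.

Lemma l2norm_Zi n (v : 'cV[C]_n) : l2norm ('i *: v) = l2norm v.
Proof.
apply: l2norm_eq; rewrite rip.unlock adjZ -scalemxAl -scalemxAr scalerA conjCi.
by rewrite mulNr -expr2 sqrCi opprK scale1r.
Qed.

Lemma l2normZ n (x : R) (v : 'cV[C]_n) : l2norm (x%:C%C *: v) = `|x| * l2norm v.
Proof.
apply/eqP; rewrite -(eqrXn2 (n := 2)) ?mulr_ge0 ?l2norm_ge0 //.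
by rewrite exprMn real_normK ?num_real // !l2norm_sqr ripZl ripZr mulrA expr2.
Qed.

Lemma l2norm_eq0 n (v : 'cV[C]_n) : l2norm v = 0 -> v = 0.
Proof.
move=> v0; have := l2norm_sqr v; rewrite v0 expr0n /= ripE => /esym/eqP.
rewrite psumr_eq0 => [/allP v00|i _]; last by rewrite addr_ge0 // -expr2 sqr_ge0.
apply/matrixP=> i j; rewrite ord1 mxE; have := v00 i (mem_index_enum _).
rewrite /= -!expr2 paddr_eq0 ?sqr_ge0 // !sqrf_eq0; case: (v i 0) => a b /=.
by case/andP=> /eqP-> /eqP->.
Qed.

Lemma cauchy_schwarz n (u v : 'cV[C]_n) : rip u v <= l2norm u * l2norm v.
Proof.
have [/l2norm_eq0->|u0] := eqVneq (l2norm u) 0; first by rewrite ripC rip0r l2norm0 mul0r.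
have [/l2norm_eq0->|v0] := eqVneq (l2norm v) 0; first by rewrite rip0r l2norm0 mulr0.
have uv0 : 0 < l2norm u * l2norm v by rewrite mulr_gt0 // lt0r ?u0 ?v0 l2norm_ge0.
have := rip_ge0 ((l2norm v)%:C%C *: u - (l2norm u)%:C%C *: v).
rewrite ripDl !ripDr !ripNl !ripNr !ripZl !ripZr (ripC v u) -!l2norm_sqr => h.
by rewrite -(ler_pM2l uv0); nra.
Qed.

Lemma l2normD n (u v : 'cV[C]_n) : l2norm (u + v) <= l2norm u + l2norm v.
Proof.
rewrite -ler_sqr ?nnegrE ?addr_ge0 ?l2norm_ge0 // l2norm_sqr ripDl !ripDr.
rewrite (ripC v u) -!l2norm_sqr; have := cauchy_schwarz u v; lra.
Qed.

End InnerProduct.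

(** A name for products that does not depend on the algebraic structure through
which they were elaborated. *)
Definition mxprod (R : realType) n (A B : 'M[R[i]]_n) : 'M[R[i]]_n := A *m B.

(** Linear identities between matrices, with products treated as atoms: they
hold as soon as they hold entrywise by commutative ring reasoning. *)
Ltac mx_linear :=
  repeat match goal with
  | |- context [@GRing.mul ?T ?A ?B] => change (@GRing.mul T A B) with (mxprod A B)
  end;
  repeat match goal with
  | |- context [@mxprod ?T ?n ?A ?B] => generalize (@mxprod T n A B); intro
  end;
  let k := fresh "k" in let l := fresh "l" in
  apply/matrixP => k l;
  repeat match goal with
  | |- context [fun_of_matrix (?A + ?B) k l] => rewrite (entryD A B k l)
  | |- context [fun_of_matrix (- ?A) k l] => rewrite (entryN A k l)
  | |- context [fun_of_matrix (?c *: ?A) k l] => rewrite (entryZ c A k l)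
  end;
  repeat match goal with
  | |- context [@fun_of_matrix ?T ?m ?n ?A k l] =>
      generalize (@fun_of_matrix T m n A k l); intro
  end; ring.

(** * The operator norm *)

(** A sealed copy of the operator norm: unification must never look into the
supremum that defines it. *)
HB.lock Definition opn (R : realType) n (A : 'M[R[i]]_n) : R := opnorm A.

Section OperatorNorm.
Context {R : realType}.
Local Notation C := R[i].

Lemma opnE n (A : 'M[C]_n) : opn A = opnorm A.
Proof. by rewrite opn.unlock. Qed.

Lemma opnorm_ge0 n (A : 'M[C]_n) : 0 <= opn A.
Proof.
rewrite opnE; apply: ub_le_sup; first by case: (opnorm_has_sup A).
by exists 0; rewrite /= ?mulmx0 l2norm0.
Qed.

Lemma l2norm_mulmx n (A : 'M[C]_n) v : l2norm (A *m v) <= opn A * l2norm v.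
Proof.
have [/l2norm_eq0->|v0] := eqVneq (l2norm v) 0; first by rewrite mulmx0 l2norm0 mulr0.
have v_gt0 : 0 < l2norm v by rewrite lt0r v0 l2norm_ge0.
rewrite -ler_pdivrMr // mulrC -[X in X * _]ger0_norm ?invr_ge0 ?l2norm_ge0 //.
rewrite -l2normZ scalemxAr opnE; apply: ub_le_sup; first by case: (opnorm_has_sup A).
by eexists => //=; rewrite l2normZ ger0_norm ?invr_ge0 ?l2norm_ge0 // mulVf.
Qed.

Lemma opnorm_le n (A : 'M[C]_n) c :
  (forall v, l2norm v <= 1 -> l2norm (A *m v) <= c) -> opn A <= c.
Proof.
move=> h; rewrite opnE; apply: ge_sup; first by case: (opnorm_has_sup A).
by move=> _ [v /= v1 <-]; exact: h.
Qed.

Lemma opnorm_le_mul n (A : 'M[C]_n) c : 0 <= c ->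
  (forall v, l2norm (A *m v) <= c * l2norm v) -> opn A <= c.
Proof.
by move=> c0 h; apply: opnorm_le => v v1; apply: le_trans (h v) _; exact: ler_piMr.
Qed.

Lemma opnormD n (A B : 'M[C]_n) : opn (A + B) <= opn A + opn B.
Proof.
apply: opnorm_le_mul => [|v]; first by rewrite addr_ge0 ?opnorm_ge0.
rewrite mulmxDl mulrDl; apply: le_trans (l2normD _ _) _.
by rewrite lerD ?l2norm_mulmx.
Qed.

Lemma opnormN n (A : 'M[C]_n) : opn (- A) = opn A.
Proof.
have le (B : 'M[C]_n) : opn (- B) <= opn B.
  apply: opnorm_le_mul => [|v]; first exact: opnorm_ge0.
  by rewrite mulNmx l2normN l2norm_mulmx.
by apply/le_anti/andP; split; [exact: le|rewrite -{1}[A]opprK; exact: le].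
Qed.

Lemma opnormBC n (A B : 'M[C]_n) : opn (A - B) = opn (B - A).
Proof. by rewrite -opnormN opprB. Qed.

Lemma opnormB n (A B : 'M[C]_n) : opn (A - B) <= opn A + opn B.
Proof. by rewrite -(opnormN B) opnormD. Qed.

Lemma opnormM n (A B : 'M[C]_n) : opn (A * B) <= opn A * opn B.
Proof.
apply: opnorm_le_mul => [|v]; first by rewrite mulr_ge0 ?opnorm_ge0.
rewrite -mulmxA -mulrA; apply: le_trans (l2norm_mulmx _ _) _.
by rewrite ler_wpM2l ?opnorm_ge0 ?l2norm_mulmx.
Qed.

Lemma opnormM_le n (A B : 'M[C]_n) a b :
  opn A <= a -> opn B <= b -> opn (A * B) <= a * b.
Proof.
by move=> Aa Bb; apply: le_trans (opnormM _ _) _; apply: ler_pM; rewrite ?opnorm_ge0.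
Qed.

Lemma opnormD_le n (A B : 'M[C]_n) a b :
  opn A <= a -> opn B <= b -> opn (A + B) <= a + b.
Proof. by move=> Aa Bb; apply: le_trans (opnormD _ _) _; exact: lerD. Qed.

Lemma opnormB_le n (A B : 'M[C]_n) a b :
  opn A <= a -> opn B <= b -> opn (A - B) <= a + b.
Proof. by rewrite -(opnormN B); exact: opnormD_le. Qed.

Lemma opnorm0 n : opn (0 : 'M[C]_n) = 0.
Proof.
apply/eqP; rewrite eq_le opnorm_ge0 andbT; apply: opnorm_le_mul => // v.
by rewrite mul0mx l2norm0 mul0r.
Qed.

Lemma opnormZ n (x : R) (A : 'M[C]_n) : opn (x%:C%C *: A) <= `|x| * opn A.
Proof.
apply: opnorm_le_mul => [|v]; first by rewrite mulr_ge0 ?opnorm_ge0.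
by rewrite -scalemxAl l2normZ -mulrA ler_wpM2l ?l2norm_mulmx.
Qed.

Lemma opnorm_Zi n (A : 'M[C]_n) : opn ('i *: A) <= opn A.
Proof.
apply: opnorm_le_mul => [|v]; first exact: opnorm_ge0.
by rewrite -scalemxAl l2norm_Zi l2norm_mulmx.
Qed.

Lemma opnorm_adj_le n (A : 'M[C]_n) : opn (adj A) <= opn A.
Proof.
apply: opnorm_le_mul => [|v]; first exact: opnorm_ge0.
set w := adj A *m v; have [->|w0] := eqVneq (l2norm w) 0.
  by rewrite mulr_ge0 ?opnorm_ge0 ?l2norm_ge0.
have w_gt0 : 0 < l2norm w by rewrite lt0r w0 l2norm_ge0.
rewrite -(ler_pM2r w_gt0) -expr2 l2norm_sqr {1}/w -rip_adj.
apply: le_trans (cauchy_schwarz _ _) _; rewrite mulrC mulrAC ler_wpM2r ?l2norm_ge0 //.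
exact: l2norm_mulmx.
Qed.

Lemma opnorm_adj n (A : 'M[C]_n) : opn (adj A) = opn A.
Proof. by apply/le_anti/andP; split; [|rewrite -{1}[A]adjK]; exact: opnorm_adj_le. Qed.

Lemma opnorm_isometry n (U : 'M[C]_n) : adj U * U = 1 -> opn U <= 1.
Proof.
move=> UU; apply: opnorm_le_mul => // v; rewrite mul1r le_eqVlt; apply/orP; left.
apply/eqP/l2norm_eq; rewrite rip_adj mulmxA.
by have -> : adj U *m U = 1%:M by []; rewrite mul1mx.
Qed.

Lemma opnorm1 n : opn (1 : 'M[C]_n) <= 1.
Proof. by apply: opnorm_isometry; rewrite adj1 mulr1. Qed.

End OperatorNorm.

(** * Functional calculus of Hermitian matrices *)

Definition herm (R : realType) n (X : 'M[R[i]]_n) := adj X = X.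

HB.lock Definition rdiag (R : realType) n (d : 'I_n -> R) : 'M[R[i]]_n :=
  diag_mx (\row_j (d j)%:C%C).

(** Eigenvalues are stored by the spectral theorem as complex numbers; they are real
when [X] is Hermitian. *)
HB.lock Definition ev (R : realType) n (X : 'M[R[i]]_n) (j : 'I_n) : R :=
  complex.Re (spectral_diag X 0 j).

(** The functional calculus [f(X)] of a Hermitian matrix [X]. *)
HB.lock Definition fc (R : realType) n (f : R -> R) (X : 'M[R[i]]_n) : 'M[R[i]]_n :=
  adj (spectralmx X) * rdiag (fun j => f (ev X j)) * spectralmx X.

Section FunctionalCalculus.
Context {R : realType}.
Local Notation C := R[i].
Implicit Types (f g : R -> R).

Lemma hermsymmxP n (X : 'M[C]_n) : X \is hermsymmx <-> herm X.
Proof.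
rewrite /herm; split => [/is_hermitianmxP|h].
  by rewrite adj.unlock expr0 scale1r => {2}->.
by apply/is_hermitianmxP; rewrite expr0 scale1r -[LHS]h adj.unlock.
Qed.

Lemma hermD n (X Y : 'M[C]_n) : herm X -> herm Y -> herm (X + Y).
Proof. by rewrite /herm adjD => -> ->. Qed.
Lemma hermN n (X : 'M[C]_n) : herm X -> herm (- X).
Proof. by rewrite /herm adjN => ->. Qed.
Lemma hermB n (X Y : 'M[C]_n) : herm X -> herm Y -> herm (X - Y).
Proof. by rewrite /herm adjB => -> ->. Qed.
Lemma herm1 n : herm (1 : 'M[C]_n).
Proof. by rewrite /herm adj1. Qed.
Lemma hermZ n (x : R) (X : 'M[C]_n) : herm X -> herm (x%:C%C *: X).
Proof. by rewrite /herm adjZ => ->; congr (_ *: _); rewrite /Num.conj /= /conjc /= oppr0. Qed.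
Lemma herm_conj n (X Y : 'M[C]_n) : herm X -> herm (Y * X * adj Y).
Proof. by rewrite /herm !adjM adjK => ->; rewrite mulrA. Qed.

Lemma rdiagl n p (d : 'I_n -> R) (M : 'M[C]_(n, p)) i j :
  (rdiag d *m M) i j = (d i)%:C%C * M i j.
Proof. by rewrite rdiag.unlock mul_diag_mx !mxE. Qed.

Lemma rdiagr n p (d : 'I_p -> R) (M : 'M[C]_(n, p)) i j :
  (M *m rdiag d) i j = M i j * (d j)%:C%C.
Proof. by rewrite rdiag.unlock mul_mx_diag !mxE. Qed.

Lemma adj_rdiag n (d : 'I_n -> R) : adj (rdiag d) = rdiag d.
Proof.
apply/matrixP=> i j; rewrite adjE rdiag.unlock !mxE eq_sym; case: eqP => [->|]; rewrite ?mulr0n ?rmorph0 //.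
by rewrite mulr1n /Num.conj /= /conjc /= oppr0.
Qed.

Lemma rdiagM n (d e : 'I_n -> R) : rdiag d * rdiag e = rdiag (fun i => d i * e i).
Proof.
apply/matrixP=> i j; rewrite -[LHS]/((rdiag d *m rdiag e) i j) rdiagl rdiag.unlock !mxE.
by case: eqP; rewrite ?mulr0n ?mulr0 // !mulr1n rmorphM.
Qed.

Lemma rdiagD n (d e : 'I_n -> R) : rdiag d + rdiag e = rdiag (fun i => d i + e i).
Proof. by apply/matrixP=> i j; rewrite rdiag.unlock !mxE -mulrnDl rmorphD. Qed.

Lemma rdiag_cst n (x : R) : rdiag (fun _ : 'I_n => x) = x%:C%C *: (1 : 'M[C]_n).
Proof. by apply/matrixP=> i j; rewrite rdiag.unlock !mxE mulr_natr. Qed.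

Lemma spectral_adjl n (X : 'M[C]_n) : adj (spectralmx X) * spectralmx X = 1.
Proof.
have h := spectral_unitarymx X; rewrite adj.unlock.
by rewrite -invmx_unitary // -[LHS]/(_ *m _) mulVmx // spectral_unit.
Qed.

Lemma spectral_adjr n (X : 'M[C]_n) : spectralmx X * adj (spectralmx X) = 1.
Proof. by rewrite adj.unlock; have /unitarymxP := spectral_unitarymx X. Qed.

Lemma fc_id n (X : 'M[C]_n) : herm X -> fc id X = X.
Proof.
move/hermsymmxP => hX; have := hermitian_spectral_diag_real hX => /mxOverP dr.
have /orthomx_spectralP e := hermitian_normalmx hX.
apply: etrans (esym e); rewrite fc.unlock rdiag.unlock adj.unlock.
rewrite (invmx_unitary (spectral_unitarymx X)); congr (_ *m _ *m _).
apply/matrixP => i j; rewrite !mxE; case: eqP => // _; rewrite !mulr1n.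
rewrite ev.unlock; have /CrealP := dr 0 i; case: (spectral_diag X 0 i) => a b [] /= ab.
by apply/eqP; rewrite eq_complex /= eqxx /=; apply/eqP; lra.
Qed.

Lemma rdiag_intertwine n p (d : 'I_n -> R) (e : 'I_p -> R) (M : 'M[C]_(n, p)) f :
  rdiag d *m M = M *m rdiag e ->
  rdiag (fun i => f (d i)) *m M = M *m rdiag (fun j => f (e j)).
Proof.
move=> /matrixP h; apply/matrixP => i j; have := h i j; rewrite !rdiagl !rdiagr mulrC.
have [->|M0] := eqVneq (M i j) 0; first by rewrite !(mulr0, mul0r).
by move/(mulfI M0)/complexI => ->; rewrite mulrC.
Qed.

(** Any matrix intertwining two Hermitian matrices intertwines their images
under the functional calculus: in eigenbases it only links equal eigenvalues. *)
Lemma fc_intertwine n (X X' Y : 'M[C]_n) f : herm X -> herm X' ->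
  X * Y = Y * X' -> fc f X * Y = Y * fc f X'.
Proof.
move=> hX hX' XY.
have h : rdiag (ev X) *m (spectralmx X * Y * adj (spectralmx X')) =
    (spectralmx X * Y * adj (spectralmx X')) *m rdiag (ev X').
  have e1 : rdiag (ev X) * spectralmx X = spectralmx X * X.
    by rewrite -{4}(fc_id hX) fc.unlock !mulrA spectral_adjr mul1r.
  have e2 : adj (spectralmx X') * rdiag (ev X') = X' * adj (spectralmx X').
    by rewrite -{3}(fc_id hX') fc.unlock -!mulrA spectral_adjr mulr1.
  rewrite -[LHS]/(_ * _) -[RHS]/(_ * _) !mulrA e1 -(mulrA _ X Y) XY.
  by rewrite -!mulrA e2.
have := rdiag_intertwine f h.
rewrite -[LHS]/(_ * _) -[RHS]/(_ * _) => e.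
have := congr1 (fun M => adj (spectralmx X) * M * spectralmx X') e.
rewrite fc.unlock !mulrA => e3.
rewrite -[LHS]mulr1 -(spectral_adjl X') !mulrA {}e3.
by rewrite spectral_adjl mul1r -!mulrA.
Qed.

Lemma fc_comm n (X Y : 'M[C]_n) f : herm X -> X * Y = Y * X -> fc f X * Y = Y * fc f X.
Proof. by move=> hX; exact: fc_intertwine. Qed.

Lemma fcX n (X : 'M[C]_n) f : herm X -> fc f X * X = X * fc f X.
Proof. by move=> hX; exact: fc_comm. Qed.

Lemma fc_herm n (X : 'M[C]_n) f : herm (fc f X).
Proof. by rewrite /herm fc.unlock !adjM adjK adj_rdiag mulrA. Qed.

Lemma fcM n (X : 'M[C]_n) f g : fc f X * fc g X = fc (fun x => f x * g x) X.
Proof.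
rewrite fc.unlock !mulrA -(mulrA _ _ (adj _)) spectral_adjr mulr1.
by rewrite -(mulrA (adj _)) rdiagM.
Qed.

Lemma fcD n (X : 'M[C]_n) f g : fc f X + fc g X = fc (fun x => f x + g x) X.
Proof. by rewrite fc.unlock -mulrDl -mulrDr rdiagD. Qed.

Lemma fc_cst n (X : 'M[C]_n) (c : R) : fc (fun=> c) X = c%:C%C *: (1 : 'M[C]_n).
Proof.
rewrite fc.unlock rdiag_cst -[adj _ * _]/(adj _ *m _) -scalemxAr -[LHS]/(_ *m _) -scalemxAl.
by congr (_ *: _); rewrite -[LHS]/(adj _ * 1 * _) mulr1 spectral_adjl.
Qed.

Lemma fc1 n (X : 'M[C]_n) : fc (fun=> 1) X = 1.
Proof. by rewrite fc_cst scale1r. Qed.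

Lemma fc0 n (X : 'M[C]_n) : fc (fun=> 0) X = 0.
Proof. by rewrite fc_cst scale0r. Qed.

Lemma eq_fc n (X : 'M[C]_n) f g : (forall j, f (ev X j) = g (ev X j)) -> fc f X = fc g X.
Proof.
move=> h; rewrite fc.unlock rdiag.unlock; congr (_ * _ * _).
by congr diag_mx; apply/rowP=> j; rewrite !mxE h.
Qed.

Lemma fc_sqr_norm n (X : 'M[C]_n) f v : rip v (fc (fun x => f x * f x) X *m v) = l2norm (fc f X *m v) ^+ 2.
Proof. by rewrite -fcM l2norm_sqr -[fc f X * _]/(_ *m _) -mulmxA rip_adj fc_herm. Qed.

Lemma rip_scalar n (c : R) (v : 'cV[C]_n) :
  c * l2norm v ^+ 2 = rip v ((c%:C%C *: (1 : 'M[C]_n)) *m v).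
Proof. by rewrite l2norm_sqr -ripZr -scalemxAl mul1mx. Qed.

Lemma fc_ge_ev n (X : 'M[C]_n) f c v : (forall j, c <= f (ev X j)) ->
  c * l2norm v ^+ 2 <= rip v (fc f X *m v).
Proof.
move=> h; rewrite -subr_ge0 rip_scalar -(fc_cst X c) -ripNr -mulNmx -ripDr -mulmxDl.
have -> : fc f X - fc (fun=> c) X =
    fc (fun x => Num.sqrt (f x - c) * Num.sqrt (f x - c)) X.
  apply/eqP; rewrite subr_eq fcD; apply/eqP; apply: eq_fc => j.
  by rewrite -expr2 sqr_sqrtr ?subr_ge0 //; ring.
by rewrite fc_sqr_norm sqr_ge0.
Qed.

Lemma fc_norm_ev n (X : 'M[C]_n) f c : 0 <= c -> (forall j, `|f (ev X j)| <= c) ->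
  opn (fc f X) <= c.
Proof.
move=> c0 h; apply: opnorm_le_mul => // v.
rewrite -ler_sqr ?nnegrE ?mulr_ge0 ?l2norm_ge0 // exprMn -fc_sqr_norm -subr_ge0.
rewrite rip_scalar -(fc_cst X (c ^+ 2)) -ripNr -mulNmx -ripDr -mulmxDl.
rewrite -(mul0r (l2norm v ^+ 2)).
have -> : fc (fun=> c ^+ 2) X - fc (fun x => f x * f x) X =
    fc (fun x => c ^+ 2 - f x * f x) X.
  apply/eqP; rewrite subr_eq fcD; apply/eqP; apply: eq_fc => j; ring.
apply: fc_ge_ev => j; rewrite subr_ge0 -expr2 -real_normK ?num_real //.
by rewrite ler_sqr ?nnegrE.
Qed.

Lemma fc_spectral n (X : 'M[C]_n) f :
  fc f X * adj (spectralmx X) = adj (spectralmx X) * rdiag (fun j => f (ev X j)).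
Proof. by rewrite fc.unlock -!mulrA spectral_adjr mulr1. Qed.

Lemma ev_vector n (X : 'M[C]_n) j : herm X ->
  exists2 v, rip v v = 1 & X *m v = (ev X j)%:C%C *: v.
Proof.
move=> hX; set e : 'cV[C]_n := delta_mx j 0; exists (adj (spectralmx X) *m e).
  rewrite rip_adj adjK mulmxA [_ *m adj _]spectral_adjr mul1mx ripE (bigD1 j) //= big1.
    by rewrite /e !mxE !eqxx /= mul1r mul0r !addr0.
  by move=> k /negPf kj; rewrite /e !mxE kj /= !mul0r addr0.
rewrite mulmxA -{1}(fc_id hX) [_ *m adj _]fc_spectral -[in LHS]mulmxA scalemxAr.
congr (_ *m _); apply/matrixP=> k l; rewrite rdiagl !mxE.
by case: eqP => [->|]; rewrite ?mulr0.
Qed.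

Lemma ev_le n (X : 'M[C]_n) j : herm X -> `|ev X j| <= opn X.
Proof.
move=> hX; have [v v1 Xv] := ev_vector j hX.
have n1 : l2norm v = 1.
  by apply/eqP; rewrite -(eqrXn2 (n := 2)) ?l2norm_ge0 // expr1n l2norm_sqr v1.
by have := l2norm_mulmx X v; rewrite Xv l2normZ n1 !mulr1.
Qed.

Lemma fc_norm n (X : 'M[C]_n) f r c : herm X -> opn X <= r -> 0 <= c ->
  (forall x, `|x| <= r -> `|f x| <= c) -> opn (fc f X) <= c.
Proof.
by move=> hX Xr c0 h; apply: fc_norm_ev => // j; apply: h; apply: le_trans (ev_le _ _) Xr.
Qed.

Lemma fc_ge n (X : 'M[C]_n) f c v : (forall x, c <= f x) ->
  c * l2norm v ^+ 2 <= rip v (fc f X *m v).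
Proof. by move=> h; apply: fc_ge_ev. Qed.

Lemma fc_ext n (X : 'M[C]_n) f g : f =1 g -> fc f X = fc g X.
Proof. by move=> h; apply: eq_fc => j. Qed.

Lemma fc_norm1 n (X : 'M[C]_n) f : (forall x, `|f x| <= 1) -> opn (fc f X) <= 1.
Proof. by move=> h; apply: fc_norm_ev. Qed.

Lemma fcN n (X : 'M[C]_n) f : - fc f X = fc (fun x => - f x) X.
Proof.
apply/eqP; rewrite eq_sym -addr_eq0 fcD -(fc0 X); apply/eqP/eq_fc => j; ring.
Qed.

Lemma fcB n (X : 'M[C]_n) f g : fc f X - fc g X = fc (fun x => f x - g x) X.
Proof. by rewrite fcN fcD. Qed.

(** On a block where [X] acts as a scalar, so does [f(X)]. *)
Lemma fc_eigen n (X Q : 'M[C]_n) f (c : R) : herm X -> X * Q = c%:C%C *: Q ->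
  fc f X * Q = (f c)%:C%C *: Q.
Proof.
move=> hX XQ.
have e0 (x : R) : x%:C%C *: Q = Q * fc (fun=> x) X.
  by rewrite fc_cst -[RHS]/(_ *m _) -scalemxAr mulmx1.
have hc (x : R) : herm (x%:C%C *: (1 : 'M[C]_n)) by apply: hermZ; exact: herm1.
have XQ' : X * Q = Q * (c%:C%C *: (1 : 'M[C]_n)) by rewrite XQ -[RHS]/(_ *m _) -scalemxAr mulmx1.
rewrite (fc_intertwine f hX (hc c) XQ') e0 fc_cst; congr (_ * _).
have e1 : rdiag (ev (c%:C%C *: (1 : 'M[C]_n))) = rdiag (fun=> c).
  rewrite rdiag_cst; set Y : 'M[C]_n := c%:C%C *: (1 : 'M[C]_n).
  have : spectralmx Y * fc id Y * adj (spectralmx Y) = rdiag (ev Y).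
    by rewrite fc.unlock !mulrA spectral_adjr mul1r -mulrA spectral_adjr mulr1.
  have cM (M : 'M[C]_n) : M * Y = c%:C%C *: M.
    by rewrite -[LHS]/(_ *m _) -scalemxAr mulmx1.
  rewrite (fc_id (hc c)) => <-; rewrite cM -[LHS]/(_ *m _) -scalemxAl.
  by rewrite [_ *m _]spectral_adjr.
rewrite -(fc_cst (c%:C%C *: (1 : 'M[C]_n)) (f c)); apply: eq_fc => j.
have /matrixP /(_ j j) := e1; rewrite rdiag.unlock !mxE eqxx !mulr1n => -[] -> //.
Qed.

Lemma fc_comp n (X : 'M[C]_n) f g : fc f (fc g X) = fc (fun x => f (g x)) X.
Proof.
(* in the eigenbasis of X, both sides are diagonal; columns are eigenvectors *)
suff h : fc f (fc g X) * adj (spectralmx X) = fc (fun x => f (g x)) X * adj (spectralmx X).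
  by rewrite -[LHS]mulr1 -[RHS]mulr1 -(spectral_adjl X) !mulrA h.
set P := adj (spectralmx X).
have e k : fc k X * P = P * rdiag (fun j => k (ev X j)) by exact: fc_spectral.
pose E j : 'M[C]_n := delta_mx j j.
have sE : \sum_j E j = 1.
  apply/matrixP=> i j; rewrite summxE (bigD1 i) //= big1 => [|k ki].
    by rewrite !mxE eqxx /= addr0 eq_sym.
  by rewrite !mxE eq_sym (negPf ki).
have dE (d : 'I_n -> R) j : rdiag d * E j = (d j)%:C%C *: E j.
  apply/matrixP=> i k; rewrite -[LHS]/((_ *m _) i k) rdiagl !mxE.
  by case: eqP => [->|]; rewrite ?mulr0.
have eE k j : fc k X * (P * E j) = (k (ev X j))%:C%C *: (P * E j).
  by rewrite mulrA e -mulrA dE -[LHS]/(_ *m _) -scalemxAr.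
rewrite -[P]mulr1 -sE !mulr_sumr; apply: eq_bigr => j _.
by rewrite (@fc_eigen _ _ _ _ (g (ev X j))) ?eE //; exact: fc_herm.
Qed.

End FunctionalCalculus.

(** * Separated spectra and block estimates *)

(** A resolution of the identity into orthogonal projections. *)
Definition blocks (R : realType) n (I : finType) (E : I -> 'M[R[i]]_n) :=
  [/\ forall k, herm (E k), forall k l, E k * E l = if k == l then E k else 0
    & \sum_k E k = 1].

(** The half-open interval of length [w] that contains [x], numbered so that
interval 0 begins at [-r]. *)
Definition cell (R : realType) (r w x : R) : int := Num.floor ((x + r) / w).

Definition cellmx (R : realType) n (r w : R) (X : 'M[R[i]]_n) (k : nat) :=
  fc (fun x => (cell r w x == k%:Z)%:R) X.

Section Gaps.
Context {R : realType}.
Local Notation C := R[i].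
Implicit Types (f g : R -> R).

(** A top singular vector: take an eigenvector for the largest eigenvalue of
[adj c * c]. *)
Lemma opnorm_attained n (c : 'M[C]_n) : (0 < n)%N -> exists v,
  l2norm v = 1 /\ adj c *m (c *m v) = ((opn c) ^+ 2)%:C%C *: v.
Proof.
case: n c => // n c _; set E := adj c * c.
have hE : herm E by rewrite /herm /E adjM adjK.
pose j := [arg max_(j > ord0) ev E j]%O.
have [v v1 Ev] := ev_vector j hE.
have n1 : l2norm v = 1.
  by apply/eqP; rewrite -(eqrXn2 (n := 2)) ?l2norm_ge0 // expr1n l2norm_sqr v1.
have cv : l2norm (c *m v) ^+ 2 = ev E j.
  by rewrite l2norm_sqr rip_adj mulmxA ripC [adj c *m c *m v]Ev ripZr v1 mulr1.
exists v; split => //; rewrite mulmxA -[adj c *m c]/E Ev; congr (_%:C%C *: _).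
apply/eqP; rewrite eq_le; apply/andP; split.
  rewrite -cv ler_sqr ?nnegrE ?l2norm_ge0 ?opnorm_ge0 //.
  by rewrite -[leRHS]mulr1 -n1 l2norm_mulmx.
have evj0 : 0 <= ev E j by rewrite -cv sqr_ge0.
rewrite -[leRHS]sqr_sqrtr // ler_sqr ?nnegrE ?sqrtr_ge0 ?opnorm_ge0 //.
apply: opnorm_le_mul => [|u]; first exact: sqrtr_ge0.
rewrite -ler_sqr ?nnegrE ?mulr_ge0 ?sqrtr_ge0 ?l2norm_ge0 // exprMn.
rewrite [Num.sqrt (ev E j) ^+ 2]sqr_sqrtr //.
rewrite [l2norm (c *m u) ^+ 2]l2norm_sqr rip_adj mulmxA ripC -[adj c *m c]/E.
have hj k : - ev E j <= - ev E k.
  by rewrite lerN2 /j; case: arg_maxP => //= m _; apply.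
have := fc_ge_ev (f := fun x => - x) u hj.
have -> : fc (fun x => - x) E = - fc id E by rewrite fcN.
by rewrite fc_id // mulNmx ripNr mulNr lerN2.
Qed.

(** If [D'] lies below [al] on the range of [c] and [D] lies above [be] on that
of its adjoint, then [c] is controlled by [D' c - c D]: test this difference
against a pair of top singular vectors of [c]. *)
Lemma sylvester n (D' D c : 'M[C]_n) al be :
  (forall v, rip (c *m v) (D' *m (c *m v)) <= al * l2norm (c *m v) ^+ 2) ->
  (forall v, be * l2norm (adj c *m v) ^+ 2 <= rip (adj c *m v) (D *m (adj c *m v))) ->
  (be - al) * opn c <= opn (D' * c - c * D).
Proof.
move=> hal hbe; set X := D' * c - c * D.
have [s0|s0] := eqVneq (opn c) 0; first by rewrite s0 mulr0 opnorm_ge0.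
have s_gt0 : 0 < opn c by rewrite lt0r s0 opnorm_ge0.
have [v [v1 cv]] : exists v,
  l2norm v = 1 /\ adj c *m (c *m v) = ((opn c) ^+ 2)%:C%C *: v.
  have [n0|] := posnP n; last exact: opnorm_attained.
  have c0 : c = 0 by apply/matrixP => k; have := ltn_ord k; rewrite {2}n0.
  by move: s0; rewrite c0 opnorm0 eqxx.
set s := opn c in s0 s_gt0 cv *.
have cvn : l2norm (c *m v) ^+ 2 = s ^+ 2.
  by rewrite l2norm_sqr rip_adj cv ripC ripZr -l2norm_sqr v1 expr1n mulr1.
have e1 : rip (c *m v) (X *m v) =
    rip (c *m v) (D' *m (c *m v)) - s ^+ 2 * rip v (D *m v).
  rewrite mulmxBl ripDr ripNr -[D' * c]/(D' *m c) -[c * D]/(c *m D) -!mulmxA.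
  by rewrite [rip _ (c *m _)]rip_adj cv ripZl.
have h2 : be <= rip v (D *m v).
  have := hbe (c *m v); rewrite cv -scalemxAr ripZl ripZr l2normZ v1 mulr1.
  rewrite ger0_norm ?sqr_ge0 // mulrA [be * _]mulrC -expr2 ler_pM2l //.
  by rewrite exprn_gt0 // exprn_gt0.
have h1 := hal v; rewrite cvn in h1.
have h3 : - rip (c *m v) (X *m v) <= s * opn X.
  have cvs : l2norm (c *m v) <= s by rewrite -[leRHS]mulr1 -v1 l2norm_mulmx.
  have Xv : l2norm (X *m v) <= opn X by rewrite -[leRHS]mulr1 -v1 l2norm_mulmx.
  rewrite -ripNr; apply: le_trans (cauchy_schwarz _ _) _; rewrite l2normN.
  apply: le_trans (ler_wpM2l (l2norm_ge0 _) Xv) _.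
  exact: (ler_wpM2r (opnorm_ge0 _) cvs).
rewrite -(ler_pM2l s_gt0); apply: le_trans h3; rewrite e1.
have := ler_wpM2l (sqr_ge0 s) h2; move: h1; set a := rip _ _; set b := rip _ _; nra.
Qed.

Lemma fc_form_le_ev n (X : 'M[C]_n) f g v : (forall j, f (ev X j) <= g (ev X j)) ->
  rip v (fc f X *m v) <= rip v (fc g X *m v).
Proof.
move=> h; rewrite -subr_ge0 -ripNr -mulNmx -ripDr -mulmxDl fcB.
by rewrite -(mul0r (l2norm v ^+ 2)); apply: fc_ge_ev => j; rewrite subr_ge0.
Qed.

Lemma fc_form_le n (X : 'M[C]_n) f g v : (forall x, f x <= g x) ->
  rip v (fc f X *m v) <= rip v (fc g X *m v).
Proof. by move=> h; apply: fc_form_le_ev. Qed.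

Lemma fc_form_conj n (X : 'M[C]_n) f v : herm X ->
  rip (fc f X *m v) (X *m (fc f X *m v)) = rip v (fc (fun x => f x * x * f x) X *m v).
Proof.
move=> hX; rewrite -(fc_herm X f) -rip_adj !mulmxA -{2}(fc_id hX) (fc_herm X f).
by rewrite [fc f X *m _]fcM [fc _ X *m fc f X]fcM.
Qed.

Lemma fc_form_sqr n (X : 'M[C]_n) f v (c : R) :
  c * l2norm (fc f X *m v) ^+ 2 = rip v (fc (fun x => f x * c * f x) X *m v).
Proof.
rewrite -fc_sqr_norm -ripZr scalemxAl.
have -> : c%:C%C *: fc (fun x => f x * f x) X = fc (fun=> c) X * fc (fun x => f x * f x) X.
  by rewrite fc_cst -[RHS]/(_ *m _) -scalemxAl mul1mx.
rewrite fcM (fc_ext X (g := fun x => f x * c * f x)) // => x.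
by rewrite mulrA (mulrC c).
Qed.

(** Between spectral subspaces separated by a gap, commuting with [X] and [X'] costs
at least the gap. *)
Lemma gap_le n (X X' Y : 'M[C]_n) f g al be : herm X -> herm X' ->
  (forall x, f x != 0 -> x <= al) -> (forall x, g x != 0 -> be <= x) ->
  (forall x, `|f x| <= 1) -> (forall x, `|g x| <= 1) ->
  (be - al) * opn (fc f X * Y * fc g X') <= opn (X * Y - Y * X').
Proof.
move=> hX hX' fal gbe f1 g1; set c := _ * Y * _.
have Xc : X * c - c * X' = fc f X * (X * Y - Y * X') * fc g X'.
  by rewrite /c mulrBr mulrBl !mulrA (fcX f hX) -!mulrA -(fcX g hX').
apply: (@le_trans _ _ (opn (X * c - c * X'))).
  apply: sylvester => v.
    rewrite /c !mulmx_app fc_form_conj // fc_form_sqr.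
    apply: fc_form_le => x; have [->|/fal xal] := eqVneq (f x) 0; first by rewrite !mul0r.
    have := mulr_ge0 (sqr_ge0 (f x)) (etrans (subr_ge0 _ _) xal); rewrite expr2; lra.
  rewrite /c adjM fc_herm !mulmx_app fc_form_conj // fc_form_sqr.
  apply: fc_form_le => x; have [->|/gbe xal] := eqVneq (g x) 0; first by rewrite !mul0r.
  have := mulr_ge0 (sqr_ge0 (g x)) (etrans (subr_ge0 _ _) xal); rewrite expr2; lra.
rewrite Xc -[leRHS]mulr1; apply: opnormM_le; last exact: fc_norm1.
by rewrite -[leRHS]mul1r; apply: opnormM_le => //; exact: fc_norm1.
Qed.

Lemma gap_ge n (X X' Y : 'M[C]_n) f g al be : herm X -> herm X' ->
  (forall x, f x != 0 -> be <= x) -> (forall x, g x != 0 -> x <= al) ->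
  (forall x, `|f x| <= 1) -> (forall x, `|g x| <= 1) ->
  (be - al) * opn (fc f X * Y * fc g X') <= opn (X * Y - Y * X').
Proof.
move=> hX hX' fbe gal f1 g1.
rewrite -opnorm_adj !adjM !fc_herm mulrA -[leRHS]opnorm_adj adjB !adjM hX hX' opnormBC.
exact: gap_le.
Qed.

Lemma opnorm_le_rip_sqr n (A : 'M[C]_n) c : 0 <= c ->
  (forall u v, rip u (A *m v) <= c * (l2norm u ^+ 2 + l2norm v ^+ 2) / 2) ->
  opn A <= c.
Proof.
move=> c0 h; apply: opnorm_le_mul => // v.
have [/l2norm_eq0->|v0] := eqVneq (l2norm v) 0.
  by rewrite mulmx0 l2norm0 mulr0.
have [->|w0] := eqVneq (l2norm (A *m v)) 0; first by rewrite mulr_ge0 ?l2norm_ge0.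
have v_gt0 : 0 < l2norm v by rewrite lt0r v0 l2norm_ge0.
have w_gt0 : 0 < l2norm (A *m v) by rewrite lt0r w0 l2norm_ge0.
have := h ((l2norm v / l2norm (A *m v))%:C%C *: (A *m v)) v.
rewrite ripZl l2normZ -l2norm_sqr ger0_norm ?divr_ge0 ?l2norm_ge0 // divfK //.
rewrite expr2 mulrA divfK // => hh; rewrite -(ler_pM2l v_gt0); apply: le_trans hh _.
by rewrite le_eqVlt; apply/orP; left; apply/eqP; field.
Qed.

Lemma blocks_norm n (I : finType) (E : I -> 'M[C]_n) v : blocks E ->
  \sum_k l2norm (E k *m v) ^+ 2 = l2norm v ^+ 2.
Proof.
case=> hE EE sE; rewrite [RHS]l2norm_sqr -[v in rip _ v]mul1mx.
have -> : 1%:M = \sum_k E k by rewrite sE.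
rewrite mulmx_suml rip_sumr; apply: eq_bigr => k _.
by rewrite l2norm_sqr rip_adj hE ripC mulmxA [E k *m E k]EE eqxx.
Qed.

(** Bound the bilinear form of [T] block by block with the inequality between
arithmetic and geometric means, and sum over rows and columns. *)
Lemma schur_test n (I J : finType) (E : I -> 'M[C]_n) (E' : J -> 'M[C]_n)
    (T : 'M[C]_n) (b : I -> J -> R) s :
  blocks E -> blocks E' -> 0 <= s ->
  (forall k l, opn (E k * T * E' l) <= b k l) ->
  (forall k, \sum_l b k l <= s) -> (forall l, \sum_k b k l <= s) ->
  opn T <= s.
Proof.
move=> bE bE' s0 hb row col; apply: opnorm_le_rip_sqr => // u v.
have [hE EE sE] := bE; have [hE' EE' sE'] := bE'.
have b0 k l : 0 <= b k l by apply: le_trans (opnorm_ge0 _) (hb k l).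
have -> : rip u (T *m v) = \sum_k \sum_l rip (E k *m u) (E k * T * E' l *m (E' l *m v)).
  have -> : T *m v = \sum_k \sum_l E k * T * E' l *m v.
    transitivity ((\sum_k E k) * T * (\sum_l E' l) *m v).
      by rewrite sE sE' mul1r mulr1.
    rewrite !mulr_suml mulmx_suml; apply: eq_bigr => k _.
    by rewrite mulr_sumr mulmx_suml.
  rewrite rip_sumr; apply: eq_bigr => k _; rewrite rip_sumr; apply: eq_bigr => l _.
  have Ekk := EE k k; have Ell := EE' l l; rewrite !eqxx in Ekk Ell.
  by rewrite -{1}Ekk -{1}Ell !mulmx_app rip_adj hE.
apply: (@le_trans _ _ (\sum_k \sum_l
    (b k l * l2norm (E k *m u) ^+ 2 / 2 + b k l * l2norm (E' l *m v) ^+ 2 / 2))).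
  apply: ler_sum => k _; apply: ler_sum => l _.
  apply: le_trans (cauchy_schwarz _ _) _; set x := l2norm (E k *m u).
  have x0 : 0 <= x := l2norm_ge0 _.
  have y0 : 0 <= l2norm (E' l *m v) := l2norm_ge0 _.
  have : l2norm (E k * T * E' l *m (E' l *m v)) <= b k l * l2norm (E' l *m v).
    by apply: le_trans (l2norm_mulmx _ _) _; rewrite ler_wpM2r.
  move: (l2norm (E' l *m v)) y0 => y y0 /(ler_wpM2l x0) => hh; apply: le_trans hh _.
  have := mulr_ge0 (b0 k l) (sqr_ge0 (x - y)); nra.
under eq_bigr do rewrite big_split /=.
rewrite big_split /= [X in _ + X]exchange_big /=.
have -> : s * (l2norm u ^+ 2 + l2norm v ^+ 2) / 2 =
  (\sum_k s * l2norm (E k *m u) ^+ 2 / 2) + (\sum_l s * l2norm (E' l *m v) ^+ 2 / 2).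
  by rewrite -!mulr_suml -!mulr_sumr !blocks_norm // -mulrDl -mulrDr.
rewrite lerD //; apply: ler_sum => k _; rewrite -!mulr_suml ler_wpM2r //.
  by rewrite ler_wpM2r ?sqr_ge0.
by rewrite ler_wpM2r ?sqr_ge0.
Qed.

End Gaps.

(** * Spectral cells *)

Section Cells.
Context {R : realType}.
Local Notation C := R[i].
Implicit Types (f g : R -> R).

Lemma cellP (r w x : R) (k : int) : 0 < w ->
  (cell r w x == k) = (k%:~R * w - r <= x) && (x < (k + 1)%:~R * w - r).
Proof.
move=> w0; by rewrite /cell floor_eq ler_pdivlMr // ltr_pdivrMr // lerBlDr ltrBrDr.
Qed.

Lemma fc_sum n (X : 'M[C]_n) I (s : seq I) (F : I -> R -> R) :
  \sum_(k <- s) fc (F k) X = fc (fun x => \sum_(k <- s) F k x) X.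
Proof.
elim: s => [|k s IH]; first by rewrite big_nil -(fc0 X); apply: fc_ext => x; rewrite big_nil.
by rewrite big_cons IH fcD; apply: fc_ext => x; rewrite big_cons.
Qed.

Lemma cellmx_blocks n (X : 'M[C]_n) r w M : herm X -> opn X <= r -> 0 < w ->
  2 * r < w * M%:R -> blocks (fun k : 'I_M => cellmx r w X k).
Proof.
move=> hX Xr w0 rM; split=> [k|k l|]; first exact: fc_herm.
  rewrite /cellmx fcM; case: eqP => [->|kl]; first by apply: fc_ext => x; case: eqP; rewrite ?mulr1 ?mulr0.
  rewrite -(fc0 X); apply: fc_ext => x; case: eqP => [->|]; last by rewrite mul0r.
  by rewrite eqz_nat; case: eqP => [/val_inj//|]; rewrite mulr0.
rewrite /cellmx fc_sum -(fc1 X); apply: eq_fc => j.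
have /ler_normlP [x1 x2] := le_trans (ev_le j hX) Xr.
set x := ev X j in x1 x2 *.
have c0 : (0 <= cell r w x)%R.
  by rewrite /cell floor_ge0 divr_ge0 ?(ltW w0) //; lra.
have [k kE] : exists k : nat, cell r w x = k%:Z by move: c0; case: (cell _ _ _) => // k _; exists k.
have kM : (k < M)%N.
  have : cell r w x == k%:Z by rewrite kE.
  rewrite cellP // => /andP[kx _]; rewrite -(ltr_nat R) -(ltr_pM2r w0).
  by rewrite -pmulrn in kx; lra.
rewrite (bigD1 (Ordinal kM)) //= kE eqxx big1 ?addr0 // => l lk.
by rewrite eqz_nat; case: eqP => // e; move: lk; rewrite -val_eqE /= e eqxx.
Qed.


(** Approximate intertwining passes to functions of Hermitian matrices. Cut the
line into cells of width [w] and replace [f] by a step function: neighbouring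
cells contribute the oscillation [om] of [f] on a cell, while distant cells
hardly see each other because their spectra are separated by [w]. *)
Lemma fc_intertwine_approx n (X X' Y : 'M[C]_n) f r w om F M :
  herm X -> herm X' -> opn X <= r -> opn X' <= r -> 0 < w ->
  2 * r < w * M%:R ->
  (forall x y, `|x - y| <= w -> `|f x - f y| <= om) ->
  (forall x y, `|f x - f y| <= F) ->
  opn (fc f X * Y - Y * fc f X') <=
    4 * om * opn Y + M%:R * (F / w) * opn (X * Y - Y * X').
Proof.
move=> hX hX' Xr X'r w0 rM fom fF; set dl := opn (X * Y - Y * X').
have om0 : 0 <= om by apply: le_trans (fom 0 0 _); rewrite ?subrr ?normr0 // ltW.
have F0 : 0 <= F by apply: le_trans (fF 0 0); rewrite normr_ge0.
have dl0 : 0 <= dl := opnorm_ge0 _; have Y0 := opnorm_ge0 Y.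
pose c (k : int) : R := k%:~R * w - r.
pose fw x := f (c (cell r w x)).
have near x : `|f x - fw x| <= om.
  apply: fom; have /esym := cellP r x (cell r w x) w0; rewrite eqxx.
  by rewrite intrD mulrDl mul1r => /andP[x1 x2]; rewrite ger0_norm /c; lra.
have sN (Z : 'M[C]_n) : opn (fc f Z - fc fw Z) <= om.
  by rewrite fcB; apply: fc_norm_ev.
have step : opn (fc fw X * Y - Y * fc fw X') <= 2 * om * opn Y + M%:R * (F / w) * dl.
  pose E k := cellmx r w X k; pose E' k := cellmx r w X' k.
  pose b (k l : nat) := om * opn Y * ((l == k.+1)%:R + (k == l.+1)%:R) + F / w * dl.
  have Fw0 : 0 <= F / w * dl by rewrite mulr_ge0 // divr_ge0 // ltW.
  have omY0 : 0 <= om * opn Y by rewrite mulr_ge0.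
  have fwE (Z : 'M[C]_n) (k : nat) : cellmx r w Z k * fc fw Z = (f (c k))%:C%C *: cellmx r w Z k.
    have -> : (f (c k))%:C%C *: cellmx r w Z k = fc (fun=> f (c k)) Z * cellmx r w Z k.
      by rewrite fc_cst -[RHS]/(_ *m _) -scalemxAl mul1mx.
    rewrite /cellmx !fcM; apply: fc_ext => x; rewrite /fw.
    by case: eqP => [->|]; rewrite ?mul0r ?mulr0 // mul1r mulr1.
  have fwE' (Z : 'M[C]_n) (k : nat) : fc fw Z * cellmx r w Z k = (f (c k))%:C%C *: cellmx r w Z k.
    by rewrite -fwE /cellmx !fcM; apply: fc_ext => x; rewrite mulrC.
  have blk (k l : nat) : opn (E k * (fc fw X * Y - Y * fc fw X') * E' l) <= b k l.
    have -> : E k * (fc fw X * Y - Y * fc fw X') * E' l =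
        (f (c k) - f (c l))%:C%C *: (E k * Y * E' l).
      rewrite mulrBr mulrBl !mulrA fwE -!mulrA fwE' rmorphB scalerBl.
      by rewrite scalemulAl !scalemulAr !mulrA.
    apply: le_trans (opnormZ _ _) _.
    have cell1 (Z : 'M[C]_n) m : opn (cellmx r w Z m) <= 1.
      by apply: fc_norm1 => x; case: eqP; rewrite ?normr1 ?normr0.
    have EYE : opn (E k * Y * E' l) <= opn Y.
      rewrite -[leRHS]mulr1; apply: opnormM_le; last exact: cell1.
      by rewrite -[leRHS]mul1r; apply: opnormM_le => //; exact: cell1.
    have supp (m : nat) x : (cell r w x == m)%:R != 0 :> R ->
        c m <= x /\ x <= c m.+1.
      rewrite pnatr_eq0 eqb0 negbK cellP // => /andP[x1 x2]; split => //.
      by move: x2; rewrite /c -addn1 PoszD => /ltW.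
    have bound1 (m : nat) x : `|(cell r w x == m)%:R| <= 1 :> R.
      by case: eqP; rewrite ?normr1 ?normr0.
    have cdiff (m m' : nat) : (m.+1 < m')%N -> w <= c m' - c m.+1.
      move=> mm; have -> : c m' - c m.+1 = (m'%:R - m.+1%:R) * w by rewrite /c; ring.
      rewrite -[leLHS]mul1r ler_pM2r // lerBrDl natr1 ler_nat //.
    have bdist : w * opn (E k * Y * E' l) <= dl ->
        `|f (c k) - f (c l)| * opn (E k * Y * E' l) <= b k l.
      move=> hw; apply: (@le_trans _ _ (F / w * dl)).
        rewrite -[F / w * dl]mulrA; apply: ler_pM; rewrite ?normr_ge0 ?opnorm_ge0 //.
        by rewrite [w^-1 * dl]mulrC ler_pdivlMr // mulrC.
      by rewrite /b lerDr mulr_ge0 ?addr_ge0 ?ler0n.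
    have bnear : `|c k - c l| <= w -> (1 <= (l == k.+1)%:R + (k == l.+1)%:R :> R) ->
        `|f (c k) - f (c l)| * opn (E k * Y * E' l) <= b k l.
      move=> cw one; apply: (@le_trans _ _ (om * opn Y)).
        by apply: ler_pM; rewrite ?normr_ge0 ?opnorm_ge0 // fom.
      by rewrite /b; apply: (@le_trans _ _ (om * opn Y * ((l == k.+1)%:R + (k == l.+1)%:R))); rewrite ?lerDl ?ler_peMr.
    have csucc (m : nat) : c m.+1 = c m + w by rewrite /c -addn1 PoszD intrD mulrDl mul1r; ring.
    case: (ltngtP k l) => kl.
    - move: (kl); rewrite leq_eqVlt => /orP[/eqP kl1|kl2].
        apply: bnear; rewrite -kl1; last by rewrite eqxx lerDl ler0n.
        by rewrite csucc opprD addrA subrr sub0r normrN gtr0_norm.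
      apply: bdist; apply: le_trans (ler_wpM2r (opnorm_ge0 _) (cdiff _ _ kl2)) _.
      apply: gap_le => // x => [/supp[]//|/supp[]//].
    - move: (kl); rewrite leq_eqVlt => /orP[/eqP kl1|kl2].
        apply: bnear; rewrite -kl1; last by rewrite eqxx lerDr ler0n.
        by rewrite csucc addrC addKr gtr0_norm.
      apply: bdist; apply: le_trans (ler_wpM2r (opnorm_ge0 _) (cdiff _ _ kl2)) _.
      apply: gap_ge => // x => [/supp[]//|/supp[]//].
    - rewrite -kl subrr normr0 mul0r /b addr_ge0 // mulr_ge0 // addr_ge0 ?ler0n //.
  have sum1 (k : nat) : \sum_(l < M) ((l == k :> nat)%:R : R) <= 1.
    have [kM|kM] := ltnP k M.
      rewrite (bigD1 (Ordinal kM)) //= eqxx big1 ?addr0 // => l.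
      by rewrite -val_eqE /= => /negPf->.
    rewrite big1 // => l _; have := ltn_ord l; case: eqP => // ->.
    by rewrite ltnNge kM.
  have sum2 (k : nat) : \sum_(l < M) ((k == l.+1 :> nat)%:R : R) <= 1.
    apply: le_trans (sum1 k.-1); apply: ler_sum => l _; rewrite ler_nat.
    by case: eqP => [->|]; rewrite ?eqxx.
  have rows (k : nat) : \sum_(l < M) b k l <= 2 * om * opn Y + M%:R * (F / w) * dl.
    rewrite big_split /= sumr_const card_ord -mulr_sumr big_split /=.
    rewrite -[_ *+ M]mulr_natl [M%:R * (_ * dl)]mulrA lerD2r -[2 * om * _]mulrA [2 * _]mulrC ler_wpM2l //.
    by rewrite (_ : 2 = 1 + 1) // lerD.
  apply: (@schur_test _ _ _ _ (fun k : 'I_M => E k) (fun k : 'I_M => E' k) _ (fun k l => b k l)) => //.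
  - exact: cellmx_blocks.
  - exact: cellmx_blocks.
  - by apply: addr_ge0; rewrite -mulrA mulr_ge0 ?ler0n.
  - move=> l; apply: le_trans (rows l); apply: ler_sum => k _.
    by rewrite /b [(l == k.+1 :> nat)%:R + _]addrC.
have -> : fc f X * Y - Y * fc f X' =
    (fc f X - fc fw X) * Y + (fc fw X * Y - Y * fc fw X') + Y * (fc fw X' - fc f X').
  by rewrite mulrBl mulrBr !addrA subrK subrK.
have h1 : opn ((fc f X - fc fw X) * Y) <= om * opn Y by exact: opnormM_le.
have h2 : opn (Y * (fc fw X' - fc f X')) <= opn Y * om.
  by apply: opnormM_le => //; rewrite opnormBC.
have := opnormD_le (opnormD_le h1 step) h2; lra.
Qed.

End Cells.

(** * Continuity moduli and pinching *)

Definition ucont (R : realType) (f : R -> R) := forall e : R, 0 < e ->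
  exists2 w : R, 0 < w & forall x y, `|x - y| <= w -> `|f x - f y| <= e.

Definition ramp (R : realType) (a b x : R) : R :=
  Num.min 1 (Num.max 0 ((x - a) / (b - a))).

Definition pinch (R : realType) n (I : finType) (E : I -> 'M[R[i]]_n) Y :=
  \sum_k E k * Y * E k.

Section Pinching.
Context {R : realType}.
Local Notation C := R[i].
Implicit Types (f g : R -> R).

Lemma ucont_lipschitz f L : (forall x y, `|f x - f y| <= L * `|x - y|) -> ucont f.
Proof.
move=> fL e e0; have L0 : 0 <= L.
  by have := fL 1 0; rewrite subr0 normr1 mulr1; apply: le_trans.
exists (e / (L + 1)) => [|x y xy]; first by rewrite divr_gt0 // ltr_wpDl.
apply: le_trans (fL x y) _; apply: le_trans (ler_wpM2l L0 xy) _.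
by rewrite mulrCA ler_piMr ?(ltW e0) // ler_pdivrMr ?mul1r ?lerDl // ltr_wpDl.
Qed.

(** The cells of [fc_intertwine_approx] are fixed by the modulus of continuity of
[f], so that [d] depends neither on the dimension nor on the matrices. *)
Lemma fc_intertwine_small f r y F e : ucont f -> (forall x z, `|f x - f z| <= F) ->
  0 < e -> 0 <= y -> exists2 d : R, 0 < d & forall n (X X' Y : 'M[C]_n),
    herm X -> herm X' -> opn X <= r -> opn X' <= r -> opn Y <= y ->
    opn (X * Y - Y * X') <= d -> opn (fc f X * Y - Y * fc f X') <= e.
Proof.
move=> uf fF e0 y0.
have y1 : 0 < 8 * (y + 1) by rewrite mulr_gt0 // ltr_wpDl.
have [w w0 fw] := uf (e / (8 * (y + 1))) (divr_gt0 e0 y1).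
have F0 : 0 <= F by apply: le_trans (fF 0 0); rewrite normr_ge0.
pose M := (Num.truncn (2 * r / w)).+1.
have rM : 2 * r < w * M%:R.
  by rewrite [w * _]mulrC -ltr_pdivrMr // /M; exact: truncnS_gt.
pose K := M%:R * (F / w); have K0 : 0 <= K.
  by rewrite /K mulr_ge0 ?ler0n // divr_ge0 // ltW.
exists (e / (2 * (K + 1))) => [|n X X' Y hX hX' Xr X'r Yy XY].
  by rewrite divr_gt0 // mulr_gt0 // ltr_wpDl.
apply: le_trans (fc_intertwine_approx Y hX hX' Xr X'r w0 rM fw fF) _.
rewrite -/K.
have h1 : 4 * (e / (8 * (y + 1))) * opn Y <= e / 2.
  apply: (@le_trans _ _ (4 * (e / (8 * (y + 1))) * (y + 1))).
    apply: ler_wpM2l; last by apply: le_trans Yy _; rewrite lerDl.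
    by rewrite mulr_ge0 // divr_ge0 // ltW.
  by rewrite le_eqVlt; apply/orP; left; apply/eqP; field; rewrite gt_eqF // ltr_wpDl.
have h2 : K * opn (X * Y - Y * X') <= e / 2.
  apply: (@le_trans _ _ ((K + 1) * (e / (2 * (K + 1))))).
    by apply: ler_pM => //; rewrite ?opnorm_ge0 // lerDl.
  by rewrite le_eqVlt; apply/orP; left; apply/eqP; field; rewrite gt_eqF // ltr_wpDl.
lra.
Qed.

Lemma ramp_ge0 (a b x : R) : 0 <= ramp a b x.
Proof. by rewrite /ramp le_min ler01 le_max lexx. Qed.

Lemma ramp_le1 (a b x : R) : ramp a b x <= 1.
Proof. by rewrite /ramp ge_min lexx. Qed.

Lemma ramp_norm (a b x : R) : `|ramp a b x| <= 1.
Proof. by rewrite ger0_norm ?ramp_ge0 ?ramp_le1. Qed.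

Lemma ramp0 (a b x : R) : a < b -> x <= a -> ramp a b x = 0.
Proof.
move=> ab xa; rewrite /ramp max_l ?min_r ?ler01 //.
by rewrite ler_pdivrMr ?subr_gt0 // mul0r subr_le0.
Qed.

Lemma ramp1 (a b x : R) : a < b -> b <= x -> ramp a b x = 1.
Proof.
move=> ab bx; rewrite /ramp min_l // le_max; apply/orP; right.
by rewrite ler_pdivlMr ?subr_gt0 // mul1r lerB.
Qed.

Lemma ramp_lipschitz (a b x y : R) : a < b ->
  `|ramp a b x - ramp a b y| <= (b - a)^-1 * `|x - y|.
Proof.
move=> ab; have -> : (b - a)^-1 * `|x - y| = `|(x - a) / (b - a) - (y - a) / (b - a)|.
  rewrite -mulrBl normrM [`|_^-1|]gtr0_norm ?invr_gt0 ?subr_gt0 // mulrC.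
  by congr (`|_| * _); ring.
rewrite /ramp; move: ((x - a) / (b - a)) ((y - a) / (b - a)) => u v.
have clipE (z : R) : let p := Num.min 1 (Num.max 0 z) in
    [\/ z <= 0 /\ p = 0, [/\ 0 <= z, z <= 1 & p = z] | 1 <= z /\ p = 1].
  rewrite /=; have [z0|z0] := leP 0 z; last by constructor 1; rewrite ltW // min_r ?ler01.
  by have [z1|z1] := leP 1 z; [constructor 3|constructor 2]; rewrite ?z0 ?(ltW z1).
have uv1 := ler_norm (u - v); have uv2 := ler_norm (v - u); rewrite distrC in uv2.
rewrite ler_norml;
case: (clipE u) => [[? ->]|[? ? ->]|[? ->]];
case: (clipE v) => [[? ->]|[? ? ->]|[? ->]];
by apply/andP; split; lra.
Qed.

Lemma ramp_osc (a b x y : R) : `|ramp a b x - ramp a b y| <= 1.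
Proof.
have := ramp_ge0 a b x; have := ramp_ge0 a b y.
have := ramp_le1 a b x; have := ramp_le1 a b y => *.
rewrite ler_norml; apply/andP; split; lra.
Qed.

Lemma ucont_ramp (a b : R) : a < b -> ucont (ramp a b).
Proof. by move=> ab; apply: ucont_lipschitz => x y; exact: ramp_lipschitz. Qed.

Variables (n : nat) (I : finType) (E : I -> 'M[C]_n).
Hypothesis bE : blocks E.
Implicit Types (Y M : 'M[C]_n).

Lemma blockM k l : E k * E l = if k == l then E k else 0.
Proof. by case: bE. Qed.

Lemma block_herm k : herm (E k).
Proof. by case: bE. Qed.

Lemma block_norm k : opn (E k) <= 1.
Proof.
have hE := block_herm k; have EE := blockM k k; rewrite eqxx in EE.
apply: opnorm_le_mul => // v; rewrite mul1r.
have [->|v0] := eqVneq (l2norm (E k *m v)) 0; first exact: l2norm_ge0.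
have v_gt0 : 0 < l2norm (E k *m v) by rewrite lt0r v0 l2norm_ge0.
rewrite -(ler_pM2l v_gt0) -expr2 l2norm_sqr rip_adj hE -mulmx_app EE.
by apply: le_trans (cauchy_schwarz _ _) _.
Qed.

Lemma pinch_mull k Y : E k * pinch E Y = E k * Y * E k.
Proof.
rewrite /pinch mulr_sumr (bigD1 k) //= big1 => [|l /negPf lk].
  by rewrite !mulrA blockM eqxx addr0.
by rewrite !mulrA blockM eq_sym lk !mul0r.
Qed.

Lemma pinch_mulr k Y : pinch E Y * E k = E k * Y * E k.
Proof.
rewrite /pinch mulr_suml (bigD1 k) //= big1 => [|l /negPf lk].
  by rewrite -!mulrA blockM eqxx addr0.
by rewrite -!mulrA blockM lk !mulr0.
Qed.

Lemma pinch_herm Y : herm Y -> herm (pinch E Y).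
Proof.
move=> hY; rewrite /herm /pinch adj_sum; apply: eq_bigr => k _.
by rewrite !adjM hY block_herm mulrA.
Qed.

Lemma pinch_norm Y : opn (pinch E Y) <= opn Y.
Proof.
apply: (@schur_test _ _ _ _ E E _ (fun k l => (k == l)%:R * opn Y)) => //.
- exact: opnorm_ge0.
- move=> k l; rewrite pinch_mull -mulrA blockM; case: eqP => [_|_].
    rewrite mul1r -[leRHS]mulr1; apply: opnormM_le; last exact: block_norm.
    by rewrite -[leRHS]mul1r; apply: opnormM_le => //; exact: block_norm.
  by rewrite mulr0 opnorm0 mul0r.
- move=> k; rewrite (bigD1 k) //= eqxx mul1r big1 ?addr0 // => l.
  by rewrite eq_sym => /negPf->; rewrite mul0r.
- move=> k; rewrite (bigD1 k) //= eqxx mul1r big1 ?addr0 // => l.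
  by move=> /negPf->; rewrite mul0r.
Qed.

Lemma pinch_comml M Y : (forall k, M * E k = E k * M) -> M * pinch E Y = pinch E (M * Y).
Proof.
by move=> ME; rewrite /pinch mulr_sumr; apply: eq_bigr => k _; rewrite !mulrA ME.
Qed.

Lemma pinch_commr M Y : (forall k, M * E k = E k * M) -> pinch E Y * M = pinch E (Y * M).
Proof.
move=> ME; rewrite /pinch mulr_suml; apply: eq_bigr => k _.
by rewrite -!mulrA ME.
Qed.

Lemma pinchB Y M : pinch E (Y - M) = pinch E Y - pinch E M.
Proof. by rewrite /pinch -sumrB; apply: eq_bigr => k _; rewrite mulrBr mulrBl. Qed.

Lemma pinch_label K (c : I -> R) Y : (forall k, K * E k = (c k)%:C%C *: E k) ->
  (forall k, E k * K = (c k)%:C%C *: E k) -> K * pinch E Y = pinch E Y * K.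
Proof.
move=> KE EK; rewrite /pinch mulr_sumr mulr_suml; apply: eq_bigr => k _.
by rewrite !mulrA KE -[RHS]mulrA EK scalemulAr !scalemulAl.
Qed.

Lemma pinch_off k l Y :
  E k * (Y - pinch E Y) * E l = if k == l then 0 else E k * Y * E l.
Proof.
rewrite mulrBr mulrBl pinch_mull -(mulrA (E k * Y)) blockM.
by case: eqP => [->|_]; rewrite ?subrr // mulr0 subr0.
Qed.

End Pinching.

Section CellPinching.
Context {R : realType}.
Local Notation C := R[i].
Implicit Types (f g : R -> R).

Lemma cellmx_comm n (A Y : 'M[C]_n) r w k : herm A -> A * Y = Y * A ->
  cellmx r w A k * Y = Y * cellmx r w A k.
Proof. by move=> hA AY; exact: fc_comm. Qed.

(** Pinching along spectral cells of [A] barely changes a matrix that almost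
commutes with [A], except near the cell boundaries. *)
Lemma pinch_cells_near n (A B : 'M[C]_n) r w M g tau :
  herm A -> opn A <= r -> 0 < w -> 2 * r < w * M%:R -> 0 < tau ->
  (forall x, `|g x| <= 1) ->
  (forall x (k : nat), g x != 0 -> cell r w x = k%:Z ->
     k%:R * w - r + tau <= x /\ x <= k.+1%:R * w - r - tau) ->
  opn ((B - pinch (fun k : 'I_M => cellmx r w A k) B) * fc g A) <=
    M%:R * (opn (A * B - B * A) / tau).
Proof.
move=> hA Ar w0 rM tau0 g1 gcell; pose E (k : 'I_M) := cellmx r w A k.
have bE : blocks E by exact: cellmx_blocks.
set b := opn _ / tau; have b0 : 0 <= b by rewrite divr_ge0 ?opnorm_ge0 // ltW.
apply: (@schur_test _ _ _ _ E E _ (fun _ _ => b)) => //; first by rewrite mulr_ge0 ?ler0n.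
- move=> k l.
  have gE : fc g A * E l = E l * fc g A.
    by rewrite /E /cellmx !fcM; apply: fc_ext => x; rewrite mulrC.
  have -> : E k * ((B - pinch E B) * fc g A) * E l = E k * (B - pinch E B) * E l * fc g A.
    by rewrite -!mulrA gE.
  rewrite pinch_off //; case: eqP => [_|kl]; first by rewrite mul0r opnorm0.
  have kl' : (k : nat) != l by apply/eqP => e; apply: kl; exact: val_inj.
  rewrite -mulrA {2}/E /cellmx fcM /b ler_pdivlMr // mulrC.
  have bound1 (m : nat) x : `|(cell r w x == m)%:R| <= 1 :> R.
    by case: eqP; rewrite ?normr1 ?normr0.
  have supp1 (m : nat) x : (cell r w x == m)%:R != 0 :> R ->
      m%:R * w - r <= x /\ x <= m.+1%:R * w - r.
    rewrite pnatr_eq0 eqb0 negbK cellP // => /andP[x1 x2]; split => //.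
    by move: x2; rewrite intrD -pmulrn natr1 => /ltW.
  have supp2 x : (cell r w x == l)%:R * g x != 0 :> R ->
      l%:R * w - r + tau <= x /\ x <= l.+1%:R * w - r - tau.
    by rewrite mulf_eq0 negb_or pnatr_eq0 eqb0 negbK => /andP[/eqP cl gx]; exact: gcell.
  have bound2 x : `|(cell r w x == l)%:R * g x| <= 1.
    by rewrite normrM -[leRHS]mulr1 ler_pM.
  have mono (m m' : nat) : (m < m')%N -> m.+1%:R * w <= m'%:R * w.
    by move=> mm; rewrite ler_pM2r // ler_nat.
  case: (ltngtP k l) kl' => // kl0 _; have := mono _ _ kl0.
    have -> : tau = (l%:R * w - r + tau) - (l%:R * w - r) by ring.
    move=> h; apply: gap_le => // x => [/supp1[_]|/supp2[]//].
    lra.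
  have -> : tau = (l.+1%:R * w - r) - (l.+1%:R * w - r - tau) by ring.
  move=> h; apply: gap_ge => // x => [/supp1[]|/supp2[]//].
  lra.
- by move=> k; rewrite sumr_const card_ord mulr_natl.
- by move=> k; rewrite sumr_const card_ord mulr_natl.
Qed.

End CellPinching.

(** * Polar parts of almost normal matrices *)

(** The cap at 4 makes the function bounded. It is not felt on the matrix
[adj Z * Z], where [Z] is almost [D + iB], whose norm is at most [49 / 16]. *)
Definition fourth_root (R : realType) (x : R) : R :=
  Num.sqrt (Num.sqrt (Num.min x 4)).

Definition repart (R : realType) n (U : 'M[R[i]]_n) : 'M[R[i]]_n :=
  (2^-1)%:C%C *: (U + adj U).

Definition impart (R : realType) n (U : 'M[R[i]]_n) : 'M[R[i]]_n :=
  (2^-1)%:C%C *: ('i *: (adj U - U)).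

Section PolarPart.
Context {R : realType}.
Local Notation C := R[i].

Lemma sqrt_holder (x y : R) : `|Num.sqrt x - Num.sqrt y| <= Num.sqrt `|x - y|.
Proof.
wlog xy : x y / y <= x.
  by move=> h; have [/h//|/ltW/h] := leP y x; rewrite distrC [`|y - x|]distrC.
have sxy : Num.sqrt y <= Num.sqrt x by exact: ler_wsqrtr.
rewrite !ger0_norm ?subr_ge0 //.
have [y0|/ltW y0] := leP 0 y; last first.
  by rewrite [Num.sqrt y]ler0_sqrtr // subr0 ler_wsqrtr // lerBrDr gerDl.
have x0 := le_trans y0 xy.
rewrite -ler_sqr ?nnegrE ?subr_ge0 ?sqrtr_ge0 // sqr_sqrtr ?subr_ge0 //.
have := sqr_sqrtr x0; have := sqr_sqrtr y0; have := sqrtr_ge0 y.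
move: (Num.sqrt x) (Num.sqrt y) sxy => u v *; nra.
Qed.

Lemma ucont_fourth_root : ucont (@fourth_root R).
Proof.
move=> e e0; exists (e ^+ 4); first by rewrite exprn_gt0.
move=> x y xy; rewrite /fourth_root.
have m1 : `|Num.min x 4 - Num.min y 4| <= e ^+ 4.
  apply: le_trans xy; rewrite ler_norml.
  have := ler_norm (x - y); have := ler_norm (y - x); rewrite [`|y - x|]distrC.
  have [x4|x4] := leP x 4; have [y4|y4] := leP y 4; move=> *; apply/andP; split; lra.
apply: le_trans (sqrt_holder _ _) _.
apply: (@le_trans _ _ (Num.sqrt (Num.sqrt (e ^+ 4)))).
  by rewrite ler_wsqrtr //; apply: le_trans (sqrt_holder _ _) _; rewrite ler_wsqrtr.
by rewrite (exprM e 2 2) sqrtr_sqr ger0_norm ?sqr_ge0 // sqrtr_sqr ger0_norm // ltW.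
Qed.

Lemma fourth_root_osc (x y : R) : `|fourth_root x - fourth_root y| <= 2.
Proof.
have b (z : R) : 0 <= fourth_root z <= 2.
  rewrite sqrtr_ge0 /=; have -> : 2 = Num.sqrt (2 ^+ 2) :> R by rewrite sqrtr_sqr ger0_norm.
  rewrite ler_wsqrtr // (_ : 2 ^+ 2 = Num.sqrt (4 ^+ 2)); last by rewrite sqrtr_sqr ger0_norm //; ring.
  by rewrite ler_wsqrtr // (@le_trans _ _ 4) ?ge_min ?lexx ?orbT // expr2; lra.
have /andP[? ?] := b x; have /andP[? ?] := b y.
by rewrite ler_norml; apply/andP; split; lra.
Qed.

(** Arbitrarily small scalar shifts make a matrix invertible, since its spectrum is
finite. This is where finiteness of the dimension is essential: in infinite
dimension the Fredholm index of [D + iB] may forbid such a shift. *)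
Lemma shift_unitmx n (Z : 'M[C]_n) (tau : R) : 0 < tau ->
  exists2 t : R, 0 < t <= tau & Z + t%:C%C *: (1 : 'M[C]_n) \in unitmx.
Proof.
move=> tau0; pose p := char_poly (- Z).
pose t (k : nat) : R := tau / k.+1%:R.
pose rs := [seq (t k)%:C%C | k <- iota 0 n.+1].
have t0 k : 0 < t k by rewrite divr_gt0 ?ltr0n.
have urs : uniq rs.
  rewrite map_inj_uniq ?iota_uniq // => k l /complexI.
  rewrite /t => /(mulfI (lt0r_neq0 tau0))/invr_inj/eqP.
  by rewrite eqr_nat => /eqP[].
have [/allP allr|] := boolP (all (root p) rs).
  have := max_poly_roots (monic_neq0 (char_poly_monic (- Z))) _ urs.
  by rewrite size_char_poly size_map size_iota ltnn => /(_ (introT allP allr)).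
case/allPn => _ /mapP[k _ ->] nroot; exists (t k).
  by rewrite t0 /t ler_pdivrMr ?ltr0n // ler_peMr ?(ltW tau0) // ler1n.
move: nroot; rewrite /p -eigenvalue_root_char /eigenvalue negbK => /eqP e0.
have : row_free (- Z - ((t k)%:C%C)%:M).
  by rewrite -kermx_eq0; apply/eqP.
rewrite row_free_unit => u; have -> : Z + (t k)%:C%C *: (1 : 'M[C]_n) = - (- Z - ((t k)%:C%C)%:M).
  by rewrite opprB opprK addrC -scalemx1.
by rewrite -scaleN1r unitmxZ // unitrN1.
Qed.

Lemma opn_half n (M : 'M[C]_n) : opn ((2^-1)%:C%C *: M) <= opn M / 2.
Proof. by rewrite mulrC; apply: le_trans (opnormZ _ _) _; rewrite ger0_norm ?invr_ge0. Qed.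

Lemma self_commutator n (D B : 'M[C]_n) :
  (D + 'i *: B) * (D - 'i *: B) - (D - 'i *: B) * (D + 'i *: B) =
  - ('i *: ((D * B - B * D) + (D * B - B * D))).
Proof.
rewrite !(mulrDl, mulrDr, mulrN, mulNr) !(scalemulAl, scalemulAr) !scalerA.
have -> : 'i * 'i = -1 :> C by rewrite -expr2 sqrCi.
by mx_linear.
Qed.

Lemma adj_comm_norm n (U Q : 'M[C]_n) : herm Q ->
  opn (adj U * Q - Q * adj U) = opn (U * Q - Q * U).
Proof. by move=> hQ; rewrite -opnorm_adj adjB !adjM adjK hQ opnormBC. Qed.

Lemma herm_repart n (U : 'M[C]_n) : herm (repart U).
Proof. by apply: hermZ; rewrite /herm adjD adjK addrC. Qed.

Lemma herm_impart n (U : 'M[C]_n) : herm (impart U).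
Proof. by apply: hermZ; rewrite /herm adjZ conjCi adjB adjK scaleNr -scalerN opprB. Qed.

Lemma repart_norm n (U : 'M[C]_n) : opn (repart U) <= opn U.
Proof.
apply: le_trans (opn_half _) _; have := opnormD U (adj U); rewrite opnorm_adj; lra.
Qed.

Lemma impart_norm n (U : 'M[C]_n) : opn (impart U) <= opn U.
Proof.
apply: le_trans (opn_half _) _; have := opnormB (adj U) U; rewrite opnorm_adj.
have := opnorm_Zi (adj U - U); lra.
Qed.

Lemma repartB n (U V : 'M[C]_n) : repart (U - V) = repart U - repart V.
Proof. by rewrite /repart adjB -scalerBr opprD addrACA. Qed.

Lemma impartB n (U V : 'M[C]_n) : impart (U - V) = impart U - impart V.
Proof. by rewrite /impart adjB -!scalerBr !opprB addrACA [in RHS]addrACA; congr (_ *: (_ *: _)); mx_linear. Qed.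

Lemma repart_conj n (U Q : 'M[C]_n) : herm Q -> repart (Q * U * Q) = Q * repart U * Q.
Proof.
move=> hQ; rewrite /repart !adjM hQ scalemulAr scalemulAl mulrDr mulrDl.
by rewrite !mulrA.
Qed.

Lemma impart_conj n (U Q : 'M[C]_n) : herm Q -> impart (Q * U * Q) = Q * impart U * Q.
Proof.
move=> hQ; rewrite /impart !adjM hQ !(scalemulAr, scalemulAl) mulrBr mulrBl.
by rewrite !mulrA.
Qed.

Lemma repart_comm n (U M : 'M[C]_n) : M * U = U * M -> M * adj U = adj U * M ->
  M * repart U = repart U * M.
Proof. by move=> h1 h2; rewrite /repart scalemulAr scalemulAl mulrDr mulrDl h1 h2. Qed.

Lemma impart_comm n (U M : 'M[C]_n) : M * U = U * M -> M * adj U = adj U * M ->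
  M * impart U = impart U * M.
Proof.
by move=> h1 h2; rewrite /impart !(scalemulAr, scalemulAl) mulrBr mulrBl h1 h2.
Qed.

Lemma repart_comm_norm n (U Q : 'M[C]_n) : herm Q ->
  opn (repart U * Q - Q * repart U) <= opn (U * Q - Q * U).
Proof.
move=> hQ; have -> : repart U * Q - Q * repart U =
    (2^-1)%:C%C *: ((U * Q - Q * U) + (adj U * Q - Q * adj U)).
  by rewrite /repart scalemulAl scalemulAr -scalerBr mulrDl mulrDr opprD addrACA.
apply: le_trans (opn_half _) _.
have := opnormD (U * Q - Q * U) (adj U * Q - Q * adj U).
rewrite adj_comm_norm //; lra.
Qed.

Lemma impart_comm_norm n (U Q : 'M[C]_n) : herm Q ->
  opn (impart U * Q - Q * impart U) <= opn (U * Q - Q * U).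
Proof.
move=> hQ; have -> : impart U * Q - Q * impart U =
    (2^-1)%:C%C *: ('i *: ((adj U * Q - Q * adj U) - (U * Q - Q * U))).
  rewrite /impart !(scalemulAl, scalemulAr) -!scalerBr mulrBl mulrBr.
  by congr (_ *: (_ *: _)); mx_linear.
apply: le_trans (opn_half _) _.
have := opnorm_Zi ((adj U * Q - Q * adj U) - (U * Q - Q * U)).
have := opnormB (adj U * Q - Q * adj U) (U * Q - Q * U).
rewrite adj_comm_norm //; lra.
Qed.

Lemma cartesianK n (D B : 'M[C]_n) : herm D -> herm B ->
  repart (D + 'i *: B) = D /\ impart (D + 'i *: B) = B.
Proof.
move=> hD hB; have half (M : 'M[C]_n) : (2^-1)%:C%C *: (M + M) = M.
  rewrite scalerDr -scalerDl -rmorphD (_ : 2^-1 + 2^-1 = 1 :> R) ?rmorph1 ?scale1r //.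
  by lra.
rewrite /repart /impart adjD adjZ hD hB conjCi scaleNr.
rewrite (_ : D + 'i *: B + (D - 'i *: B) = D + D); last by mx_linear.
rewrite (_ : D - 'i *: B - (D + 'i *: B) = - 'i *: (B + B)); last by mx_linear.
by rewrite ['i *: _]scalerA mulrN -expr2 sqrCi opprK scale1r !half.
Qed.

(** Two almost commuting Hermitian matrices [D] and [B] arise from exactly
commuting ones [X] and [Y], the real and imaginary parts of the unitary polar
factor of [D + iB], by compression with the fourth root [Q] of its modulus
squared. The factor almost commutes with the modulus squared because [D + iB]
is almost normal, and hence with [Q]. *)
Lemma polar_parts (e : R) : 0 < e -> exists2 d : R, 0 < d &
  forall n (D B : 'M[C]_n), herm D -> herm B -> opn D <= 1 / 2 -> opn B <= 1 ->
    opn (D * B - B * D) <= d -> exists X Y Q : 'M[C]_n,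
  [/\ [/\ herm X, herm Y & herm Q], [/\ opn X <= 1, opn Y <= 1 & opn Q <= 4 / 3],
      X * Y = Y * X,
      [/\ opn (X * Q - Q * X) <= e, opn (Y * Q - Q * Y) <= e,
          opn (D - Q * X * Q) <= e & opn (B - Q * Y * Q) <= e] &
      forall M, M * D = D * M -> M * B = B * M -> M * X = X * M /\ M * Y = Y * M].
Proof.
move=> e0; have e4 : 0 < e / 4 by rewrite divr_gt0.
have [d d0 dP] := @fc_intertwine_small R _ 4 1 2 _ ucont_fourth_root fourth_root_osc e4 ler01.
exists (d / 2) => [|n D B hD hB Dn Bn DB]; first by rewrite divr_gt0.
pose tau := Num.min (e / 4) (1 / 4).
have tau0 : 0 < tau by rewrite lt_min e4; lra.
have [t /andP[t0 ttau] uZ] := shift_unitmx (D + 'i *: B) tau0.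
have te : t <= e / 4 by apply: le_trans ttau _; rewrite ge_min lexx.
have t4 : t <= 1 / 4 by apply: le_trans ttau _; rewrite ge_min lexx orbT.
set Z := _ + _ in uZ; pose Dt : 'M[C]_n := D + t%:C%C *: (1 : 'M[C]_n).
have hDt : herm Dt by apply: hermD => //; apply: hermZ; exact: herm1.
have adjiB : adj ('i *: B) = - ('i *: B) by rewrite adjZ conjCi hB scaleNr.
have ZE : Z = Dt + 'i *: B by rewrite /Z /Dt addrAC.
have aZ : adj Z = Dt - 'i *: B by rewrite ZE adjD hDt adjiB.
pose S := adj Z * Z; have hS : herm S by rewrite /herm /S adjM adjK.
have Zn : opn Z <= 7 / 4.
  rewrite ZE; have h1 : opn Dt <= 3 / 4.
    have h : opn (t%:C%C *: (1 : 'M[C]_n)) <= t.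
      apply: le_trans (opnormZ _ _) _; rewrite ger0_norm ?(ltW t0) //.
      by rewrite ler_piMr ?(ltW t0) ?opnorm1.
    by have := opnormD_le Dn h; rewrite -/Dt; lra.
  by have := opnormD_le h1 (le_trans (opnorm_Zi B) Bn); lra.
have Sn : opn S <= 49 / 16.
  have : opn (adj Z) <= 7 / 4 by rewrite opnorm_adj.
  by move=> h; have := opnormM_le h Zn; lra.
have evS j : 0 < ev S j <= 49 / 16.
  have [v v1 Sv] := ev_vector j hS.
  have Zv : ev S j = l2norm (Z *m v) ^+ 2.
    by rewrite l2norm_sqr rip_adj -mulmx_app -/S Sv ripZl v1 mulr1.
  apply/andP; split; last by apply: le_trans (ler_norm _) _; apply: le_trans (ev_le j hS) Sn.
  rewrite Zv exprn_gt0 // lt0r l2norm_ge0 andbT; apply/eqP => /l2norm_eq0 Zv0.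
  have v0 : v = 0 by rewrite -(mulKmx uZ v) Zv0 mulmx0.
  by move: v1; rewrite v0 rip0r => /eqP; rewrite eq_sym oner_eq0.
pose Q := fc (@fourth_root R) S.
have qE j : fourth_root (ev S j) = Num.sqrt (Num.sqrt (ev S j)).
  by have /andP[_ ?] := evS j; rewrite /fourth_root min_l //; lra.
pose G := fc (fun x => (Num.sqrt x)^-1) S.
pose U := Z * G.
have sq0 j : 0 < Num.sqrt (ev S j) by rewrite sqrtr_gt0; have /andP[] := evS j.
have UU : adj U * U = 1.
  have -> : adj U * U = G * S * G by rewrite /U adjM fc_herm /S !mulrA.
  rewrite -{1}(fc_id hS) /G !fcM -(fc1 S); apply: eq_fc => j /=; have /andP[/ltW p _] := evS j.
  rewrite -{2}(sqr_sqrtr p) expr2; field; exact: lt0r_neq0.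
have UU' : U * adj U = 1 by apply: mulmx1C.
have UQQ : U * Q * Q = Z.
  rewrite /U /G /Q -!mulrA !fcM -[RHS]mulr1 -(fc1 S); congr (_ * _); apply: eq_fc => j.
  rewrite qE -expr2 sqr_sqrtr ?sqrtr_ge0 // mulVf //; exact: lt0r_neq0.
have US : opn (U * S - S * U) <= d.
  have -> : U * S - S * U = (Z * adj Z - adj Z * Z) * U.
    by rewrite /U -[Z * G * S]mulrA (fcX _ hS) mulrBl /S !mulrA.
  rewrite -[leRHS]mulr1; apply: opnormM_le; last exact: opnorm_isometry.
  have -> : Z * adj Z - adj Z * Z = - ('i *: ((D * B - B * D) + (D * B - B * D))).
    rewrite aZ ZE; have DtB : Dt * B - B * Dt = D * B - B * D.
      by rewrite /Dt mulrDl mulrDr scalemulAl scalemulAr mul1r mulr1 opprD addrACA subrr addr0.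
    by rewrite -DtB self_commutator.
  rewrite opnormN; apply: le_trans (opnorm_Zi _) _.
  by have := opnormD_le DB DB; lra.
have Un : opn U <= 1 by exact: opnorm_isometry.
have aUn : opn (adj U) <= 1 by rewrite opnorm_adj.
have QUn : opn (U * Q - Q * U) <= e / 4.
  have S4 : opn S <= 4 by apply: le_trans Sn _; lra.
  have SU : opn (S * U - U * S) <= d by rewrite opnormBC.
  by rewrite opnormBC; exact: (dP _ _ _ _ hS hS S4 S4 Un SU).
have aQU : opn (adj U * Q - Q * adj U) <= e / 4.
  by rewrite adj_comm_norm //; exact: fc_herm.
have Qn : opn Q <= 4 / 3.
  apply: fc_norm_ev => // j; rewrite qE ger0_norm ?sqrtr_ge0 //.
  have -> : 4 / 3 = Num.sqrt ((4 / 3) ^+ 2) :> R by rewrite sqrtr_sqr ger0_norm.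
  rewrite ler_wsqrtr //.
  have -> : (4 / 3) ^+ 2 = Num.sqrt (((4 / 3) ^+ 2) ^+ 2) :> R by rewrite sqrtr_sqr ger0_norm ?sqr_ge0.
  rewrite ler_wsqrtr //; have /andP[_ h] := evS j; apply: le_trans h _; rewrite !expr2; lra.
have hQ : herm Q by exact: fc_herm.
have UQ1 : opn ((U * Q - Q * U) * Q) <= e / 3.
  by have := opnormM_le QUn Qn; lra.
have [rZ iZ] := cartesianK hDt hB; rewrite -ZE in rZ iZ.
have ZQ : Z - Q * U * Q = (U * Q - Q * U) * Q by rewrite mulrBl UQQ.
exists (repart U), (impart U), Q; split.
- by split=> //; [exact: herm_repart|exact: herm_impart].
- by split=> //; [exact: le_trans (repart_norm _) Un|exact: le_trans (impart_norm _) Un].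
- have UaU : U * adj U = adj U * U by rewrite UU UU'.
  apply: impart_comm; last by apply/esym; exact: repart_comm.
  by apply/esym; exact: repart_comm.
- have e4e : e / 4 <= e by lra.
  split.
  + exact: le_trans (repart_comm_norm _ hQ) (le_trans QUn e4e).
  + exact: le_trans (impart_comm_norm _ hQ) (le_trans QUn e4e).
  + have -> : D - Q * repart U * Q = repart (Z - Q * U * Q) - t%:C%C *: (1 : 'M[C]_n).
      by rewrite repartB repart_conj // rZ /Dt [RHS]addrAC addrK.
    have ht : opn (t%:C%C *: (1 : 'M[C]_n)) <= e / 4.
      apply: le_trans (opnormZ _ _) _; rewrite ger0_norm ?(ltW t0) //.
      by apply: le_trans te; rewrite ler_piMr ?(ltW t0) ?opnorm1.
    have h1 : opn (repart (Z - Q * U * Q)) <= e / 3.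
      by rewrite ZQ; exact: le_trans (repart_norm _) UQ1.
    by have := opnormB_le h1 ht; lra.
  + have -> : B - Q * impart U * Q = impart (Z - Q * U * Q).
      by rewrite impartB impart_conj // iZ.
    by rewrite ZQ; apply: le_trans (impart_norm _) _; apply: le_trans UQ1 _; lra.
- move=> M MD MB.
  have MDt : M * Dt = Dt * M.
    by apply: commrD MD _; apply: comm_scale; exact: commr1.
  have MZ : M * Z = Z * M by rewrite ZE; apply: commrD MDt _; exact: comm_scale.
  have MaZ : M * adj Z = adj Z * M.
    by rewrite aZ; apply: commrB MDt _; exact: comm_scale.
  have MG : M * G = G * M.
    apply/esym; apply: fc_comm => //.
    by rewrite /S -mulrA -MZ mulrA -MaZ mulrA.
  have MU : M * U = U * M by rewrite /U mulrA MZ -mulrA MG mulrA.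
  have MaU : M * adj U = adj U * M.
    by rewrite /U adjM fc_herm mulrA MG -mulrA MaZ mulrA.
  by split; [exact: repart_comm|exact: impart_comm].
Qed.

End PolarPart.

(** * Spectral comparison of a matrix with its compression *)

Section Compression.
Context {R : realType}.
Local Notation C := R[i].

Lemma ramp_compl_norm (a b x : R) : `|1 - ramp a b x| <= 1.
Proof.
have := ramp_ge0 a b x; have := ramp_le1 a b x => *.
by rewrite ler_norml; apply/andP; split; lra.
Qed.

Lemma ramp_compl_osc (a b x y : R) : `|(1 - ramp a b x) - (1 - ramp a b y)| <= 1.
Proof. by rewrite (_ : _ - _ = ramp a b y - ramp a b x) ?ramp_osc //; ring. Qed.

Lemma ucont_ramp_compl (a b : R) : a < b -> ucont (fun x => 1 - ramp a b x).
Proof.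
move=> ab e e0; have [w w0 h] := ucont_ramp ab e0; exists w => // x y xy.
by rewrite (_ : _ - _ = ramp a b y - ramp a b x) ?h // 1?distrC //; ring.
Qed.

Lemma compression_identity n (Q Xa X h D q : 'M[C]_n) :
  Xa * h = h * X -> q * D = D * q ->
  Q * Xa * Q * (h * q) - (h * q) * D =
  (Q * Xa * (Q * h - h * Q) - (h * Q - Q * h) * X * Q - h * (D - Q * X * Q)) * q.
Proof.
move=> Xah qD; have e1 : Q * Xa * h * Q = Q * h * X * Q by rewrite -(mulrA Q) Xah mulrA.
rewrite -(mulrA h q) qD !(mulrBl, mulrBr, mulrA) e1.
mx_linear.
Qed.

(** If [D] is close to [Q X Q], the part of [X] below [a0] misses the part of
[D] above [b]: cutting [X] off at [a] turns [Q X Q] into a matrix bounded by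
[a |Q|^2 < b], and the part of [X] below [a0], which almost commutes with [Q],
does not feel the cut. *)
Lemma compression_gap (a0 a b e : R) : 0 <= a -> a <= 1 -> a0 < a -> 16 / 9 * a < b ->
  0 < e -> exists2 d : R, 0 < d & forall n (X Q D : 'M[C]_n) (g : R -> R),
    herm X -> herm Q -> herm D -> opn X <= 1 -> opn Q <= 4 / 3 ->
    opn (X * Q - Q * X) <= d -> opn (D - Q * X * Q) <= d ->
    (forall x, g x != 0 -> b <= x) -> (forall x, `|g x| <= 1) ->
    opn (fc (fun x => 1 - ramp a0 a x) X * fc g D) <= e.
Proof.
move=> a_ge0 a_le1 a0a ab e0; set s := b - 16 / 9 * a.
have s0 : 0 < s by rewrite subr_gt0.
have se : 0 < e * s / 8 by rewrite divr_gt0 ?mulr_gt0.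
have y0 : 0 <= 4 / 3 :> R by lra.
have [d d0 dP] := fc_intertwine_small 1 (ucont_ramp_compl a0a) (ramp_compl_osc a0 a) se y0.
exists (Num.min d (e * s / 8)) => [|n X Q D g hX hQ hD X1 Qn XQ DQ gb g1].
  by rewrite lt_min d0.
have XQd : opn (X * Q - Q * X) <= d by apply: le_trans XQ _; rewrite ge_min lexx.
have DQe : opn (D - Q * X * Q) <= e * s / 8 by apply: le_trans DQ _; rewrite ge_min lexx orbT.
pose f x : R := 1 - ramp a0 a x.
set h := fc f X; set q := fc g D.
have hQ' : opn (h * Q - Q * h) <= e * s / 8 by exact: dP.
pose Xa := fc (fun x => Num.min x a) X.
have Xan : opn Xa <= 1.
  apply: (fc_norm hX X1) => // x; rewrite !ler_norml => /andP[x1 x2].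
  have a1 : -1 <= a by lra.
  by have [xa|xa] := leP x a; rewrite ?x1 ?x2 // a1 a_le1.
have Xah : Xa * h = h * X.
  rewrite -{1}(fc_id hX) /Xa /h !fcM; apply: fc_ext => x; rewrite /f.
  by have [xa|/ltW xa] := leP x a; [rewrite mulrC|rewrite ramp1 // subrr mulr0 mul0r].
have h1 : opn h <= 1 by apply: fc_norm1 => x; exact: ramp_compl_norm.
have q1 : opn q <= 1 by exact: fc_norm1.
pose D' := Q * Xa * Q.
have err : D' * (h * q) - (h * q) * D =
    (Q * Xa * (Q * h - h * Q) - (h * Q - Q * h) * X * Q - h * (D - Q * X * Q)) * q.
  by apply: compression_identity => //; exact: fcX.
have errn : opn (D' * (h * q) - (h * q) * D) <= e * s.
  have t1 : opn (Q * Xa * (Q * h - h * Q)) <= 4 / 3 * 1 * (e * s / 8).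
    by apply: opnormM_le; [exact: opnormM_le|rewrite opnormBC].
  have t2 : opn ((h * Q - Q * h) * X * Q) <= e * s / 8 * 1 * (4 / 3).
    by apply: opnormM_le => //; exact: opnormM_le.
  have t3 : opn (h * (D - Q * X * Q)) <= 1 * (e * s / 8) by exact: opnormM_le.
  rewrite err -[leRHS]mulr1; apply: opnormM_le => //.
  have := opnormB_le (opnormB_le t1 t2) t3; lra.
rewrite -(ler_pM2l s0) [s * e]mulrC; apply: le_trans errn; apply: sylvester => v.
  rewrite /D' !mulmx_app; set u := h *m (q *m v).
  rewrite [rip u _]rip_adj hQ.
  have Qu : l2norm (Q *m u) <= 4 / 3 * l2norm u.
    by apply: le_trans (l2norm_mulmx _ _) _; rewrite ler_wpM2r ?l2norm_ge0.
  have : rip (Q *m u) (Xa *m (Q *m u)) <= a * l2norm (Q *m u) ^+ 2.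
    have ge (x : R) : - a <= - Num.min x a by rewrite lerN2 ge_min lexx orbT.
    by have := fc_ge X (Q *m u) ge; rewrite -fcN mulNmx ripNr mulNr lerN2.
  move=> hh; apply: le_trans hh _.
  have : l2norm (Q *m u) ^+ 2 <= (4 / 3 * l2norm u) ^+ 2.
    by rewrite ler_sqr ?nnegrE ?mulr_ge0 ?l2norm_ge0.
  move=> /(ler_wpM2l a_ge0); rewrite exprMn; lra.
rewrite adjM fc_herm !mulmx_app fc_form_conj // fc_form_sqr; apply: fc_form_le => x.
have [->|/gb gx] := eqVneq (g x) 0; first by rewrite !mul0r.
have := mulr_ge0 (sqr_ge0 (g x)) (etrans (subr_ge0 _ _) gx); rewrite expr2; lra.
Qed.

End Compression.

(** * The model of one jump *)

Section LocalModel.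
Context {R : realType}.
Local Notation C := R[i].

(** Selects the upper end of the spectrum of a contraction. *)
Definition upper (x : R) : R := ramp (8 / 10) (9 / 10) x.
Definition raised (x : R) : R := Num.max x (3 / 10).

Lemma le_min_both (x a b : R) : x <= Num.min a b -> x <= a /\ x <= b.
Proof. by rewrite le_min => /andP. Qed.

Lemma upper_lt : 8 / 10 < 9 / 10 :> R.
Proof. lra. Qed.

Lemma upper_raised (x : R) : x * upper x = upper x * raised x.
Proof.
rewrite /upper /raised; have [x8|x8] := leP x (8 / 10).
  by rewrite (ramp0 upper_lt x8) mulr0 mul0r.
by rewrite max_l 1?mulrC //; lra.
Qed.

Lemma fc_opp n (X : 'M[C]_n) f : herm X -> fc f (- X) = fc (fun x => f (- x)) X.
Proof.
by move=> hX; rewrite -{1}(fc_id hX) fcN fc_comp.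
Qed.

Lemma opp_comm n (X Y : 'M[C]_n) : - X * Y - Y * - X = - (X * Y - Y * X).
Proof. by rewrite mulNr mulrN opprB opprK addrC. Qed.

(** At the upper end of the spectrum of [B], which is close to [Q Y Q], the matrix
[Y] is almost at least [3 / 10]: it may be replaced there by its function
[raised Y], because by [compression_gap] the part of [Y] below [3 / 10] misses
the upper end. *)
Lemma upper_part_model e : 0 < e -> exists2 d : R, 0 < d & forall n (Y Q B : 'M[C]_n),
    herm Y -> herm Q -> herm B -> opn Y <= 1 -> opn Q <= 4 / 3 -> opn B <= 1 ->
    opn (Y * Q - Q * Y) <= d -> opn (B - Q * Y * Q) <= d ->
    opn (Y * fc upper B - fc upper B * fc raised Y) <= e.
Proof.
move=> e0; have e3 : 0 < e / 4 by rewrite divr_gt0.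
have [| | | |d1 d10 d1P] := @compression_gap R (3 / 10) (4 / 10) (8 / 10) (e / 4) _ _ _ _ e3; try lra.
have [d2 d20 d2P] := fc_intertwine_small 1 (ucont_ramp upper_lt) (ramp_osc _ _) e3 ler01.
exists (Num.min d1 (Num.min (e / 4) (d2 / 8))).
  by rewrite !lt_min d10 e3 divr_gt0.
move=> n Y Q B hY hQ hB Y1 Q1 B1; rewrite !le_min => /and3P[YQ1 _ YQ3] /and3P[BQ1 _ BQ3].
set k := fc upper B; set Ya := fc raised Y.
pose h := fc (fun x => 1 - ramp (3 / 10) (4 / 10) x) Y.
have hk : opn (h * k) <= e / 4.
  apply: (d1P _ Y Q B) => // x; last exact: ramp_norm.
  by apply: contra_neqP => /negP; rewrite -ltNge => /ltW; exact: ramp0 upper_lt.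
have k1 : opn k <= 1 by apply: fc_norm1 => x; exact: ramp_norm.
have YB : opn (B * Y - Y * B) <= d2.
  have -> : B * Y - Y * B = ((B - Q * Y * Q) * Y - Y * (B - Q * Y * Q)) -
      ((Y * Q - Q * Y) * Y * Q + Q * Y * (Y * Q - Q * Y)).
    by rewrite !(mulrBl, mulrBr, mulrA); mx_linear.
  have t1 : opn ((B - Q * Y * Q) * Y) <= d2 / 8 * 1 by exact: opnormM_le.
  have t2 : opn (Y * (B - Q * Y * Q)) <= 1 * (d2 / 8) by exact: opnormM_le.
  have t3 : opn ((Y * Q - Q * Y) * Y * Q) <= d2 / 8 * 1 * (4 / 3).
    by apply: opnormM_le => //; exact: opnormM_le.
  have t4 : opn (Q * Y * (Y * Q - Q * Y)) <= 4 / 3 * 1 * (d2 / 8).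
    by apply: opnormM_le => //; exact: opnormM_le.
  have := opnormB_le (opnormB_le t1 t2) (opnormD_le t3 t4).
  move=> t; apply: le_trans t _; lra.
have Yk : opn (k * Y - Y * k) <= e / 4 by exact: (d2P _ B B Y).
pose Z := fc (fun x => x - raised x) Y.
have Zn : opn Z <= 2.
  apply: (fc_norm hY Y1) => // x; rewrite ler_norml => /andP[x1 x2].
  by rewrite /raised ler_norml; have [?|?] := leP x (3 / 10); apply/andP; split; lra.
have YZ : Y - Ya = h * Z.
  rewrite -{1}(fc_id hY) fcB fcM; apply: fc_ext => x /=; rewrite /raised.
  have [x3|/ltW x3] := leP x (3 / 10); first by rewrite ramp0 ?subr0 ?mul1r //; lra.
  by rewrite subrr mulr0.
have -> : Y * k - k * Ya = - (k * Y - Y * k) + k * h * Z.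
  by rewrite -mulrA -YZ mulrBr; mx_linear.
have kh : opn (k * h) <= e / 4 by rewrite -opnorm_adj adjM !fc_herm.
have t1 := opnormM_le kh Zn.
have t2 : opn (- (k * Y - Y * k)) <= e / 4 by rewrite opnormN.
have := opnormD_le t2 t1; move=> t; apply: le_trans t _; lra.
Qed.

(** By [compression_gap], the part of [X] below [0] misses the part of [D] above
[1 / 5]. *)
Lemma sign_part_model e : 0 < e -> exists2 d : R, 0 < d &
  forall n (X Q D : 'M[C]_n) (u s : R -> R),
    herm X -> herm Q -> herm D -> opn X <= 1 -> opn Q <= 4 / 3 ->
    opn (X * Q - Q * X) <= d -> opn (D - Q * X * Q) <= d ->
    (forall x, `|u x| <= 1) -> (forall x, u x != 0 -> 1 / 5 <= x) ->
    (forall x, `|s x| <= 1) -> (forall x, s x != 0 -> x <= 0) ->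
    opn (fc s X * fc u D) <= e.
Proof.
move=> e0; have [| | | |d d0 dP] := @compression_gap R 0 (1 / 10) (1 / 5) e _ _ _ _ e0; try lra.
exists d => // n X Q D u s hX hQ hD X1 Q1 XQ DQ u1 u5 s1 s0.
pose h := fc (fun x => 1 - ramp 0 (1 / 10) x) X.
have -> : fc s X = fc s X * h.
  rewrite /h fcM; apply: fc_ext => x; have [->|/s0 x0] := eqVneq (s x) 0; first by rewrite mul0r.
  by rewrite ramp0 ?subr0 ?mulr1 //; lra.
rewrite -mulrA -[leRHS]mul1r; apply: opnormM_le; first exact: fc_norm1.
exact: (dP _ X Q D u).
Qed.

(** Around one jump, at [D = 0]: [P] selects the right half of the unitary polar
factor of [D + iB] and so commutes with the imaginary part [Y] of this factor. It
is essentially decided by [D] away from the jump, while the sign of [Y] is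
essentially decided by [B] when [B] is close to [1] or to [-1]. *)
Lemma local_model (e : R) : 0 < e -> exists2 d : R, 0 < d &
  forall n (D B : 'M[C]_n), herm D -> herm B -> opn D <= 1 / 2 -> opn B <= 1 ->
    opn (D * B - B * D) <= d -> exists P Y : 'M[C]_n,
  [/\ [/\ herm P, P * P = P & herm Y], opn Y <= 1,
      P * Y = Y * P /\ (forall M, M * D = D * M -> M * B = B * M ->
        M * P = P * M /\ M * Y = Y * M),
      forall u : R -> R, (forall x, `|u x| <= 1) -> (forall x, u x != 0 -> 1 / 5 <= x) ->
        opn ((1 - P) * fc u D) <= e /\ opn (P * fc u (- D)) <= e &
      opn (Y * fc upper B - fc upper B * fc raised Y) <= e /\
      opn (- Y * fc upper (- B) - fc upper (- B) * fc raised (- Y)) <= e].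
Proof.
move=> e0; have [d1 d10 d1P] := upper_part_model e0.
have [d2 d20 d2P] := sign_part_model e0.
have d120 : 0 < Num.min d1 d2 by rewrite lt_min d10.
have [d d0 dP] := polar_parts d120; exists d => // n D B hD hB D1 B1 DB.
have [X [Y [Q [[hX hY hQ] [X1 Y1 Q1] XY [XQ YQ DQ BQ] cXY]]]] := dP _ _ _ hD hB D1 B1 DB.
have [_ XQ2] := le_min_both XQ; have [YQ1 _] := le_min_both YQ.
have [_ DQ2] := le_min_both DQ; have [BQ1 _] := le_min_both BQ.
have neg1 (Z : 'M[C]_n) c : opn Z <= c -> opn (- Z) <= c by rewrite opnormN.
have negQ (Z : 'M[C]_n) c : opn (Z * Q - Q * Z) <= c -> opn (- Z * Q - Q * - Z) <= c.
  by rewrite opp_comm opnormN.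
have negD (Z W : 'M[C]_n) c : opn (Z - Q * W * Q) <= c -> opn (- Z - Q * - W * Q) <= c.
  by rewrite mulrN mulNr -opprD opnormN.
pose s (x : R) : R := (0 < x)%R%:R; pose P := fc s X.
have s1 x : `|s x| <= 1 by rewrite /s; case: (0 < x); rewrite ?normr1 ?normr0.
exists P, Y; split => //.
- split => //; first exact: fc_herm.
  by rewrite fcM; apply: fc_ext => x; rewrite /s; case: (0 < x); rewrite ?mulr1 ?mulr0.
- split; first exact: fc_comm.
  move=> M MD MB; have [MX MY] := cXY M MD MB; split => //.
  by apply/esym; apply: fc_comm.
- move=> u u1 u5; split.
    rewrite -(fc1 X) fcB; apply: (d2P n _ _ _ _ _ hX hQ hD X1 Q1 XQ2 DQ2 u1 u5) => x.
      by rewrite /s; case: (0 < x); rewrite ?subrr ?subr0 ?normr1 ?normr0.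
    by rewrite /s; case: ltP => //; rewrite subrr eqxx.
  have -> : P = fc (fun x => s (- x)) (- X).
    by rewrite fc_opp //; apply: fc_ext => x; rewrite opprK.
  apply: (d2P n _ _ _ _ _ (hermN hX) hQ (hermN hD) (neg1 _ _ X1) Q1 (negQ _ _ XQ2)
    (negD _ _ _ DQ2) u1 u5) => x; first exact: s1.
  by rewrite /s; case: ltP; rewrite ?eqxx // oppr_gt0 => /ltW.
- split; first exact: (d1P n _ _ _ hY hQ hB Y1 Q1 B1 YQ1 BQ1).
  exact: (d1P n _ _ _ (hermN hY) hQ (hermN hB) (neg1 _ _ Y1) Q1 (neg1 _ _ B1)
    (negQ _ _ YQ1) (negD _ _ _ BQ1)).
Qed.

(** The range of [p], where [phi] is nonpositive, almost misses the upper end of the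
spectrum of [B]. There both [Y] and [B] may be replaced by matrices that are at
least [3 / 10], hence [phi] by one that is at least [3 / 10] as well, because the
squares of [G] and [Gt] add up to at least [1]; [sylvester] compares it with
[phi]. *)
Lemma end_estimate n (phi Y B Bd G Gt p : 'M[C]_n) (e : R) :
  herm Y -> herm B -> herm G -> herm Gt ->
  opn Y <= 1 -> opn B <= 1 -> opn G <= 1 -> opn Gt <= 1 ->
  (forall v, l2norm v ^+ 2 <= l2norm (G *m v) ^+ 2 + l2norm (Gt *m v) ^+ 2) ->
  opn p <= 1 -> phi * p = p * phi -> (forall v, rip (p *m v) (phi *m (p *m v)) <= 0) ->
  opn (phi - (Gt * Y * Gt + G * B * G)) <= e ->
  opn (G * fc upper B - fc upper B * G) <= e ->
  opn (Gt * fc upper B - fc upper Bd * Gt) <= e ->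
  opn (Y * fc upper Bd - fc upper Bd * fc raised Y) <= e ->
  3 / 10 * opn (p * fc upper B) <= 6 * e.
Proof.
move=> hY hB hG hGt Y1 B1 G1 Gt1 cover p1 php neg e1 e2 e3 e4.
set k := fc upper B in e2 e3 *; set kd := fc upper Bd in e3 e4.
set Ya := fc raised Y in e4; pose Ba := fc raised B.
pose phi2 := Gt * Ya * Gt + G * Ba * G.
have k1 : opn k <= 1 by apply: fc_norm1 => x; exact: ramp_norm.
have raised1 (x : R) : `|x| <= 1 -> `|raised x| <= 1.
  by rewrite !ler_norml /raised => /andP[? ?]; have [?|?] := leP x (3 / 10); apply/andP; split; lra.
have Ya1 : opn Ya <= 1 by apply: (fc_norm hY Y1) => // x; exact: raised1.
have Ba1 : opn Ba <= 1 by apply: (fc_norm hB B1) => // x; exact: raised1.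
have Bk : B * k = k * Ba.
  by rewrite -{1}(fc_id hB) !fcM; apply: fc_ext => x; exact: upper_raised.
have id : phi * k - k * phi2 = (phi - (Gt * Y * Gt + G * B * G)) * k +
    (Gt * Y * (Gt * k - kd * Gt) + Gt * (Y * kd - kd * Ya) * Gt +
     (Gt * kd - k * Gt) * Ya * Gt) +
    (G * B * (G * k - k * G) + (G * k - k * G) * Ba * G).
  have e0 : G * B * k * G = G * k * Ba * G by rewrite -(mulrA G) Bk mulrA.
  rewrite /phi2 !(mulrDl, mulrDr, mulrN, mulNr, mulrA) e0; mx_linear.
have Gtk : opn (Gt * kd - k * Gt) <= e.
  by rewrite -opnorm_adj adjB !adjM hGt !fc_herm opnormBC.
have err : opn (phi * k - k * phi2) <= 6 * e.
  have t1 := opnormM_le e1 k1.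
  have t2 := opnormM_le (opnormM_le Gt1 Y1) e3.
  have t3 := opnormM_le (opnormM_le Gt1 e4) Gt1.
  have t4 := opnormM_le (opnormM_le Gtk Ya1) Gt1.
  have t5 := opnormM_le (opnormM_le G1 B1) e2.
  have t6 := opnormM_le (opnormM_le e2 Ba1) G1.
  have := opnormD_le (opnormD_le t1 (opnormD_le (opnormD_le t2 t3) t4)) (opnormD_le t5 t6).
  rewrite -id => t; apply: le_trans t _; lra.
rewrite -[3 / 10]subr0; apply: (@le_trans _ _ (opn (phi * (p * k) - (p * k) * phi2))).
  apply: sylvester => v; first by rewrite mul0r mulmx_app; exact: neg.
  set w := adj (p * k) *m v.
  have raised_ge (x : R) : 3 / 10 <= raised x by rewrite /raised le_max lexx orbT.
  have a1 := fc_ge Y (Gt *m w) raised_ge; have a2 := fc_ge B (G *m w) raised_ge.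
  rewrite /phi2 mulmxDl ripDr !mulmx_app [rip w (Gt *m _)]rip_adj [rip w (G *m _)]rip_adj hG hGt.
  have := cover w; rewrite -/Ya -/Ba in a1 a2 *; lra.
have -> : phi * (p * k) - p * k * phi2 = p * (phi * k - k * phi2).
  by rewrite mulrBr !mulrA php.
by rewrite -[6 * e]mul1r; exact: opnormM_le.
Qed.

End LocalModel.

(** * Correcting the ends of an approximate spectral cut *)

Section Ends.
Context {R : realType}.
Local Notation C := R[i].

Definition lower_ramp (x : R) : R := 1 - ramp (9 / 10) (19 / 20) x.

Lemma lower_ramp_lt : 9 / 10 < 19 / 20 :> R.
Proof. lra. Qed.

Lemma lower_ramp_norm (x : R) : `|lower_ramp x| <= 1.
Proof. exact: ramp_compl_norm. Qed.

Lemma lower_ramp1 (x : R) : x <= 9 / 10 -> lower_ramp x = 1.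
Proof. by move=> x9; rewrite /lower_ramp (ramp0 lower_ramp_lt x9) subr0. Qed.

Lemma lower_ramp0 (x : R) : 19 / 20 <= x -> lower_ramp x = 0.
Proof. by move=> x9; rewrite /lower_ramp (ramp1 lower_ramp_lt x9) subrr. Qed.

Lemma near_idempotent (x : R) : `|x * x - x| <= 4 / 25 -> x <= 1 / 4 \/ 3 / 4 <= x.
Proof.
rewrite ler_norml => /andP[h _]; have [x4|x4] := leP x (1 / 4); [by left|right].
rewrite leNgt; apply/negP => x34.
have : 0 <= (x - 1 / 4) * (3 / 4 - x) by rewrite mulr_ge0 // subr_ge0 ltW.
lra.
Qed.

Lemma compress_comm n (T A P Q : 'M[C]_n) : P * T = T * P -> Q * T = T * Q ->
  T * (Q * A * P) - (Q * A * P) * T = Q * (T * A - A * T) * P.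
Proof. by move=> PT QT; rewrite mulrBr mulrBl !mulrA QT -!mulrA PT. Qed.

Lemma comm_mulB n (X Y A : 'M[C]_n) :
  X * Y * A - A * (X * Y) = X * (Y * A - A * Y) + (X * A - A * X) * Y.
Proof. rewrite !(mulrDl, mulrDr, mulrN, mulNr, mulrA); mx_linear. Qed.

Lemma projC n (p : 'M[C]_n) : herm p -> p * p = p ->
  herm (1 - p) /\ (1 - p) * (1 - p) = 1 - p.
Proof.
move=> hp pp; split; first exact: hermB (herm1 _) hp.
by rewrite mulrBl mul1r mulrBr mulr1 pp subrr subr0.
Qed.

Lemma proj_norm n (p : 'M[C]_n) : herm p -> p * p = p -> opn p <= 1.
Proof.
move=> hp pp; have bE : blocks (fun b : bool => if b then p else 1 - p).
  split=> [[]|[] []|] //=.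
  - by case: (projC hp pp).
  - by rewrite mulrBr mulr1 pp subrr.
  - by rewrite mulrBl mul1r pp subrr.
  - by case: (projC hp pp).
  - by rewrite big_bool /= addrC subrK.
exact: block_norm bE true.
Qed.

(** An approximate spectral cut [p] of [B] can be made exact at both ends: force
it to be [1] where [B] is close to [-1] and [0] where [B] is close to [1] by
smooth cutoffs, and round the result, whose spectrum stays near [0] and [1],
back to a projection. *)
Lemma exact_ends n (A B p : 'M[C]_n) (c : R) : herm A -> herm B -> herm p -> p * p = p ->
  opn (p * fc upper B) <= 1 / 80 -> opn ((1 - p) * fc upper (- B)) <= 1 / 80 ->
  opn (fc lower_ramp B * A - A * fc lower_ramp B) <= 1 / 10 ->
  opn (fc lower_ramp (- B) * A - A * fc lower_ramp (- B)) <= 1 / 10 ->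
  opn (p * A - A * p) <= c ->
  exists P : 'M[C]_n, [/\ herm P, P * P = P,
    forall M, M * B = B * M -> M * p = p * M -> M * P = P * M,
    (forall s : R -> R, (forall x, s x != 0 -> 19 / 20 <= x) -> P * fc s B = 0) /\
    (forall s : R -> R, (forall x, s x != 0 -> x <= - (19 / 20)) -> P * fc s B = fc s B)
    & opn ((1 - P) * A * P) <= 2 * (c + 1)].
Proof.
move=> hA hB hp pp pu pl cu cl pA.
pose mu x : R := lower_ramp x; pose ml x : R := lower_ramp (- x).
pose Ml := fc ml B; pose M0 := fc (fun x => ml x * mu x) B.
have MlE : fc lower_ramp (- B) = Ml by exact: fc_opp.
have M0E : M0 = Ml * fc lower_ramp B by rewrite /Ml fcM.
have ml1 x : `|ml x| <= 1 by exact: lower_ramp_norm.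
have mu1 x : `|mu x| <= 1 by exact: lower_ramp_norm.
have Ml1 : opn Ml <= 1 by exact: fc_norm1.
have Mu1 : opn (fc lower_ramp B) <= 1 by exact: fc_norm1.
have M01 : opn M0 <= 1 by rewrite M0E -[leRHS]mulr1; exact: opnormM_le.
have hMl : herm Ml by exact: fc_herm.
have hM0 : herm M0 by exact: fc_herm.
pose T := 1 - Ml * Ml + M0 * p * M0.
have hT : herm T.
  apply: hermD; first by apply: hermB (herm1 _) _; rewrite /herm adjM hMl.
  by have := herm_conj M0 hp; rewrite hM0.
have p1 := proj_norm hp pp.
pose lp x : R := if 0 <= x then 1 - ml x * mu x else 0.
pose lm x : R := if 0 <= x then 0 else 1 - ml x * mu x.
pose Lp := fc lp B; pose Lm := fc lm B.
have mlE x : 0 <= x -> ml x = 1 by move=> x0; apply: lower_ramp1; move: x0; clear; lra.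
have muE x : x <= 0 -> mu x = 1 by move=> x0; apply: lower_ramp1; move: x0; clear; lra.
have Lsum : Lp + Lm = 1 - M0.
  rewrite -(fc1 B) fcB fcD; apply: fc_ext => x; rewrite /lp /lm.
  by case: (0 <= x); rewrite ?addr0 ?add0r.
have Esum : 1 - Ml * Ml = Lm + M0 * Lm.
  rewrite /Ml /M0 /Lm -(fc1 B) !fcM fcB fcD; apply: fc_ext => x; rewrite /lm.
  have [x0|/ltW x0] := leP 0 x; first by rewrite mlE // mulr0 addr0 mul1r subrr.
  by rewrite muE //; ring.
have n01 (x : R) : `|ml x * mu x| <= 1 by rewrite normrM -[leRHS]mulr1 ler_pM.
have nonneg (x : R) : 0 <= ml x * mu x.
  by rewrite mulr_ge0 // subr_ge0 ramp_le1.
have comp1 (x : R) : `|1 - ml x * mu x| <= 1.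
  have := nonneg x; have := n01 x; move: (ml x * mu x); clear => y.
  by rewrite !ler_norml => /andP[_ ?] ?; apply/andP; split; lra.
have Lp1 : opn Lp <= 1.
  by apply: fc_norm1 => x; rewrite /lp; case: ifP; rewrite ?normr0.
have Lm1 : opn Lm <= 1.
  by apply: fc_norm1 => x; rewrite /lm; case: ifP; rewrite ?normr0.
have up9 (x : R) : 9 / 10 <= x -> upper x = 1 by move=> ?; exact: ramp1 upper_lt _.
have LpE : Lp = fc upper B * Lp.
  rewrite fcM; apply: fc_ext => x; rewrite /lp; case: ifP => x0; last by rewrite mulr0.
  have [x9|/ltW x9] := leP (9 / 10) x; first by rewrite up9 ?mul1r.
  by rewrite mlE // /mu lower_ramp1 // mulr1 subrr mulr0.
have LmE : Lm = fc upper (- B) * Lm.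
  rewrite fc_opp // fcM; apply: fc_ext => x; rewrite /lm; case: leP => x0; first by rewrite mulr0.
  have [x9|/ltW x9] := leP (9 / 10) (- x); first by rewrite up9 ?mul1r.
  by rewrite muE ?(ltW x0) // /ml lower_ramp1 // mulr1 subrr mulr0.
have pLp : opn (p * Lp) <= 1 / 80.
  by rewrite LpE mulrA -[leRHS]mulr1; exact: opnormM_le.
have pLm : opn ((1 - p) * Lm) <= 1 / 80.
  by rewrite LmE mulrA -[leRHS]mulr1; exact: opnormM_le.
have Lpp : opn (Lp * p) <= 1 / 80 by rewrite -opnorm_adj adjM hp fc_herm.
have Lmp : opn (Lm * (1 - p)) <= 1 / 80.
  by rewrite -opnorm_adj adjM fc_herm; have [-> _] := projC hp pp.
(* each term of T - p has a factor p next to Lp or 1 - p next to Lm, and these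
   products are small: p almost misses the upper end of B, 1 - p the lower end *)
pose De := T - p.
have DeE : De = - (Lp * p - Lm * (1 - p) + (M0 * (p * Lp) - M0 * ((1 - p) * Lm))).
  rewrite /De /T Esum; have -> : M0 * p * M0 = M0 * p * (1 - (Lp + Lm)) by rewrite Lsum opprB addrC subrK.
  have e1 : M0 * p = p - (Lp + Lm) * p by rewrite Lsum mulrBl mul1r opprB addrC subrK.
  rewrite mulrBr mulr1 {1}e1 !(mulrDl, mulrDr, mulrN, mulNr, mulr1, mul1r, mulrA).
  mx_linear.
have Den : opn De <= 1 / 20.
  rewrite DeE opnormN.
  have t3 := opnormM_le M01 pLp; have t4 := opnormM_le M01 pLm.
  apply: le_trans (opnormD_le (opnormB_le Lpp Lmp) (opnormB_le t3 t4)) _; clear; lra.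
have T2 : opn (T * T - T) <= 4 / 25.
  have -> : T * T - T = p * De + De * p + De * De - De.
    have -> : T = p + De by rewrite /De addrC subrK.
    rewrite !(mulrDl, mulrDr) pp; mx_linear.
  have t1 := opnormM_le p1 Den; have t2 := opnormM_le Den p1.
  apply: le_trans (opnormB_le (opnormD_le (opnormD_le t1 t2) (opnormM_le Den Den)) Den) _; clear; lra.
have evT j : ev T j <= 1 / 4 \/ 3 / 4 <= ev T j.
  have [v v1 Tv] := ev_vector j hT.
  have n1 : l2norm v = 1.
    by apply/eqP; rewrite -(eqrXn2 (n := 2)) ?l2norm_ge0 // expr1n l2norm_sqr v1.
  have TTv : (T * T - T) *m v = (ev T j * ev T j - ev T j)%:C%C *: v.
    by rewrite mulmxBl mulmx_app Tv -scalemxAr Tv scalerA -scalerBl rmorphB rmorphM.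
  have := l2norm_mulmx (T * T - T) v; rewrite TTv l2normZ n1 !mulr1 => h.
  exact: near_idempotent (le_trans h T2).
pose s (x : R) : R := (1 / 2 < x)%R%:R.
have ss x : s x * s x = s x by rewrite /s; case: (1 / 2 < x); rewrite ?mulr1 ?mulr0.
have s1 x : 1 / 2 < x -> s x = 1 by rewrite /s => ->.
have s0 x : x <= 1 / 2 -> s x = 0 by rewrite /s ltNge => ->.
pose P := fc s T.
have PP : P * P = P by rewrite fcM; apply: fc_ext => x.
exists P; split => //.
- exact: fc_herm.
- move=> M MB Mp; have MMl : M * Ml = Ml * M by apply/esym; apply: fc_comm.
  have MM0 : M * M0 = M0 * M by apply/esym; apply: fc_comm.
  apply/esym; apply: fc_comm => //; apply/esym.
  apply: commrD; first by apply: commrB; [exact: commr1|exact: commrM].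
  by apply: commrM => //; exact: commrM.
- split=> u us.
    have TQ : T * fc u B = (0 : R)%:C%C *: fc u B.
      have z1 : M0 * fc u B = 0.
        rewrite /M0 fcM -(fc0 B); apply: fc_ext => x.
        have [->|/us x9] := eqVneq (u x) 0; first by rewrite mulr0.
        by rewrite /mu lower_ramp0 // mulr0 mul0r.
      have z2 : Ml * fc u B = fc u B.
        rewrite /Ml fcM; apply: fc_ext => x.
        have [->|/us x9] := eqVneq (u x) 0; first by rewrite mulr0.
        by rewrite mlE ?mul1r //; move: x9; clear; lra.
      by rewrite /T mulrDl mulrBl mul1r -!mulrA z1 z2 z2 subrr !mulr0 addr0 scale0r.
    by rewrite (fc_eigen s hT TQ) /s ltNge divr_ge0 //= scale0r.
  have TQ : T * fc u B = (1 : R)%:C%C *: fc u B.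
    have z1 : Ml * fc u B = 0.
      rewrite /Ml fcM -(fc0 B); apply: fc_ext => x.
      have [->|/us x9] := eqVneq (u x) 0; first by rewrite mulr0.
      by rewrite /ml lower_ramp0 ?mul0r //; move: x9; clear; lra.
    have z2 : M0 * fc u B = 0.
      rewrite /M0 fcM -(fc0 B); apply: fc_ext => x.
      have [->|/us x9] := eqVneq (u x) 0; first by rewrite mulr0.
      by rewrite /ml lower_ramp0 ?mul0r //; move: x9; clear; lra.
    by rewrite /T mulrDl mulrBl mul1r -!mulrA z1 z2 !mulr0 subr0 addr0 scale1r.
  rewrite (fc_eigen s hT TQ) /s; have -> : (1 / 2 < 1 :> R) by clear; lra.
  by rewrite scale1r.
- have [hP' PP'] := projC (fc_herm T s) PP.
  have P'E : 1 - P = fc (fun x => 1 - s x) T by rewrite -(fc1 T) fcB.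
  have P'1 := proj_norm hP' PP'.
  have P1 : opn P <= 1 by apply: proj_norm => //; exact: fc_herm.
  set X := (1 - P) * A * P.
  have e1 : T * X - X * T = (1 - P) * (T * A - A * T) * P.
    have cP : P * T = T * P by exact: fcX.
    have cP' : (1 - P) * T = T * (1 - P) by rewrite mulrBl mulrBr mul1r mulr1 cP.
    exact: compress_comm.
  have TA : opn (T * A - A * T) <= c + 1.
    have cl' : opn (Ml * A - A * Ml) <= 1 / 10 by rewrite -MlE.
    have c0 : opn (M0 * A - A * M0) <= 1 / 5.
      rewrite M0E comm_mulB.
      by apply: le_trans (opnormD_le (opnormM_le Ml1 cu) (opnormM_le cl' Mu1)) _; clear; lra.
    have -> : T * A - A * T = (M0 * p * M0 * A - A * (M0 * p * M0)) - (Ml * Ml * A - A * (Ml * Ml)).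
      rewrite /T !(mulrDl, mulrDr, mulrN, mulNr, mulr1, mul1r, mulrA); mx_linear.
    have M0p1 : opn (M0 * p) <= 1 by rewrite -[leRHS]mulr1; exact: opnormM_le.
    have c1 : opn (M0 * p * A - A * (M0 * p)) <= c + 1 / 5.
      rewrite comm_mulB.
      by apply: le_trans (opnormD_le (opnormM_le M01 pA) (opnormM_le c0 p1)) _; clear; lra.
    have c2 : opn (M0 * p * M0 * A - A * (M0 * p * M0)) <= c + 2 / 5.
      rewrite comm_mulB.
      by apply: le_trans (opnormD_le (opnormM_le M0p1 c0) (opnormM_le c1 M01)) _; clear; lra.
    have c3 : opn (Ml * Ml * A - A * (Ml * Ml)) <= 1 / 5.
      rewrite comm_mulB.
      by apply: le_trans (opnormD_le (opnormM_le Ml1 cl') (opnormM_le cl' Ml1)) _; clear; lra.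
    by apply: le_trans (opnormB_le c2 c3) _; clear; lra.
  have syl : (3 / 4 - 1 / 4) * opn X <= opn (T * X - X * T).
    apply: sylvester => v.
      rewrite /X !mulmx_app P'E fc_form_conj // fc_form_sqr; apply: fc_form_le_ev => j.
      case: (evT j) => h; last by rewrite s1 ?subrr ?mul0r //; move: h; clear; lra.
      by rewrite s0 ?subr0 ?mulr1 ?mul1r //; move: h; clear; lra.
    rewrite /X !adjM fc_herm !mulmx_app fc_form_conj // fc_form_sqr; apply: fc_form_le_ev => j.
    case: (evT j) => h; first by rewrite s0 ?mul0r //; move: h; clear; lra.
    by rewrite s1 ?mulr1 ?mul1r //; move: h; clear; lra.
  have t : opn ((1 - P) * (T * A - A * T) * P) <= 1 * (c + 1) * 1.
    by apply: opnormM_le => //; exact: opnormM_le.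
  rewrite e1 in syl; have := le_trans syl t; clear; lra.
Qed.

End Ends.

(** * Rounding to the nearest integer *)

Section Rounding.
Context {R : realType}.
Local Notation C := R[i].

(** The nearest integer. *)
Definition rd (x : R) : R := (Num.floor (x + 1 / 2))%:~R.
Definition dev (x : R) : R := x - rd x.
(** With [y] the signed distance to the nearest integer, [outer] vanishes near the
integers and [inner] near the half-integers; one of them is 1 at each point. *)
Definition outer (y : R) : R := ramp (2 / 10) (3 / 10) `|y|.
Definition inner (y : R) : R := 1 - ramp (3 / 10) (4 / 10) `|y|.
(** Keeps the part of [u] on the positive side. *)
Definition right (u : R -> R) (y : R) : R := if 0 < y then u y else 0.

Lemma dev_bound x : - (1 / 2) <= dev x <= 1 / 2.
Proof.
rewrite /dev /rd; have /andP[h1 h2] := floor_itv (x + 1 / 2).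
rewrite intrD in h2; move: h1 h2; move: (_%:~R) => m; rewrite mulr1z.
by clear => ? ?; apply/andP; split; lra.
Qed.

Lemma dev_norm x : `|dev x| <= 1 / 2.
Proof. by rewrite ler_norml; exact: dev_bound. Qed.

Lemma dev_nearest x (m : int) : `|dev x| <= `|x - m%:~R|.
Proof.
have /andP[d1 d2] := dev_bound x.
have [k kE] : exists k : int, rd x = k%:~R by eexists.
have -> : x - m%:~R = dev x + (k - m)%:~R by rewrite /dev kE intrB; ring.
move: (dev x) d1 d2 => d d1 d2.
case: (ltrgtP (k - m) 0) => [h|h|->]; last by rewrite addr0.
- have : (k - m)%:~R <= -1 :> R.
    by move: h; rewrite -oppr_gt0 gtz0_ge1 -(ler_int R) mulrNz lerNr.
  move: ((k - m)%:~R) => q q1; rewrite [leRHS]ler0_norm; last by lra.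
  by rewrite ler_norml; apply/andP; split; lra.
- have : 1 <= (k - m)%:~R :> R by move: h; rewrite gtz0_ge1 -(ler_int R).
  move: ((k - m)%:~R) => q q1; rewrite [leRHS]ger0_norm; last by lra.
  by rewrite ler_norml; apply/andP; split; lra.
Qed.

Lemma dev_lipschitz x y : `| `|dev x| - `|dev y| | <= `|x - y|.
Proof.
have h u v : `|dev u| <= `|dev v| + `|u - v|.
  have [k kE] : exists k : int, rd v = k%:~R by eexists.
  apply: le_trans (dev_nearest u k) _; rewrite [leRHS]addrC -kE.
  by apply: le_trans (ler_normD _ _); rewrite /dev addrA subrK.
have h1 := h x y; have h2 := h y x; rewrite [`|y - x|]distrC in h2.
by rewrite ler_norml; move: h1 h2; clear => ? ?; apply/andP; split; lra.
Qed.

Lemma floor_of_dev x (k : int) : Num.floor (x + 1 / 2) = k ->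
  (0 < dev x -> Num.floor x = k) /\ (dev x < 0 -> Num.floor x = k - 1).
Proof.
move=> kE; have /andP[] := dev_bound x; rewrite /dev /rd kE => d1 d2; split=> d0.
  apply: floor_def; rewrite intrD mulr1z; move: d1 d2 d0; move: (k%:~R) => q; clear => *.
  by apply/andP; split; lra.
by apply: floor_def; rewrite subrK intrB mulr1z; move: d1 d2 d0; move: (k%:~R) => q; clear => *;
   apply/andP; split; lra.
Qed.

Lemma outer_lt : 2 / 10 < 3 / 10 :> R. Proof. lra. Qed.
Lemma inner_lt : 3 / 10 < 4 / 10 :> R. Proof. lra. Qed.

Lemma outer_norm y : `|outer y| <= 1. Proof. exact: ramp_norm. Qed.
Lemma inner_norm y : `|inner y| <= 1. Proof. exact: ramp_compl_norm. Qed.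
Lemma right_norm u y : `|u y| <= 1 -> `|right u y| <= 1.
Proof. by rewrite /right; case: ifP => //; rewrite normr0. Qed.

Lemma outer_neq0 y : outer y != 0 -> 2 / 10 <= `|y|.
Proof. by apply: contra_neqP => /negP; rewrite -ltNge => /ltW; exact: ramp0 outer_lt. Qed.

Lemma inner_neq0 y : inner y != 0 -> `|y| <= 4 / 10.
Proof.
apply: contra_neqP => /negP; rewrite -ltNge => /ltW h.
by rewrite /inner (ramp1 inner_lt h) subrr.
Qed.

Lemma inner_compl_neq0 y : 1 - inner y != 0 -> 3 / 10 <= `|y|.
Proof.
apply: contra_neqP => /negP; rewrite -ltNge => /ltW h.
by rewrite /inner (ramp0 inner_lt h) subr0 subrr.
Qed.

Lemma outer_inner_cover y : 1 <= outer y * outer y + inner y * inner y.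
Proof.
have [y3|/ltW y3] := leP (3 / 10) `|y|.
  by rewrite /outer (ramp1 outer_lt y3) mulr1 lerDl -expr2 sqr_ge0.
by rewrite /inner (ramp0 inner_lt y3) subr0 mulr1 lerDr -expr2 sqr_ge0.
Qed.

Lemma right_split u y : u 0 = 0 -> u (- y) = u y -> u y = right u y + right u (- y).
Proof.
move=> u0 uN; rewrite /right oppr_gt0; case: (ltgtP y 0) => [y0|y0|->].
- by rewrite add0r uN.
- by rewrite addr0.
- by rewrite u0 addr0.
Qed.

Lemma ucont_abs f : ucont f -> ucont (fun y : R => f `|y|).
Proof.
move=> uf e e0; have [w w0 h] := uf e e0; exists w => // x y xy; apply: h.
exact: le_trans (ler_dist_dist x y) xy.
Qed.

Lemma ucont_inner : ucont inner.
Proof. exact: (ucont_abs (ucont_ramp_compl inner_lt)). Qed.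

Lemma inner_osc x y : `|inner x - inner y| <= 1.
Proof. exact: ramp_compl_osc. Qed.

Lemma outer_dev_osc x y : `|outer (dev x) - outer (dev y)| <= 1.
Proof. exact: ramp_osc. Qed.

Lemma outer_dev_lipschitz x y : `|outer (dev x) - outer (dev y)| <= 10 * `|x - y|.
Proof.
apply: le_trans (ramp_lipschitz _ _ outer_lt) _.
have -> : (3 / 10 - 2 / 10)^-1 = 10 :> R by field.
by rewrite ler_pM2l // dev_lipschitz.
Qed.

End Rounding.

(** * Gluing across the jumps *)

Section Gluing.
Context {R : realType}.
Local Notation C := R[i].

(** The label that [rd x], corrected by the jump of [P] at each integer, represents
away from the integers. *)
Definition floor_succ (x : R) : R := (Num.floor x)%:~R + 1.

Lemma label_right x : right outer (dev x) != 0 -> floor_succ x = rd x + 1.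
Proof.
rewrite /right; case: ltP => [d0 _|_]; last by rewrite eqxx.
have [h _] := @floor_of_dev R x _ erefl.
by rewrite /floor_succ h.
Qed.

Lemma label_left x : right outer (- dev x) != 0 -> floor_succ x = rd x.
Proof.
rewrite /right oppr_gt0; case: ltP => [d0 _|_]; last by rewrite eqxx.
have [_ h] := @floor_of_dev R x _ erefl.
by rewrite /floor_succ h // intrB subrK.
Qed.

Lemma swap_diff n (H H0 W W0 : 'M[C]_n) :
  H * W * adj H - H0 * W0 * adj H0 =
  (H - H0) * W * adj H + H0 * W * adj (H - H0) + H0 * (W - W0) * adj H0.
Proof. rewrite adjB !(mulrDl, mulrDr, mulrN, mulNr, mulrA); mx_linear. Qed.

(** Near the integers [phi] is read off [Y], away from them off [Bf], the block
diagonal part of [B] between consecutive integers. The label [rd A + P] increases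
by one at each integer, where [P] switches on; halfway between two integers the
increase of [rd A] is compensated by [P] switching off, so that away from the
integers the label is [floor_succ A], which commutes with [Bf]. Replacing the
cutoffs [inner] and [outer] by [HH] and [GH], in which [P] is inserted, makes
this an exact identity: [HH] commutes with the label and [GH] intertwines it with
[floor_succ A]. *)
Lemma glued_cut n (A B Bf P Y : 'M[C]_n) (mu s : R) :
  herm A -> herm P -> P * P = P -> herm Y -> opn Y <= 1 -> herm Bf -> opn Bf <= 1 ->
  P * Y = Y * P -> fc rd A * P = P * fc rd A -> fc rd A * Y = Y * fc rd A ->
  fc floor_succ A * Bf = Bf * fc floor_succ A -> 0 <= mu -> 0 <= s ->
  (forall u : R -> R, (forall x, `|u x| <= 1) -> (forall x, u x != 0 -> 1 / 5 <= x) ->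
     opn ((1 - P) * fc u (fc dev A)) <= mu /\ opn (P * fc u (- fc dev A)) <= mu) ->
  opn ((B - Bf) * fc (fun x => outer (dev x)) A) <= s ->
  exists phi : 'M[C]_n, [/\ herm phi, phi * (fc rd A + P) = (fc rd A + P) * phi,
    forall M, M * A = A * M -> M * Bf = Bf * M -> M * P = P * M -> M * Y = Y * M ->
      M * phi = phi * M &
    opn (phi - (fc inner (fc dev A) * Y * fc inner (fc dev A) +
                fc outer (fc dev A) * B * fc outer (fc dev A))) <= 30 * mu + s].
Proof.
move=> hA hP PP hY Y1 hBf Bf1 PY A0P A0Y FBf mu0 s0 hmu hs.
set A0 := fc rd A in A0P A0Y *; set D := fc dev A in hmu *.
have hD : herm D by exact: fc_herm.
have [P' P'E] : exists P', P' = 1 - P by eexists.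
have [hP' PP'] : herm P' /\ P' * P' = P' by rewrite P'E; exact: projC.
have P1 : opn P <= 1 by exact: proj_norm.
have P'1 : opn P' <= 1 by exact: proj_norm.
set Gt := fc inner D; set G := fc outer D.
pose L := fc (fun y => 1 - inner y) D.
pose Lp := fc (right (fun y => 1 - inner y)) D.
pose Lm := fc (right (fun y => 1 - inner y)) (- D).
pose Gp := fc (right outer) D; pose Gm := fc (right outer) (- D).
have right5 (u : R -> R) (a : R) y : 1 / 5 <= a -> (forall y, u y != 0 -> a <= `|y|) ->
    right u y != 0 -> 1 / 5 <= y.
  rewrite /right => a5 ua; case: ifP => [y0|_]; last by rewrite eqxx.
  by move/ua; rewrite gtr0_norm //; exact: le_trans.
have rG (y : R) : right outer y != 0 -> 1 / 5 <= y.
  by apply: (right5 _ (2 / 10)); [clear; lra|exact: outer_neq0].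
have rL (y : R) : right (fun y => 1 - inner y) y != 0 -> 1 / 5 <= y.
  by apply: (right5 _ (3 / 10)); [clear; lra|exact: inner_compl_neq0].
have oN (y : R) : `|right outer y| <= 1 by apply: right_norm; exact: outer_norm.
have lN (y : R) : `|right (fun y => 1 - inner y) y| <= 1.
  by apply: right_norm; rewrite /inner subKr ramp_norm.
have [P'Gp PGm] := hmu _ oN rG; have [P'Lp PLm] := hmu _ lN rL.
rewrite -/Gp -/Gm -/Lp -/Lm -P'E in P'Gp PGm P'Lp PLm.
have GE : G = Gp + Gm.
  rewrite /G /Gp /Gm fc_opp // fcD; apply: fc_ext => y.
  apply: right_split; last by rewrite /outer normrN.
  by rewrite /outer normr0 (ramp0 outer_lt) //; clear; lra.
have LE : L = Lp + Lm.
  rewrite /L /Lp /Lm fc_opp // fcD; apply: fc_ext => y.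
  apply: (right_split (u := fun y => 1 - inner y)); last by rewrite /inner normrN.
  by rewrite /inner normr0 (ramp0 inner_lt) ?subr0 ?subrr //; clear; lra.
have GtE : Gt = 1 - L by rewrite /Gt /L -(fc1 D) fcB; apply: fc_ext => y; rewrite subKr.
pose GH := P * Gp + P' * Gm.
pose HH := P * Gt * P + P' * Gt * P'.
have hHH : herm HH.
  apply: hermD; first by have := herm_conj P (fc_herm D inner); rewrite hP.
  by have := herm_conj P' (fc_herm D inner); rewrite hP'.
have hGt : herm Gt by exact: fc_herm.
have hG : herm G by exact: fc_herm.
have sP : P + P' = 1 by rewrite P'E addrC subrK.
have PP'0 : P * P' = 0 by rewrite P'E mulrBr mulr1 PP subrr.
have P'P0 : P' * P = 0 by rewrite P'E mulrBl mul1r PP subrr.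
have dGH : GH - G = - (P' * Gp + P * Gm).
  by rewrite GE /GH P'E !mulrBl !mul1r; mx_linear.
have dHH : HH - Gt = P * L * P' + P' * L * P.
  have -> : HH = P + P' - (P * L * P + P' * L * P').
    by rewrite /HH GtE !mulrBr !mulrBl !mulr1 PP PP'; mx_linear.
  have {1}-> : Gt = P + P' - (P + P') * L * (P + P') by rewrite sP mul1r mulr1.
  by rewrite !mulrDl !mulrDr; mx_linear.
have GHn : opn (GH - G) <= 2 * mu.
  by rewrite dGH opnormN; apply: le_trans (opnormD_le P'Gp PGm) _; clear; lra.
have LpP' : opn (Lp * P') <= mu by rewrite -opnorm_adj adjM hP' fc_herm.
have LmP : opn (Lm * P) <= mu by rewrite -opnorm_adj adjM hP fc_herm.
have HHn : opn (HH - Gt) <= 4 * mu.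
  have -> : HH - Gt = (P * (Lp * P') + P * Lm * P') + (P' * Lp * P + P' * (Lm * P)).
    by rewrite dHH LE !(mulrDl, mulrDr, mulrA).
  have t1 := opnormM_le P1 LpP'; have t2 := opnormM_le PLm P'1.
  have t3 := opnormM_le P'Lp P1; have t4 := opnormM_le P'1 LmP.
  by apply: le_trans (opnormD_le (opnormD_le t1 t2) (opnormD_le t3 t4)) _; clear; lra.
have Gt1 : opn Gt <= 1 by apply: fc_norm1; exact: inner_norm.
have G1 : opn G <= 1 by apply: fc_norm1; exact: outer_norm.
have Gp1 : opn Gp <= 1 by exact: fc_norm1.
have Gm1 : opn Gm <= 1 by exact: fc_norm1.
have GH2 : opn (adj GH) <= 2.
  rewrite opnorm_adj; apply: le_trans (opnormD_le (opnormM_le P1 Gp1) (opnormM_le P'1 Gm1)) _.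
  by clear; lra.
have HH2 : opn (adj HH) <= 2.
  rewrite hHH; have t1 := opnormM_le (opnormM_le P1 Gt1) P1.
  have t2 := opnormM_le (opnormM_le P'1 Gt1) P'1.
  by apply: le_trans (opnormD_le t1 t2) _; clear; lra.
have A0P' : A0 * P' = P' * A0 by rewrite P'E mulrBr mulrBl mulr1 mul1r A0P.
have A0Gt : A0 * Gt = Gt * A0.
  by rewrite /A0 /Gt /D fc_comp !fcM; apply: fc_ext => x; rewrite mulrC.
pose K := A0 + P.
have KHH : K * HH = HH * K.
  have c1 : A0 * HH = HH * A0.
    apply: commrD; apply: commrM => //; exact: commrM.
  have c2 : P * HH = HH * P.
    by rewrite /HH mulrDr mulrDl !mulrA PP PP'0 !mul0r -!mulrA PP P'P0 !mulr0 !addr0.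
  by apply/esym; apply: commrD; exact: esym.
have KY : K * Y = Y * K by rewrite /K mulrDl mulrDr A0Y PY.
have KGH : K * GH = GH * fc floor_succ A.
  have e1 : A0 * Gp + Gp = Gp * fc floor_succ A.
    rewrite /Gp /D /A0 fc_comp !fcM fcD; apply: fc_ext => x.
    have [->|/label_right ->] := eqVneq (right outer (dev x)) 0; first by rewrite mulr0 mul0r addr0.
    by rewrite mulrDr mulr1 mulrC.
  have e2 : A0 * Gm = Gm * fc floor_succ A.
    rewrite /Gm fc_opp // /D /A0 fc_comp !fcM; apply: fc_ext => x.
    have [->|/label_left ->] := eqVneq (right outer (- dev x)) 0; first by rewrite mulr0 mul0r.
    by rewrite mulrC.
  rewrite /K /GH mulrDl !mulrDr !mulrA A0P A0P' PP PP'0 mul0r addr0 mulrDl.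
  by rewrite -!mulrA -e1 -e2 mulrDr -addrA [P' * _ + _]addrC addrA.
have hK : herm K by apply: hermD => //; exact: fc_herm.
have GHK : adj GH * K = fc floor_succ A * adj GH.
  by have := congr1 (@adj R n n) KGH; rewrite !adjM hK fc_herm.
exists (HH * Y * adj HH + GH * Bf * adj GH); split.
- by apply: hermD; exact: herm_conj.
- rewrite -/K; apply/esym; apply: commrD.
    by apply: commrM; [exact: commrM|rewrite hHH].
  rewrite /GRing.comm !mulrA KGH -(mulrA GH _ Bf) FBf mulrA.
  by rewrite -(mulrA _ (adj GH)) GHK !mulrA.
- move=> M MA MB MP MY.
  have MD f : M * fc f D = fc f D * M.
    by rewrite /D fc_comp; apply/esym; apply: fc_comm.
  have MDN f : M * fc f (- D) = fc f (- D) * M by rewrite fc_opp.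
  have MP' : M * P' = P' * M by rewrite P'E mulrBr mulrBl mulr1 mul1r MP.
  have MGt : M * Gt = Gt * M := MD _.
  have MGp : M * Gp = Gp * M := MD _.
  have MGm : M * Gm = Gm * M := MDN _.
  have MHH : M * HH = HH * M by apply: commrD; apply: commrM => //; exact: commrM.
  have MGH : M * GH = GH * M by apply: commrD; exact: commrM.
  have MaGH : M * adj GH = adj GH * M.
    by rewrite /GH adjD !adjM hP hP' !fc_herm; apply: commrD; exact: commrM.
  by apply: commrD; apply: commrM => //; [exact: commrM|rewrite hHH|exact: commrM].
- rewrite -[in X in opn (_ - X)]hGt -[in X in opn (_ - X)]hG.
  have -> : HH * Y * adj HH + GH * Bf * adj GH - (adj Gt * Y * adj Gt + adj G * B * adj G) =
    (HH * Y * adj HH - Gt * Y * adj Gt) + (GH * Bf * adj GH - G * B * adj G).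
    by rewrite hGt hG opprD addrACA.
  rewrite !swap_diff subrr mulr0 mul0r addr0.
  have aHHn : opn (adj (HH - Gt)) <= 4 * mu by rewrite opnorm_adj.
  have aGHn : opn (adj (GH - G)) <= 2 * mu by rewrite opnorm_adj.
  have t1 := opnormM_le (opnormM_le HHn Y1) HH2.
  have t2 := opnormM_le (opnormM_le Gt1 Y1) aHHn.
  have t3 := opnormM_le (opnormM_le GHn Bf1) GH2.
  have t4 := opnormM_le (opnormM_le G1 Bf1) aGHn.
  have t5 : opn (G * (Bf - B) * adj G) <= 1 * s.
    rewrite -mulrA; apply: opnormM_le => //; rewrite hG -opnormN -mulNr opprB.
    by rewrite /G /D fc_comp.
  apply: le_trans (opnormD_le (opnormD_le t1 t2) (opnormD_le (opnormD_le t3 t4) t5)) _.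
  by move: mu0; clear; lra.
Qed.

End Gluing.

(** * Approximate cuts *)

Section ApproximateCut.
Context {R : realType}.
Local Notation C := R[i].

Lemma cell_floor (m : nat) (c x : R) : cell (m%:R + c) 1 x = Num.floor (x + c) + m%:Z.
Proof.
rewrite /cell divr1; apply: floor_def; have /andP[h1 h2] := floor_itv (x + c).
move: h1 h2; rewrite !intrD mulr1z -pmulrn; move: ((Num.floor _)%:~R) => q.
by clear => *; apply/andP; split; lra.
Qed.

(** A function that is constant on the cells commutes with every block diagonal
part. *)
Lemma label_cells n (A B : 'M[C]_n) (f : R -> R) r M (c : nat -> R) :
  herm A -> (forall x (k : nat), cell r 1 x = k%:Z -> f x = c k) ->
  fc f A * pinch (fun k : 'I_M => cellmx r 1 A k) B =
  pinch (fun k : 'I_M => cellmx r 1 A k) B * fc f A.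
Proof.
move=> hA fc_c; have e (k : 'I_M) : fc f A * cellmx r 1 A k = (c k)%:C%C *: cellmx r 1 A k.
  have -> : (c k)%:C%C *: cellmx r 1 A k = fc (fun=> c k) A * cellmx r 1 A k.
    by rewrite fc_cst scalemulAl mul1r.
  rewrite /cellmx !fcM; apply: fc_ext => x.
  by case: eqP => [/fc_c->|_]; rewrite ?mulr0.
apply: (pinch_label (c := fun k : 'I_M => c k)) => // k.
by rewrite -e /cellmx !fcM; apply: fc_ext => x; rewrite mulrC.
Qed.

Lemma pinch_comm n (A B Z : 'M[C]_n) r M : herm A -> Z * A = A * Z -> Z * B = B * Z ->
  Z * pinch (fun k : 'I_M => cellmx r 1 A k) B =
  pinch (fun k : 'I_M => cellmx r 1 A k) B * Z.
Proof.
move=> hA ZA ZB.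
have ZE (k : 'I_M) : Z * cellmx r 1 A k = cellmx r 1 A k * Z.
  by apply/esym; apply: cellmx_comm.
by rewrite (pinch_comml _ ZE) (pinch_commr _ ZE) ZB.
Qed.

Lemma near_jump (m k : nat) (x : R) : inner (dev x) != 0 ->
  cell (m%:R + 1 / 2) 1 x = k%:Z ->
  k%:R * 1 - (m%:R + 1 / 2) + 1 / 10 <= x /\ x <= k.+1%:R * 1 - (m%:R + 1 / 2) - 1 / 10.
Proof.
move/inner_neq0; rewrite cell_floor ler_norml => d4 e.
have : rd x = k%:R - m%:R by rewrite /rd -[Num.floor _](addrK m%:Z) e intrB -!pmulrn.
have : x = rd x + dev x by rewrite /dev addrC subrK.
move: d4; move: (rd x) (dev x) => r d; rewrite -[k.+1%:R]natr1; move: (k%:R : R) (m%:R : R); clear.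
by move=> a b /andP[? ?] ? ?; split; lra.
Qed.

Lemma far_from_jump (m k : nat) (x : R) : outer (dev x) != 0 ->
  cell m%:R 1 x = k%:Z ->
  k%:R * 1 - m%:R + 1 / 5 <= x /\ x <= k.+1%:R * 1 - m%:R - 1 / 5.
Proof.
move/outer_neq0 => d2 e; have /eqP := e; rewrite cellP ?ltr01 //.
rewrite intrD mulr1z -pmulrn natr1 => /andP[h1 h2].
have n1 := le_trans d2 (dev_nearest x (k%:Z - m%:Z)).
have n2 := le_trans d2 (dev_nearest x (k.+1%:Z - m%:Z)).
move: n1 n2; rewrite !intrB -!pmulrn; move: h1 h2; rewrite -[k.+1%:R]natr1.
move: (k%:R : R) (m%:R : R); clear => a b h1 h2.
rewrite [`|x - (a - b)|]ger0_norm; last by lra.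
rewrite [`|x - (a + 1 - b)|]ler0_norm; last by lra.
by move=> *; split; lra.
Qed.

(** Choose [phi] by [glued_cut], with [Bf] the block diagonal part of [B] for the
unit intervals between integers and with the model of one jump built from [D]
and the block diagonal part [Bd] of [B] for the unit intervals centred at the
integers; [Bd] commutes exactly with [rd A]. The cut [p] is the spectral
projection of [phi] on the nonpositive axis. Its commutator with [A] is that of
[p] with [A - (rd A + P) = D - P], which has norm at most [3 / 2]. The cutoffs
[inner] and [outer] vary at scale 1 in [A], which has norm up to [N], whence the
condition on [N * opn (A * B - B * A)]. *)
Lemma approx_cut (e : R) : 0 < e -> exists2 eta : R, 0 < eta &
  forall n (N : R) (A B : 'M[C]_n), herm A -> herm B -> 1 <= N -> opn A <= N -> opn B <= 1 ->
    N * opn (A * B - B * A) <= eta -> exists p : 'M[C]_n,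
  [/\ herm p /\ p * p = p,
      forall M, M * A = A * M -> M * B = B * M -> M * p = p * M,
      opn (p * fc upper B) <= e, opn ((1 - p) * fc upper (- B)) <= e &
      opn (p * A - A * p) <= 3].
Proof.
move=> e0; pose e1 := e / 20; have e10 : 0 < e1 by rewrite divr_gt0.
pose mu := e1 / 60; have mu0 : 0 < mu by rewrite divr_gt0.
have [d1 d10 local] := local_model mu0.
have [d2 d20 upP] := fc_intertwine_small 1 (ucont_ramp (@upper_lt R)) (ramp_osc _ _) e10 ler01.
have d220 : 0 < d2 / 2 by rewrite divr_gt0.
have [d3 d30 inP] := fc_intertwine_small 1 (@ucont_inner R) (@inner_osc R) d220 ler01.
pose w : R := Num.min 1 (d2 / 80).
have w0 : 0 < w by rewrite lt_min ltr01 divr_gt0.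
have w1 : w <= 1 by rewrite ge_min lexx.
have wd : w <= d2 / 80 by rewrite ge_min lexx orbT.
have c10 : 0 < d2 / 120 by rewrite divr_gt0.
have c20 : 0 < e1 / 60 by rewrite divr_gt0.
have c30 : 0 < d2 * w ^+ 2 / 6 by rewrite divr_gt0 // mulr_gt0 // exprn_gt0.
exists (Num.min (Num.min d1 d3) (Num.min (d2 / 120) (Num.min (e1 / 60) (d2 * w ^+ 2 / 6)))).
  by rewrite !lt_min d10 d30 c10 c20 c30.
move=> n N A B hA hB N1 AN B1 small.
have [/le_min_both[sm1 sm3] /le_min_both[sm2 /le_min_both[sm4 sm5]]] := le_min_both small.
set eta := opn (A * B - B * A) in small sm1 sm2 sm3 sm4 sm5 *.
have eta0 : 0 <= eta := opnorm_ge0 _.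
have etaN : eta <= N * eta by rewrite ler_peMl.
pose m := (Num.truncn N).+1.
have Nm : N < m%:R by exact: truncnS_gt.
have mN : m%:R <= N + 1.
  by rewrite /m -natr1 lerD2r truncn_le //; exact: le_trans ler01 N1.
pose M := (2 * m + 2)%N.
have MN : M%:R <= 6 * N by rewrite /M natrD natrM; move: mN N1; clear; lra.
have rM : 2 * (m%:R + 1 / 2) < 1 * M%:R :> R by rewrite /M natrD natrM; clear; lra.
have rM' : 2 * m%:R < 1 * M%:R :> R by rewrite /M natrD natrM; clear; lra.
have Ar : opn A <= m%:R + 1 / 2 by move: AN Nm; clear; lra.
have Ar' : opn A <= m%:R by move: AN Nm; clear; lra.
pose E (k : 'I_M) := cellmx (m%:R + 1 / 2) 1 A k.
pose E' (k : 'I_M) := cellmx m%:R 1 A k.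
have bE : blocks E by exact: cellmx_blocks.
have bE' : blocks E' by exact: cellmx_blocks.
pose Bd := pinch E B; pose Bf := pinch E' B.
pose D := fc dev A; have hD : herm D by exact: fc_herm.
have DE : D = A - fc rd A by rewrite -{1}(fc_id hA) fcB.
have hBd : herm Bd by exact: pinch_herm.
have hBf : herm Bf by exact: pinch_herm.
have Bd1 : opn Bd <= 1 by exact: le_trans (pinch_norm bE B) B1.
have Bf1 : opn Bf <= 1 by exact: le_trans (pinch_norm bE' B) B1.
have A0Bd : fc rd A * Bd = Bd * fc rd A.
  apply: (@label_cells n A B rd _ M (fun k => k%:R - m%:R) hA) => x k.
  by rewrite cell_floor => ek; rewrite /rd -[Num.floor _](addrK m%:Z) ek intrB -!pmulrn.
have FBf : fc floor_succ A * Bf = Bf * fc floor_succ A.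
  apply: (@label_cells n A B floor_succ _ M (fun k => k%:R - m%:R + 1) hA) => x k.
  rewrite -[m%:R]addr0 cell_floor !addr0 => ek.
  by rewrite /floor_succ -[Num.floor _](addrK m%:Z) ek intrB -!pmulrn.
have DBd : opn (D * Bd - Bd * D) <= eta.
  have -> : D * Bd - Bd * D = pinch E (A * B - B * A).
    have AE k : A * E k = E k * A by apply/esym; apply: cellmx_comm.
    rewrite pinchB -pinch_comml // -pinch_commr // -/Bd DE mulrBl mulrBr A0Bd.
    by rewrite opprB addrA subrK.
  exact: pinch_norm.
have D1 : opn D <= 1 / 2 by apply: fc_norm_ev => [|j]; rewrite ?dev_norm //; clear; lra.
have [P [Y [[hP PP hY] Y1 [PY cPY] hmu [up1 up2]]]] :=
  local n D Bd hD hBd D1 Bd1 (le_trans DBd (le_trans etaN sm1)).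
have cBd Z : Z * A = A * Z -> Z * B = B * Z -> Z * Bd = Bd * Z by exact: pinch_comm.
have cBf Z : Z * A = A * Z -> Z * B = B * Z -> Z * Bf = Bf * Z by exact: pinch_comm.
have cD Z : Z * A = A * Z -> Z * D = D * Z by move=> ZA; apply/esym; apply: fc_comm.
have A0D : fc rd A * D = D * fc rd A by rewrite !fcM; apply: fc_ext => x; rewrite mulrC.
have [A0P A0Y] := cPY _ A0D A0Bd.
pose G := fc outer D; pose Gt := fc inner D.
have tau1 : 0 < 1 / 10 :> R by clear; lra.
have tau2 : 0 < 1 / 5 :> R by clear; lra.
have s1 : opn ((B - Bd) * Gt) <= d2 / 2.
  rewrite /Gt /D fc_comp; apply: (le_trans (pinch_cells_near B hA Ar ltr01 rM tau1 _ _)).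
  - by move=> x; exact: inner_norm.
  - by move=> x k; exact: near_jump.
  - rewrite -/eta; apply: (@le_trans _ _ (6 * N * (eta / (1 / 10)))).
      by rewrite ler_wpM2r // divr_ge0 // ltW.
    move: sm2; clear; lra.
have s2 : opn ((B - Bf) * fc (fun x => outer (dev x)) A) <= e1 / 2.
  apply: (le_trans (pinch_cells_near B hA Ar' ltr01 rM' tau2 _ _)).
  - by move=> x; exact: outer_norm.
  - by move=> x k; exact: far_from_jump.
  - rewrite -/eta; apply: (@le_trans _ _ (6 * N * (eta / (1 / 5)))).
      by rewrite ler_wpM2r // divr_ge0 // ltW.
    move: sm4; clear; lra.
have e120 : 0 <= e1 / 2 by rewrite divr_ge0 // ltW.
have [phi [hphi phiK cphi phiE]] := glued_cut hA hP PP hY Y1 hBf Bf1 PY A0P A0Y FBf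
  (ltW mu0) e120 hmu s2.
rewrite -/D -/Gt -/G in phiE.
have phie : opn (phi - (Gt * Y * Gt + G * B * G)) <= e1.
  by apply: le_trans phiE _; rewrite /mu; clear; lra.
have GB : opn (B * G - G * B) <= d2.
  pose M' := (Num.truncn (2 * N / w)).+1.
  have rM2 : 2 * N < w * M'%:R by rewrite [w * _]mulrC -ltr_pdivrMr // truncnS_gt.
  have M'N : M'%:R <= 3 * N / w.
    have Nw0 : 0 <= 2 * N / w.
      by rewrite divr_ge0 ?(ltW w0) // mulr_ge0 //; exact: le_trans ler01 N1.
    have h1 : M'%:R <= 2 * N / w + 1 by rewrite /M' -natr1 lerD2r truncn_le.
    have h2 : 1 <= N / w by rewrite ler_pdivlMr // mul1r; exact: le_trans w1 N1.
    by apply: le_trans h1 _; move: h2; rewrite -!mulrA; clear; lra.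
  have om x y : `|x - y| <= w -> `|outer (dev x) - outer (dev y)| <= 10 * w.
    by move=> xy; apply: le_trans (outer_dev_lipschitz x y) _; rewrite ler_pM2l.
  have := fc_intertwine_approx B hA hA AN AN w0 rM2 om (@outer_dev_osc R).
  rewrite /G /D fc_comp opnormBC -/eta => h; apply: le_trans h _.
  have t1 : 4 * (10 * w) * opn B <= d2 / 2.
    have Bw : 4 * (10 * w) * opn B <= 4 * (10 * w) * 1.
      by rewrite ler_wpM2l // mulr_ge0 // mulr_ge0 // ltW.
    by move: Bw wd; clear; lra.
  have t2 : M'%:R * (1 / w) * eta <= d2 / 2.
    apply: (@le_trans _ _ (3 * N / w * (1 / w) * eta)).
      by rewrite ler_wpM2r // ler_wpM2r // divr_ge0 // ltW.
    have -> : 3 * N / w * (1 / w) * eta = 3 * (N * eta) / w ^+ 2 by field; exact: lt0r_neq0.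
    rewrite ler_pdivrMr ?exprn_gt0 //; move: sm5; clear; lra.
  by move: t1 t2; clear; lra.
have hG : herm G by exact: fc_herm.
have hGt : herm Gt by exact: fc_herm.
have G1 : opn G <= 1 by apply: fc_norm1; exact: outer_norm.
have Gt1 : opn Gt <= 1 by apply: fc_norm1; exact: inner_norm.
have GtB : opn (Bd * Gt - Gt * B) <= d2.
  have Dn1 : opn D <= 1 by apply: le_trans D1 _; clear; lra.
  have h1 : opn (Gt * Bd - Bd * Gt) <= d2 / 2.
    exact: (inP n _ _ _ hD hD Dn1 Dn1 Bd1 (le_trans DBd (le_trans etaN sm3))).
  have h2 : opn (Gt * (B - Bd)) <= d2 / 2 by rewrite -opnorm_adj adjM adjB hB hBd hGt.
  have -> : Bd * Gt - Gt * B = - ((Gt * Bd - Bd * Gt) + Gt * (B - Bd)).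
    by rewrite mulrBr; mx_linear.
  rewrite opnormN; apply: le_trans (opnormD_le h1 h2) _; clear; lra.
have cover v : l2norm v ^+ 2 <= l2norm (G *m v) ^+ 2 + l2norm (Gt *m v) ^+ 2.
  rewrite -(fc_sqr_norm D outer) -(fc_sqr_norm D inner).
  rewrite -ripDr -mulmxDl fcD -[leLHS]mul1r.
  by apply: fc_ge => y; exact: outer_inner_cover.
(* the same estimate serves both ends, after changing the signs of phi, Y and B *)
pose p := fc (fun x : R => if x <= 0 then 1 else 0) phi.
have hp : herm p by exact: fc_herm.
have pp : p * p = p by rewrite fcM; apply: fc_ext => x; case: (x <= 0); rewrite ?mulr1 ?mulr0.
have [hp' pp'] := projC hp pp.
have pp1 := proj_norm hp pp; have pp1' := proj_norm hp' pp'.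
have p'E : 1 - p = fc (fun x : R => if 0 < x then 1 else 0) phi.
  rewrite -(fc1 phi) fcB; apply: fc_ext => x; case: leP; rewrite ?subrr ?subr0 //.
have form0 v : rip v (fc (fun=> 0) phi *m v) = 0 by rewrite fc0 mul0mx rip0r.
have neg v : rip (p *m v) (phi *m (p *m v)) <= 0.
  rewrite fc_form_conj // -[leRHS](form0 v); apply: fc_form_le => x.
  by case: (leP x 0) => x0; rewrite ?mulr0 ?lexx // mulr1 mul1r.
have neg' v : rip ((1 - p) *m v) (- phi *m ((1 - p) *m v)) <= 0.
  rewrite p'E mulNmx ripNr fc_form_conj // oppr_le0.
  rewrite -[leLHS](form0 v); apply: fc_form_le => x.
  by case: (ltP 0 x) => x0; rewrite ?mulr0 ?lexx // mulr1 mul1r ltW.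
have phip : phi * p = p * phi by rewrite fcX.
have phip' : - phi * (1 - p) = (1 - p) * - phi.
  by rewrite mulNr mulrN mulrBr mulrBl mulr1 mul1r phip.
have opN1 (Z : 'M[C]_n) c : opn Z <= c -> opn (- Z) <= c by rewrite opnormN.
have GBN : opn (- B * G - G * - B) <= d2 by rewrite opp_comm opnormN.
have GtBN : opn (- Bd * Gt - Gt * - B) <= d2.
  by rewrite mulNr mulrN -opprD opnormN.
have Bn1 := opN1 _ _ B1; have Bdn1 := opN1 _ _ Bd1.
have upG := upP n _ _ _ hB hB B1 B1 G1 GB.
have upGN := upP n _ _ _ (hermN hB) (hermN hB) Bn1 Bn1 G1 GBN.
have upGt := upP n _ _ _ hBd hB Bd1 B1 Gt1 GtB.
have upGtN := upP n _ _ _ (hermN hBd) (hermN hB) Bdn1 Bn1 Gt1 GtBN.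
rewrite opnormBC in upG; rewrite opnormBC in upGN.
rewrite opnormBC in upGt; rewrite opnormBC in upGtN.
have mue : mu <= e1 by rewrite /mu; move: e10; clear; lra.
have phieN : opn (- phi - (Gt * - Y * Gt + G * - B * G)) <= e1.
  by rewrite !mulrN !mulNr -opprD -opprD opnormN.
have end1 := end_estimate hY hB hG hGt Y1 B1 G1 Gt1 cover pp1 phip neg phie upG upGt
  (le_trans up1 mue).
have end2 := end_estimate (hermN hY) (hermN hB) hG hGt (opN1 _ _ Y1) Bn1 G1 Gt1 cover pp1'
  phip' neg' phieN upGN upGtN (le_trans up2 mue).
exists p; split => //.
- move=> Z ZA ZB; have [ZP ZY] := cPY Z (cD Z ZA) (cBd Z ZA ZB).
  by apply/esym; apply: fc_comm => //; apply/esym; exact: cphi (cBf Z ZA ZB) ZP ZY.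
- by move: end1; rewrite /e1; clear; lra.
- by move: end2; rewrite /e1; clear; lra.
- have -> : p * A - A * p = p * (D - P) - (D - P) * p.
    have pK : p * (fc rd A + P) = (fc rd A + P) * p by exact: fc_comm.
    have AE : A = fc rd A + P + (D - P) by rewrite DE; mx_linear.
    rewrite {1 2}AE mulrDr [X in _ - X]mulrDl pK.
    by rewrite opprD addrACA subrr add0r.
  have P1 := proj_norm hP PP.
  have DP : opn (D - P) <= 3 / 2 by apply: le_trans (opnormB_le D1 P1) _; clear; lra.
  by apply: le_trans (opnormB_le (opnormM_le pp1 DP) (opnormM_le DP pp1)) _; clear; lra.
Qed.

End ApproximateCut.

(** * Exact cuts *)

Section ExactCut.
Context {R : realType}.
Local Notation C := R[i].

(** In [fc_intertwine_approx] the cell width [w] enters as [w * opn A] and as the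
commutator divided by [w ^+ 2]. Making the first term small takes [w] of order
[1 / N], and the second one is then of order [N ^+ 2] times the commutator. *)
Lemma lower_ramp_comm (n : nat) (N K : R) (A B : 'M[C]_n) : herm A -> herm B -> 1 <= N ->
  opn A <= N -> opn B <= 1 -> 1600 <= K ->
  N ^+ 2 * opn (A * B - B * A) <= (60 * K ^+ 2)^-1 ->
  opn (fc lower_ramp B * A - A * fc lower_ramp B) <= 1 / 10.
Proof.
move=> hA hB N1 AN B1 K1 small.
have N0 : 0 < N by exact: lt_le_trans ltr01 N1.
have K0 : 0 < K by apply: lt_le_trans K1; rewrite ltr0n.
pose w := (K * N)^-1; have w0 : 0 < w by rewrite invr_gt0 mulr_gt0.
pose M := (Num.truncn (2 * 1 / w)).+1.
have rM : 2 * 1 < w * M%:R by rewrite [w * _]mulrC -ltr_pdivrMr // truncnS_gt.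
have KN1 : 1 <= K * N.
  by rewrite -[1]mulr1; apply: ler_pM => //; apply: le_trans K1; rewrite ler1n.
have MN : M%:R <= 3 * (K * N).
  have h : M%:R <= 2 * 1 / w + 1.
    rewrite /M -natr1 lerD2r truncn_le // divr_ge0 ?(ltW w0) // mulr_ge0 //.
  by apply: le_trans h _; rewrite /w invrK; move: KN1; clear; lra.
have om (x y : R) : `|x - y| <= w -> `|lower_ramp x - lower_ramp y| <= 20 * w.
  move=> xy; rewrite /lower_ramp (_ : _ - _ = - (ramp (9 / 10) (19 / 20) x - ramp (9 / 10) (19 / 20) y)); last by ring.
  rewrite normrN; apply: le_trans (ramp_lipschitz x y (@lower_ramp_lt R)) _.
  have -> : (19 / 20 - 9 / 10)^-1 = 20 :> R by field.
  by rewrite ler_pM2l.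
have := fc_intertwine_approx A hB hB B1 B1 w0 rM om (ramp_compl_osc (9 / 10) (19 / 20)).
rewrite [opn (B * A - A * B)]opnormBC; set eta := opn (A * B - B * A) in small *.
move=> h; apply: le_trans h _.
have t1 : 4 * (20 * w) * opn A <= 1 / 20.
  apply: (@le_trans _ _ (4 * (20 * w) * N)).
    by rewrite ler_wpM2l // mulr_ge0 // mulr_ge0 // ltW.
  have -> : 4 * (20 * w) * N = 80 / K by rewrite /w; field; rewrite !lt0r_neq0.
  by rewrite ler_pdivrMr //; move: K1; clear; lra.
have t2 : M%:R * (1 / w) * eta <= 1 / 20.
  have -> : M%:R * (1 / w) * eta = M%:R * (K * N * eta) by rewrite /w div1r invrK; ring.
  have eta0 : 0 <= eta := opnorm_ge0 _.
  apply: (@le_trans _ _ (3 * (K * N) * (K * N * eta))).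
    by rewrite ler_wpM2r // mulr_ge0 // mulr_ge0 // ltW.
  have -> : 3 * (K * N) * (K * N * eta) = 3 * K ^+ 2 * (N ^+ 2 * eta) by ring.
  have K3 : 0 <= 3 * K ^+ 2 by rewrite mulr_ge0 // sqr_ge0.
  apply: le_trans (ler_wpM2l K3 small) _; rewrite le_eqVlt; apply/orP; left; apply/eqP.
  by field; rewrite lt0r_neq0.
by move: t1 t2; clear; lra.
Qed.

Lemma exact_cut : exists2 eta : R, 0 < eta &
  forall n (N : R) (A B : 'M[C]_n), herm A -> herm B -> 1 <= N -> opn A <= N -> opn B <= 1 ->
    N ^+ 2 * opn (A * B - B * A) <= eta -> exists P : 'M[C]_n,
  [/\ herm P, P * P = P,
      forall M, M * A = A * M -> M * B = B * M -> M * P = P * M,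
      (forall s : R -> R, (forall x, s x != 0 -> 19 / 20 <= x) -> P * fc s B = 0) /\
      (forall s : R -> R, (forall x, s x != 0 -> x <= - (19 / 20)) -> P * fc s B = fc s B)
    & opn ((1 - P) * A * P) <= 8].
Proof.
have e0 : 0 < 1 / 80 :> R by clear; lra.
have [eta eta0 cut] := approx_cut e0.
pose K : R := 1600; have K0 : 0 < (60 * K ^+ 2)^-1 by rewrite invr_gt0 mulr_gt0 // exprn_gt0 // ltr0n.
exists (Num.min eta (60 * K ^+ 2)^-1) => [|n N A B hA hB N1 AN B1 /le_min_both[sm1 sm2]].
  by rewrite lt_min eta0.
have N0 : 0 <= N by exact: le_trans ler01 N1.
have sm : N * opn (A * B - B * A) <= eta.
  apply: le_trans sm1; rewrite ler_wpM2r ?opnorm_ge0 //.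
  by rewrite expr2 ler_peMr.
have [p [[hp pp] cp pu pl pA]] := cut n N A B hA hB N1 AN B1 sm.
have c1 := lower_ramp_comm hA hB N1 AN B1 (lexx _) sm2.
have c2 : opn (fc lower_ramp (- B) * A - A * fc lower_ramp (- B)) <= 1 / 10.
  apply: (lower_ramp_comm hA (hermN hB) N1 AN _ (lexx K)); first by rewrite opnormN.
  by rewrite mulrN mulNr -opprD opnormN.
have [P [hP PP cP ends PA]] := exact_ends hA hB hp pp pu pl c1 c2 pA.
exists P; split => //.
- by move=> M MA MB; apply: cP => //; exact: cp.
- by apply: le_trans PA _; clear; lra.
Qed.

End ExactCut.

(** * Assembling the strips *)

Section Assembly.
Context {R : realType}.
Local Notation C := R[i].

Section Mask.
Variables (n : nat) (I : finType) (E : I -> 'M[C]_n) (l : I -> nat).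
Hypothesis bE : blocks E.

(** The part of [A] that links blocks with the same label. *)
Definition mask (A : 'M[C]_n) := \sum_k \sum_k' (if l k == l k' then E k * A * E k' else 0).

Lemma mask_block A k k' : E k * mask A * E k' = if l k == l k' then E k * A * E k' else 0.
Proof.
have Ekk : E k * E k = E k by rewrite (blockM bE) eqxx.
have Ekk' : E k' * E k' = E k' by rewrite (blockM bE) eqxx.
rewrite /mask mulr_sumr mulr_suml (bigD1 k) //= [X in _ + X]big1 ?addr0 => [|j jk].
  rewrite mulr_sumr mulr_suml (bigD1 k') //= big1 ?addr0 => [|j jk'].
    by case: eqP => _; rewrite ?mulr0 ?mul0r // !mulrA Ekk -mulrA Ekk'.
  case: eqP => _; rewrite ?mulr0 ?mul0r // -!mulrA (blockM bE) (negPf jk') !mulr0 //.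
rewrite mulr_sumr mulr_suml big1 // => j' _.
by case: eqP => _; rewrite ?mulr0 ?mul0r // !mulrA (blockM bE) eq_sym (negPf jk) !mul0r.
Qed.

Lemma mask_herm A : herm A -> herm (mask A).
Proof.
move=> hA; rewrite /herm /mask adj_sum; under eq_bigr do rewrite adj_sum.
rewrite exchange_big; apply: eq_bigr => k _; apply: eq_bigr => k' _.
rewrite eq_sym; case: eqP => _; last exact: adj0.
by rewrite !adjM hA !(block_herm bE) mulrA.
Qed.

Lemma mask_comm A B (b : nat -> R) : (forall k, B * E k = (b (l k))%:C%C *: E k) ->
  (forall k, E k * B = (b (l k))%:C%C *: E k) -> mask A * B = B * mask A.
Proof.
move=> BE EB; rewrite /mask mulr_sumr mulr_suml; apply: eq_bigr => k _.
rewrite mulr_sumr mulr_suml; apply: eq_bigr => k' _.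
case: eqP => [lk|_]; last by rewrite mulr0 mul0r.
by rewrite !mulrA BE -mulrA EB scalemulAr !scalemulAl lk.
Qed.

End Mask.

(** Bounds for [B] on the two parts of strip [k] of [B], which is centred at
[2 k - 2 m]: the lower part ([b = true], the range of [P]) misses the upper end
of the strip, the upper part ([b = false]) misses the lower end. The upper part
of a strip shares its label with the lower part of the next one. *)
Definition strip_lo (m k : nat) (b : bool) : R :=
  2 * k%:R - 2 * m%:R - (if b then 1 else 19 / 20).
Definition strip_hi (m k : nat) (b : bool) : R :=
  2 * k%:R - 2 * m%:R + (if b then 19 / 20 else 1).
Definition strip_label (k : nat) (b : bool) : nat := if b then k else k.+1.

Lemma strip_gap m k k' b b' : (k < k')%N -> strip_label k b != strip_label k' b' ->
  1 / 20 <= strip_lo m k' b' - strip_hi m k b.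
Proof.
rewrite /strip_lo /strip_hi /strip_label leq_eqVlt => /orP[/eqP <-|kk].
  by rewrite -[k.+1%:R]natr1; move: (k%:R : R) (m%:R : R) => x y;
     case: b; case: b' => //=; rewrite ?eqxx // => _; clear; lra.
have : k%:R + 2 <= k'%:R :> R by rewrite -natrD ler_nat addn2.
move: (k%:R : R) (k'%:R : R) (m%:R : R) => x x' y.
by case: b; case: b' => xx _; move: xx; clear; lra.
Qed.

Lemma sandwich_norm n (X p A q Y : 'M[C]_n) : opn X <= 1 -> opn Y <= 1 ->
  opn ((X * p) * A * (q * Y)) <= opn (p * A * q).
Proof.
move=> X1 Y1; have -> : (X * p) * A * (q * Y) = X * (p * A * q) * Y by rewrite !mulrA.
rewrite -[leRHS]mul1r -[leRHS]mulr1; apply: opnormM_le => //.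
exact: opnormM_le.
Qed.

(** On the glued block with label [l], the value of [B'] is the common end
[2 l - 2 m - 1] of the strips [l - 1] and [l]. The difference [A - A'] splits into
the blocks [V] between the two parts of a single strip, controlled by
[exact_cut], and a rest [T] whose blocks link pieces of the spectrum of [B] that
are separated by [1 / 20]. There are at most [12 N] blocks in a row, so the
condition on the commutator bounds [T]. *)
Lemma commuting_at_unit_scale : exists2 eta : R, 0 < eta &
  forall n (N : R) (A B : 'M[C]_n), herm A -> herm B -> 1 <= N -> opn A <= N -> opn B <= N ->
    N ^+ 2 * opn (A * B - B * A) <= eta -> exists A' B' : 'M[C]_n,
  [/\ herm A', herm B', A' * B' = B' * A', opn (A - A') <= 17 & opn (B - B') <= 3].
Proof.
have [eta1 eta10 cut] := @exact_cut R.
have c0 : 0 < 1 / 240 :> R by clear; lra.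
exists (Num.min eta1 (1 / 240)); first by rewrite lt_min eta10.
move=> n N A B hA hB N1 AN BN /le_min_both[sm1 sm2].
set eta := opn (A * B - B * A) in sm1 sm2.
have eta0 : 0 <= eta := opnorm_ge0 _.
have N0 : 0 < N by exact: lt_le_trans ltr01 N1.
pose m := (Num.truncn N).+1.
have Nm : N < m%:R by exact: truncnS_gt.
have mN : m%:R <= N + 1 by rewrite /m -natr1 lerD2r truncn_le // ltW.
pose M := (2 * m + 2)%N.
have MN : M%:R <= 6 * N by rewrite /M natrD natrM; move: mN N1; clear; lra.
pose r : R := 2 * m%:R + 1.
have rM : 2 * r < 2 * M%:R by rewrite /M /r natrD natrM; clear; lra.
have Br : opn B <= r by rewrite /r; move: BN Nm N0; clear; lra.
have two0 : 0 < 2 :> R by [].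
pose F (k : 'I_M) := cellmx r 2 B k.
have bF : blocks F by exact: cellmx_blocks.
pose jl (x : R) : R := 2 * (cell r 2 x)%:~R - 2 * m%:R.
have jlP x (k : nat) : cell r 2 x = k%:Z -> jl x = 2 * k%:R - 2 * m%:R.
  by rewrite /jl => ->; rewrite -pmulrn.
have jl_bound x : -1 <= x - jl x <= 1.
  have /esym := cellP r x (cell r 2 x) two0; rewrite eqxx intrD /r /jl.
  move: ((cell _ _ _)%:~R) => q /andP[]; rewrite mulr1z; clear => *.
  by apply/andP; split; lra.
pose J := fc jl B; pose Bt := fc (fun x => x - jl x) B.
have BtE : Bt = B - J by rewrite -{1}(fc_id hB) /J fcB.
pose Ac := pinch F A.
have hAc : herm Ac by exact: pinch_herm.
have hJ : herm J by exact: fc_herm.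
have hBt : herm Bt by exact: fc_herm.
have JF (k : 'I_M) : J * F k = (2 * k%:R - 2 * m%:R)%:C%C *: F k.
  have -> : (2 * k%:R - 2 * m%:R)%:C%C *: F k = fc (fun=> 2 * k%:R - 2 * m%:R) B * F k.
    by rewrite fc_cst scalemulAl mul1r.
  rewrite /F /J /cellmx !fcM; apply: fc_ext => x.
  by case: eqP => [/jlP->|_]; rewrite ?mulr0.
have FJ (k : 'I_M) : F k * J = (2 * k%:R - 2 * m%:R)%:C%C *: F k.
  by rewrite -JF /F /J /cellmx !fcM; apply: fc_ext => x; rewrite mulrC.
have JAc : J * Ac = Ac * J by exact: (pinch_label A JF FJ).
have BF k : B * F k = F k * B by apply/esym; exact: cellmx_comm.
have AcBt : opn (Ac * Bt - Bt * Ac) <= eta.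
  have -> : Ac * Bt - Bt * Ac = pinch F (A * B - B * A).
    rewrite pinchB -(pinch_commr _ BF) -(pinch_comml _ BF) -/Ac BtE mulrBr mulrBl JAc.
    by rewrite opprB addrA subrK.
  exact: pinch_norm.
have Bt1 : opn Bt <= 1 by apply: fc_norm1 => x; rewrite ler_norml jl_bound.
have AcN : opn Ac <= N by exact: le_trans (pinch_norm bF A) AN.
have sm3 : N ^+ 2 * opn (Ac * Bt - Bt * Ac) <= eta1.
  by apply: le_trans sm1; rewrite ler_wpM2l ?sqr_ge0.
have [P [hP PP cP [Phi Plo] PA]] := cut n N Ac Bt hAc hBt N1 AcN Bt1 sm3.
have FAc k : F k * Ac = Ac * F k by rewrite pinch_mull // pinch_mulr.
have FBt (k : 'I_M) : F k * Bt = Bt * F k.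
  by rewrite /F /Bt /cellmx !fcM; apply: fc_ext => x; rewrite mulrC.
have FP k : F k * P = P * F k by apply: cP; [exact: FAc|exact: FBt].
have JP : J * P = P * J.
  by apply: cP => //; rewrite /J /Bt !fcM; apply: fc_ext => x; rewrite mulrC.
have [P' P'E] : exists P', P' = 1 - P by eexists.
have [hP' PP'] : herm P' /\ P' * P' = P' by rewrite P'E; exact: projC.
have PP'0 : P * P' = 0 by rewrite P'E mulrBr mulr1 PP subrr.
have P'P0 : P' * P = 0 by rewrite P'E mulrBl mul1r PP subrr.
have sP : P + P' = 1 by rewrite P'E addrC subrK.
have FP' k : F k * P' = P' * F k by rewrite P'E mulrBr mulrBl mulr1 mul1r FP.
pose S (b : bool) := if b then P else P'.
have FS k b : F k * S b = S b * F k by case: b; [exact: FP|exact: FP'].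
have SS b b' : S b * S b' = if b == b' then S b else 0 by case: b; case: b'.
have hS b : herm (S b) by case: b.
have S1 b : opn (S b) <= 1 by case: b; exact: proj_norm.
pose E (t : 'I_M * bool) := F t.1 * S t.2.
have bE : blocks E.
  split=> [[k b]|[k b] [k' b']|].
  - by rewrite /herm /E adjM hS (block_herm bF) FS.
  - rewrite /E /= -mulrA (mulrA (S b)) -FS !mulrA (blockM bF) -mulrA SS.
    have [->|kk] := eqVneq k k'; last by rewrite mul0r xpair_eqE (negPf kk).
    by rewrite xpair_eqE eqxx /=; case: eqP => [->|_] //; rewrite mulr0.
  - rewrite -(pair_bigA _ (fun k b => F k * S b)) /=.
    have [_ _ <-] := bF; apply: eq_bigr => k _.
    by rewrite big_bool /= -mulrDr sP mulr1.
pose l (t : 'I_M * bool) := strip_label t.1 t.2.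
pose A' := mask E l A.
pose B' := J + 1 - (P + P).
have B'E t : B' * E t = (2 * (l t)%:R - 2 * m%:R - 1)%:C%C *: E t.
  have JE : J * E t = (2 * t.1%:R - 2 * m%:R)%:C%C *: E t by rewrite /E mulrA JF scalemulAl.
  have PE : P * E t = if t.2 then E t else 0.
    by rewrite /E mulrA -FP -mulrA; case: (t.2); rewrite /= ?PP // PP'0 mulr0.
  rewrite /B' mulrBl mulrDl mul1r mulrDl JE PE /l /strip_label; case: (t.2).
    move: (2 * t.1%:R - 2 * m%:R) => c.
    by rewrite rmorphB scalerBl rmorph1 scale1r opprD addrA addrK.
  rewrite addr0 subr0 (_ : 2 * t.1.+1%:R - 2 * m%:R - 1 = 2 * t.1%:R - 2 * m%:R + 1).
    move: (2 * t.1%:R - 2 * m%:R) => c.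
    by rewrite rmorphD scalerDl rmorph1 scale1r.
  by rewrite -natr1; ring.
have hB' : herm B' by apply: hermB; apply: hermD => //; exact: herm1.
have EB' t : E t * B' = (2 * (l t)%:R - 2 * m%:R - 1)%:C%C *: E t.
  have := congr1 (@adj R n n) (B'E t); rewrite adjM hB' (block_herm bE) => ->.
  by have /(_ n (E t) (block_herm bE t)) := @hermZ R _ (2 * (l t)%:R - 2 * m%:R - 1).
exists A', B'; split => //.
- exact: mask_herm.
- exact: (mask_comm _ (b := fun k => 2 * k%:R - 2 * m%:R - 1)).
- pose V := P * Ac * P' + P' * Ac * P.
  have Vn : opn V <= 16.
    have h1 : opn (P' * Ac * P) <= 8 by rewrite P'E.
    have h2 : opn (P * Ac * P') <= 8 by rewrite -opnorm_adj !adjM hP hP' hAc mulrA.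
    by apply: le_trans (opnormD_le h2 h1) _; clear; lra.
  pose sup (t : 'I_M * bool) (x : R) : R :=
    if (cell r 2 x == t.1) && (if t.2 then x - jl x < 19 / 20 else - (19 / 20) < x - jl x)
    then 1 else 0.
  have sup1 t x : `|sup t x| <= 1 by rewrite /sup; case: ifP; rewrite ?normr1 ?normr0.
  have supP t x : sup t x != 0 -> strip_lo m t.1 t.2 <= x /\ x <= strip_hi m t.1 t.2.
    rewrite /sup; case: ifP => [/andP[/eqP ck] +|_]; last by rewrite eqxx.
    have := jl_bound x; rewrite (jlP _ _ ck) /strip_lo /strip_hi => /andP[].
    move: (t.1%:R : R) (m%:R : R) => q q'.
    by clear; case: (t.2) => ? ? ? _; split; lra.
  pose cut_off (b : bool) (y : R) : R :=
    if (if b then 19 / 20 <= y else y <= - (19 / 20)) then 1 else 0.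
  have cut0 b : fc (cut_off b) Bt * S b = 0.
    rewrite -[LHS]adjK adjM fc_herm hS -[RHS](adj0 n n); congr adj; case: b => /=.
      by apply: Phi => x; rewrite /cut_off /=; case: ifP; rewrite ?eqxx.
    rewrite P'E mulrBl mul1r Plo ?subrr // => x.
    by rewrite /cut_off /=; case: ifP; rewrite ?eqxx.
  have Esup t : fc (sup t) B * E t = E t.
    case: t => k b; rewrite /E /= mulrA.
    have -> : fc (sup (k, b)) B * F k = F k * (1 - fc (cut_off b) Bt).
      rewrite /Bt fc_comp mulrBr mulr1 /F /cellmx !fcM fcB; apply: fc_ext => x.
      rewrite /sup /cut_off /=; case: eqP => ck /=; last by rewrite !mul0r subrr.
      by case: b; [case: ltP|case: (ltP (- (19 / 20)))]; rewrite !mulr1 ?mulr0 ?subr0 ?subrr.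
    by rewrite -mulrA mulrBl mul1r cut0 subr0.
  have supE t : E t * fc (sup t) B = E t.
    by rewrite -[LHS]adjK adjM fc_herm (block_herm bE) Esup (block_herm bE).
  have far t t' : 1 / 20 * opn (E t * A * E t') <= eta \/ (t.1 = t'.1 \/ l t = l t').
    have [|tt'] := eqVneq t.1 t'.1; first by right; left.
    have [|ll'] := eqVneq (l t) (l t'); first by right; right.
    left; have hAB : opn (B * A - A * B) = eta by rewrite opnormBC.
    apply: (@le_trans _ _ (1 / 20 * opn (fc (sup t) B * A * fc (sup t') B))).
      rewrite ler_wpM2l //.
      rewrite -[X in X * A](supE t) -[X in _ * A * X](Esup t').
      by apply: sandwich_norm; exact: block_norm bE _.
    have g0 := opnorm_ge0 (fc (sup t) B * A * fc (sup t') B).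
    rewrite -hAB; case: (ltngtP t.1 t'.1) => [lt|gt|eq]; last by rewrite (val_inj eq) eqxx in tt'.
      apply: (le_trans (ler_wpM2r g0 (strip_gap m lt ll'))).
      by apply: gap_le => // x /supP[].
    have ll : strip_label t'.1 t'.2 != strip_label t.1 t.2 by rewrite eq_sym.
    apply: (le_trans (ler_wpM2r g0 (strip_gap m gt ll))).
    by apply: gap_ge => // x /supP[].
  have Vblock t t' : E t * V * E t' =
      if (t.1 == t'.1) && (t.2 != t'.2) then E t * A * E t' else 0.
    case: t t' => [k b] [k' b']; rewrite /E /=.
    have -> : F k * S b * V * (F k' * S b') = S b * (F k * F k') * V * S b'.
      have FV : F k' * V = V * F k'.
        by apply: commrD; apply: commrM; rewrite /GRing.comm ?FP ?FP' //; apply: commrM;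
           rewrite /GRing.comm ?FP ?FP' ?FAc.
      by rewrite FS -!mulrA (mulrA V) -FV !mulrA.
    rewrite (blockM bF); have [<-|kk] := eqVneq k k'; last by rewrite mulr0 !mul0r.
    have -> : S b * F k * V * S b' = F k * (S b * V * S b') by rewrite -FS !mulrA.
    have -> : S b * V * S b' = if b != b' then S b * Ac * S b' else 0.
      rewrite /V; case: b; case: b'; rewrite /= mulrDr mulrDl !mulrA ?PP ?PP' ?PP'0 ?P'P0
        ?mul0r ?addr0 ?add0r -?mulrA ?PP ?PP' ?PP'0 ?P'P0 ?mulr0 //.
    rewrite /=; case: (b == b') => /=; first by rewrite mulr0.
    transitivity (S b * (F k * A * F k) * S b').
      by rewrite -(pinch_mull bF) !mulrA FS.
    by rewrite !mulrA -FS.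
  pose T := A - A' - V.
  (* the cutoff 1/20 of strip_gap turns the commutator into the bound 20 eta *)
  have Tblock t t' : opn (E t * T * E t') <= 20 * eta.
    rewrite /T mulrBr mulrBl mulrBr mulrBl (mask_block l bE) Vblock.
    have nil : opn (0 : 'M[C]_n) <= 20 * eta by rewrite opnorm0 mulr_ge0.
    case: (far t t') => [h|same].
      have h20 : opn (E t * A * E t') <= 20 * eta by move: h; clear; lra.
      have [ll|ll] := eqVneq (l t) (l t').
        have -> : (t.1 == t'.1) && (t.2 != t'.2) = false.
          apply/negP => /andP[/eqP k1 /negP b1]; apply: b1; move: ll.
          rewrite /l /strip_label k1; case: (t.2); case: (t'.2) => // /eqP.
            by rewrite eqn_leq ltnn andbF.
          by rewrite eqn_leq ltnn.
        by rewrite subrr subr0.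
      by rewrite subr0; case: ifP => _; rewrite ?subr0 // subrr.
    have [ll|ll] := eqVneq (l t) (l t').
      have -> : (t.1 == t'.1) && (t.2 != t'.2) = false.
        apply/negP => /andP[/eqP k1 /negP b1]; apply: b1; move: ll.
        rewrite /l /strip_label k1; case: (t.2); case: (t'.2) => // /eqP.
          by rewrite eqn_leq ltnn andbF.
        by rewrite eqn_leq ltnn.
      by rewrite subrr subr0.
    case: same => [kk|ll']; last by rewrite ll' eqxx in ll.
    have -> : (t.1 == t'.1) && (t.2 != t'.2).
      by rewrite kk eqxx /=; apply: contra_neq ll => bb; rewrite /l kk bb.
    by rewrite subr0 subrr.
  have Tn : opn T <= 1.
    apply: (@le_trans _ _ ((2 * M)%:R * (20 * eta))).
      apply: (@schur_test _ _ _ _ E E _ (fun _ _ => 20 * eta)) => //.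
      - by rewrite mulr_ge0 ?ler0n // mulr_ge0.
      - by move=> _; rewrite sumr_const card_prod card_ord card_bool -[leLHS]mulr_natl [(M * 2)%N]mulnC.
      - by move=> _; rewrite sumr_const card_prod card_ord card_bool -[leLHS]mulr_natl [(M * 2)%N]mulnC.
    have NN : N * eta <= N ^+ 2 * eta by rewrite expr2 ler_wpM2r // ler_peMl // ltW.
    have := ler_wpM2r eta0 MN; rewrite natrM; move: sm2 NN; clear; lra.
  have -> : A - A' = V + T by rewrite /T [RHS]addrC subrK.
  by apply: le_trans (opnormD_le Vn Tn) _; clear; lra.
- have -> : B - B' = Bt + (P - P').
    have regroup (X Y Z W : 'M[C]_n) : X - (Y + W - (Z + Z)) = X - Y + (Z - (W - Z)).
      by mx_linear.
    by rewrite BtE /B' P'E; exact: regroup.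
  have h : opn (P - P') <= 2.
    by apply: le_trans (opnormB_le (proj_norm hP PP) (proj_norm hP' PP')) _; clear; lra.
  by apply: le_trans (opnormD_le Bt1 h) _; clear; lra.
Qed.

End Assembly.

(** * Rescaling *)

Lemma subpolynomial_cst (R : realType) (c : R) : subpolynomial (fun=> c).
Proof.
move=> a a0; rewrite -(mulr0 c); apply: cvgM; first exact: cvg_cst.
apply/cvgrPdist_lt => e e0.
near=> t.
have t0 : 0 < t by near: t; exact: nbhs_pinfty_gt.
have te : (e^-1 + 1) `^ (a^-1) <= t by near: t; exact: nbhs_pinfty_ge.
have e10 : 0 <= e^-1 + 1 by rewrite addr_ge0 // invr_ge0 ltW.
rewrite sub0r normrN ger0_norm ?invr_ge0 ?powR_ge0 //.
rewrite invf_plt ?posrE ?powR_gt0 //.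
have := @ge0_ler_powR R a (ltW a0) ((e^-1 + 1) `^ a^-1) t.
rewrite !nnegrE powR_ge0 (ltW t0) => /(_ isT isT te).
rewrite -powRrM mulVf ?lt0r_neq0 // powRr1 //.
by apply: lt_le_trans; rewrite ltrDl.
Unshelve. all: by end_near. Qed.

Lemma powR_sixthK (R : realType) (x : R) : 0 <= x -> (x `^ (1 / 6)) ^+ 6 = x.
Proof. by move=> x0; rewrite -powR_mulrn ?powR_ge0 // -powRrM mul1r mulVf // powRr1. Qed.

Theorem theorem2p1 (R : realType) :
  exists (delta0 : R) (E : R -> R),
    [/\ 0 < delta0,
        (forall t : R, 0 < t -> 0 < E t),
        subpolynomial E &
        let beta : R := 1 / 6 in
        let epsilon : R -> R := fun delta => E (1 / delta) * delta `^ beta in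
        forall delta : R, 0 < delta -> delta < delta0 ->
        forall n : nat, (1 <= n)%N ->
        forall A B : 'M[R[i]]_n,
          A \is hermsymmx -> B \is hermsymmx ->
          opnorm A <= 1 -> opnorm B <= 1 ->
          opnorm (commutator A B) <= delta ->
          exists A' B' : 'M[R[i]]_n,
            [/\ A' \is hermsymmx, B' \is hermsymmx,
                commutator A' B' = 0,
                opnorm (A - A') <= epsilon delta &
                opnorm (B - B') <= epsilon delta]].
Proof.
have [eta eta0 unit_scale] := @commuting_at_unit_scale R.
exists (Num.min 1 (eta ^+ 3)), (fun=> 17); split.
- by rewrite lt_min ltr01 exprn_gt0.
- by move=> *; rewrite ltr0n.
- exact: subpolynomial_cst.
move=> beta epsilon delta d0; rewrite lt_min => /andP[d1 de] n _ A B.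
move=> /hermsymmxP hA /hermsymmxP hB; rewrite -!opnE => A1 B1 AB.
rewrite /epsilon /beta; have := powR_sixthK (ltW d0).
have := powR_gt0 (1 / 6) d0; move: (delta `^ (1 / 6)) => s s0 s6.
have [N Ns] : exists N, N * s = 1 by exists s^-1; rewrite mulVf ?lt0r_neq0.
have N0 : 0 < N by rewrite -(pmulr_lgt0 _ s0) Ns.
have s1 : s <= 1 by rewrite -(@expr_le1 _ 6) ?(ltW s0) // s6 ltW.
have N1 : 1 <= N by rewrite -(ler_pM2r s0) Ns mul1r.
have scaled (X : 'M[R[i]]_n) : opn X <= 1 -> opn (N%:C%C *: X) <= N.
  by move=> X1; apply: le_trans (opnormZ _ _) _; rewrite gtr0_norm // ger_pMr.
have small : N ^+ 2 * opn (N%:C%C *: A * (N%:C%C *: B) - N%:C%C *: B * (N%:C%C *: A)) <= eta.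
  have -> : N%:C%C *: A * (N%:C%C *: B) - N%:C%C *: B * (N%:C%C *: A) =
      (N ^+ 2)%:C%C *: (A * B - B * A).
    by rewrite !scalemulAl !scalemulAr !scalerA -rmorphM -scalerBr expr2.
  apply: le_trans (_ : N ^+ 2 * (N ^+ 2 * delta) <= _).
    rewrite ler_wpM2l ?sqr_ge0 //; apply: le_trans (opnormZ _ _) _.
    by rewrite ger0_norm ?sqr_ge0 // ler_wpM2l ?sqr_ge0.
  have -> : N ^+ 2 * (N ^+ 2 * delta) = s ^+ 2.
    by transitivity ((N * s) ^+ 4 * s ^+ 2); [rewrite -s6; ring | rewrite Ns expr1n mul1r].
  by rewrite -(@ler_pXn2r _ 3) ?nnegrE ?sqr_ge0 ?(ltW eta0) // -exprM s6 ltW.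
have [A' [B' [hA' hB' AB' nA nB]]] :=
  unit_scale n N _ _ (hermZ N hA) (hermZ N hB) N1 (scaled A A1) (scaled B B1) small.
have back (X X' : 'M[R[i]]_n) : opn (N%:C%C *: X - X') <= 17 ->
    opn (X - s%:C%C *: X') <= 17 * s.
  move=> h; have -> : X - s%:C%C *: X' = s%:C%C *: (N%:C%C *: X - X').
    by rewrite scalerBr scalerA -rmorphM mulrC Ns rmorph1 scale1r.
  by apply: le_trans (opnormZ _ _) _; rewrite gtr0_norm // mulrC ler_pM2r.
exists (s%:C%C *: A'), (s%:C%C *: B'); split.
- by apply/hermsymmxP; exact: hermZ.
- by apply/hermsymmxP; exact: hermZ.
- rewrite /commutator -!scalemxAl -!scalemxAr; apply/eqP; rewrite subr_eq0; apply/eqP.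
  by congr (_ *: (_ *: _)); exact: AB'.
- by rewrite -opnE; exact: back.
- by rewrite -opnE; apply: back; apply: le_trans nB _; rewrite ler_nat.
Qed.
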